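(* Let $\zeta_1,\zeta_2,\zeta_3$ be three equi-spaced points on the unit circle $\mathbb{T}$ (i.e. $\zeta_2=\zeta_1\omega$, $\zeta_3=\zeta_1\omega^2$ with $\omega=e^{2\pi i/3}$), and let $\mu=\delta_{\zeta_1}+\delta_{\zeta_2}+\delta_{\zeta_3}$, where $\delta_\zeta$ denotes the unit point mass at $\zeta$. Then the Cauchy dual $M_z'$ of the operator $M_z$ of multiplication by the coordinate function $z$ on the Dirichlet-type space $D(\mu)$ is not subnormal.
   Context: $\mathbb{D}$ is the open unit disc, $\mathbb{T}$ the unit circle, $dA$ the normalized Lebesgue area measure on $\mathbb{D}$. For a finite positive Borel measure $\mu$ on $\mathbb{T}$, $P_\mu(z)=\int_{\mathbb{T}}\frac{1-|z|^2}{|z-\zeta|^2}\,d\mu(\zeta)$ is its Poisson integral, and the Dirichlet-type space is $D(\mu)=\{f \text{ holomorphic on } \mathbb{D}: \int_{\mathbb{D}}|f'(z)|^2P_\mu(z)\,dA(z)<\infty\}$ (such $f$ automatically lie in the Hardy space $H^2$), with norm $\|f\|_\mu^2=\|f\|_{H^2}^2+\int_{\mathbb{D}}|f'(z)|^2P_\mu(z)\,dA(z)$; $M_z f(z)=zf(z)$ is a bounded left-invertible operator on $D(\mu)$. For a left-invertible bounded operator $T$ on a Hilbert space, its Cauchy dual is $T'=T(T^*T)^{-1}$. An operator $T$ on a Hilbert space $\mathcal{H}$ is subnormal if there is a Hilbert space $\mathcal{K}\supseteq\mathcal{H}$ and a normal operator $S$ on $\mathcal{K}$ with $S|_{\mathcal{H}}=T$.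 *)

(* Defs.v *)
From HB Require Import structures.
From mathcomp Require Import all_boot all_order all_algebra.
From mathcomp Require Import all_classical all_reals all_analysis.
From mathcomp Require Import complex.
Import Order.TTheory GRing.Theory Num.Theory.

Set Implicit Arguments.
Unset Strict Implicit.
Unset Printing Implicit Defensive.

Local Open Scope ring_scope.
Local Open Scope classical_set_scope.

Definition re {R : realType} (z : R[i]) : R := @complex.Re R z.
Definition im {R : realType} (z : R[i]) : R := @complex.Im R z.
Definition cmod {R : realType} (z : R[i]) : R := Num.sqrt (re z ^+ 2 + im z ^+ 2).

Definition in_disc {R : realType} (z : R[i]) : Prop := cmod z < 1.

Definition has_cderiv {R : realType} (f : R[i] -> R[i]) (z w : R[i]) : Prop :=
  forall e : R, 0 < e -> exists2 d : R, 0 < d &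
    forall h : R[i], h != 0 -> cmod h < d ->
      cmod ((f (z + h) - f z) / h - w) < e.

Definition holomorphic_on_disc {R : realType} (f : R[i] -> R[i]) : Prop :=
  forall z, in_disc z -> exists w, has_cderiv f z w.

Definition cderiv {R : realType} (f : R[i] -> R[i]) (z : R[i]) : R[i] :=
  xget 0 [set w | has_cderiv f z w].

(* Poisson integral of a finite sum of unit point masses on T:
   mu = \sum_(zeta <- pts) delta_zeta, so that
   P_mu(z) = \int_T (1-|z|^2)/|z-zeta|^2 dmu(zeta)
           = \sum_(zeta <- pts) (1-|z|^2)/|z-zeta|^2.                  *)
Definition poisson_pts {R : realType} (pts : seq R[i]) (z : R[i]) : R :=
  \sum_(zeta <- pts) (1 - cmod z ^+ 2) / cmod (z - zeta) ^+ 2.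

(* Weighted Dirichlet integral
     \int_D |f'(z)|^2 P_mu(z) dA(z),
   dA = normalized area measure = (1/pi) dx dy on D.                   *)
Definition dirichlet_int {R : realType} (pts : seq R[i]) (f : R[i] -> R[i])
  : \bar R :=
  ((pi^-1)%:E *
   \int[(@lebesgue_measure R \x @lebesgue_measure R)%E]_(p in
        [set p : R * R | (p.1 ^+ 2 + p.2 ^+ 2 < 1)%R])
      ((cmod (cderiv f (Complex p.1 p.2)) ^+ 2
         * poisson_pts pts (Complex p.1 p.2))%R%:E))%E.

Definition H2_norm2 {R : realType} (f : R[i] -> R[i]) : \bar R :=
  ereal_sup [set (((2 * pi)^-1)%R%:E *
      \int[@lebesgue_measure R]_(t in [set t : R | (0 <= t <= 2 * pi)%R])
        ((cmod (f (Complex (r * cos t) (r * sin t)))) ^+ 2)%R%:E)%E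
    | r in [set r : R | 0 <= r < 1]].

Definition in_Dmu {R : realType} (pts : seq R[i]) (f : R[i] -> R[i]) : Prop :=
  holomorphic_on_disc f /\ (dirichlet_int pts f < +oo)%E.

(* ||f||_mu^2 = ||f||_{H^2}^2 + \int_D |f'|^2 P_mu dA  (finite on D(mu)). *)
Definition Dmu_norm2 {R : realType} (pts : seq R[i]) (f : R[i] -> R[i]) : R :=
  fine (H2_norm2 f + dirichlet_int pts f)%E.

(* Elements of D(mu) are holomorphic functions on D: they are identified
   when they agree on D. Vector operations are pointwise. *)
Definition eq_on_disc {R : realType} (f g : R[i] -> R[i]) : Prop :=
  forall z, in_disc z -> f z = g z.
Definition fadd {R : realType} (f g : R[i] -> R[i]) : R[i] -> R[i] :=
  fun z => f z + g z.
Definition fscale {R : realType} (c : R[i]) (f : R[i] -> R[i]) : R[i] -> R[i] :=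
  fun z => c * f z.

(* Inner product of D(mu), obtained from the norm by polarization
   (linear in the first argument):
   <f,g> = 1/4 \sum_{k=0}^{3} i^k ||f + i^k g||^2. *)
Definition Dmu_inner {R : realType} (pts : seq R[i]) (f g : R[i] -> R[i]) : R[i] :=
  (4%:R)^-1 * \sum_(k < 4)
     (Complex 0 1) ^+ k * Complex (Dmu_norm2 pts (fadd f (fscale ((Complex 0 1) ^+ k) g))) 0.

Definition Mz {R : realType} (f : R[i] -> R[i]) : R[i] -> R[i] := fun z => z * f z.

Definition is_adjoint_Dmu {R : realType} (pts : seq R[i])
  (T A : (R[i] -> R[i]) -> (R[i] -> R[i])) : Prop :=
  (forall g, in_Dmu pts g -> in_Dmu pts (A g)) /\
  forall f g, in_Dmu pts f -> in_Dmu pts g ->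
    Dmu_inner pts (T f) g = Dmu_inner pts f (A g).

(* Tp is the Cauchy dual T' = T (T^* T)^{-1} of T on D(mu):
   for every x in D(mu), T' x = T y where y in D(mu) solves T^* T y = x. *)
Definition is_cauchy_dual_Dmu {R : realType} (pts : seq R[i])
  (T Tp : (R[i] -> R[i]) -> (R[i] -> R[i])) : Prop :=
  exists A, is_adjoint_Dmu pts T A /\
    forall x, in_Dmu pts x ->
      exists y, [/\ in_Dmu pts y, eq_on_disc (A (T y)) x & eq_on_disc (Tp x) (T y)].

Record hilbert (R : realType) := Hilbert {
  hcar :> lmodType R[i];
  hinner : hcar -> hcar -> R[i];
  hinner_linl : forall (a : R[i]) (x y z : hcar),
      hinner (a *: x + y) z = a * hinner x z + hinner y z;
  hinner_conj : forall x y : hcar, hinner y x = conjc (hinner x y);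
  hinner_pos : forall x : hcar, x != 0 -> 0 < hinner x x;
  hcomplete : forall u : nat -> hcar,
      (forall e : R, 0 < e -> exists N : nat, forall m n : nat,
         (N <= m)%N -> (N <= n)%N -> re (hinner (u m - u n) (u m - u n)) < e) ->
      exists l : hcar, forall e : R, 0 < e -> exists N : nat, forall n : nat,
         (N <= n)%N -> re (hinner (u n - l) (u n - l)) < e
}.

Definition bounded_linear {R : realType} (K : hilbert R) (S : K -> K) : Prop :=
  (forall (a : R[i]) (x y : K), S (a *: x + y) = a *: S x + S y) /\
  exists M : R, forall x : K,
    re (hinner (S x) (S x)) <= M * re (hinner x x).

Definition normal_op {R : realType} (K : hilbert R) (S : K -> K) : Prop :=
  bounded_linear S /\
  exists Sadj : K -> K,
    (forall x y : K, hinner (S x) y = hinner x (Sadj y)) /\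
    (forall x : K, S (Sadj x) = Sadj (S x)).

(* T on D(mu) is subnormal: there is a Hilbert space K containing D(mu)
   (through a linear isometric embedding J) and a normal operator S on K
   whose restriction to D(mu) is T. *)
Definition subnormal_Dmu {R : realType} (pts : seq R[i])
  (T : (R[i] -> R[i]) -> (R[i] -> R[i])) : Prop :=
  exists (K : hilbert R) (J : (R[i] -> R[i]) -> K) (S : K -> K),
    [/\ forall (a : R[i]) f g, in_Dmu pts f -> in_Dmu pts g ->
          J (fadd (fscale a f) g) = a *: J f + J g,
        forall f, in_Dmu pts f -> hinner (J f) (J f) = Complex (Dmu_norm2 pts f) 0,
        normal_op S
      & forall f, in_Dmu pts f -> S (J f) = J (T f)].

Definition omega3 {R : realType} : R[i] :=
  Complex (cos (2 * pi / 3%:R)) (sin (2 * pi / 3%:R)).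

(* Main.v *)
Require Import Defs.
From HB Require Import structures.
From mathcomp Require Import all_boot all_order all_algebra.
From mathcomp Require Import all_classical all_reals all_analysis.
From mathcomp Require Import complex measurable_realfun.
From mathcomp Require Import ring lra zify.
Import Order.TTheory GRing.Theory Num.Theory.
Import numFieldNormedType.Exports.
Set Implicit Arguments.
Unset Strict Implicit.
Unset Printing Implicit Defensive.
Local Open Scope ring_scope.
Local Open Scope classical_set_scope.

(* Write q for the conjugate of zeta^3. The Poisson kernels of the three points
   add up to 3 (1 - |z|^6) / |1 - q z^3|^2, so if f = \sum_k a_k z^k and
   f' / (1 - q z^3) = \sum_k G_k z^k, Parseval's identity for radial weights gives
     ||f||^2 = \sum_k |a_k|^2 + \sum_k 9 / ((k+1) (k+4)) |G_k|^2.
   Let f_0 = 1 and f_(n+1) = M_z' f_n. Since <z g, f_(n+1)> = <g, f_n>, the function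
   f_n represents the functional "n-th Taylor coefficient". Testing f_n against
   polynomials h_l for which the sequence G is the l-th unit vector yields, along each
   residue class mod 3, the recurrence x_(i+2) = 11 x_(i+1) - x_i beyond the index n;
   as Taylor coefficients grow subexponentially, the solution is geometric with ratio
   the small root lam = (11 - 3 sqrt 13) / 2. This determines
     m_n = ||f_n||^2   for n = 1, .., 5.
   If M_z' had a normal extension S then, with A = S^* S and v the image of 1, these
   would be the moments <A^n v, v>, and
   0 <= |S (I - A) (2 A - I) v|^2 = m_1 - 6 m_2 + 13 m_3 - 12 m_4 + 4 m_5,
   whereas the right-hand side is about -0.046. *)

(** * Complex numbers and power series *)

(** No formula for [M_z'] is used. The constants are orthogonal to z D(mu) and f_(n+1) is z times an
    element of D(mu), so testing against z g determines f_(n+1) completely. As f_n represents the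
    n-th coefficient, ||f_n||^2 is itself the n-th coefficient of f_n: each norm asks for a single
    number, found inside one residue class mod 3. The polynomial comes from second differences. A
    normal extension makes every form sum c_i c_j m_(i+j+1) nonnegative, whether or not S is a
    contraction. The differences u_n = m_n - 2 m_(n+1) + m_(n+2) are about 0.0555, 0.0303 and 0.0051
    for n = 1, 2, 3, against the inequality u_2^2 <= u_1 u_3 that positivity would give. The factor
    I - A, squared, produces the u_n, and 2 A - I is a simple integral choice at which the remaining
    form u_1 - 4 u_2 + 4 u_3 is negative. The area integrals are computed without polar coordinates:
    scaling gives the radial moments, and averaging over roots of unity gives the orthogonality of
    the monomials. *)

Lemma cmod_normc (R : realType) (z : R[i]) : cmod z = ComplexField.Normc.normc z.
Proof. by case: z. Qed.

Lemma cmod_ge0 (R : realType) (z : R[i]) : 0 <= cmod z.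
Proof. exact: sqrtr_ge0. Qed.

Lemma cmod_sqr (R : realType) (z : R[i]) : cmod z ^+ 2 = re z ^+ 2 + im z ^+ 2.
Proof. by rewrite /cmod sqr_sqrtr // addr_ge0 // sqr_ge0. Qed.

Lemma cmodM (R : realType) (x y : R[i]) : cmod (x * y) = cmod x * cmod y.
Proof. by rewrite !cmod_normc ComplexField.Normc.normcM. Qed.

Lemma cmodV (R : realType) (x : R[i]) : cmod x^-1 = (cmod x)^-1.
Proof. by rewrite !cmod_normc ComplexField.Normc.normcV. Qed.

Lemma cmodD (R : realType) (x y : R[i]) : cmod (x + y) <= cmod x + cmod y.
Proof. by rewrite !cmod_normc le_normcD. Qed.

Lemma cmodN (R : realType) (x : R[i]) : cmod (- x) = cmod x.
Proof. by rewrite !cmod_normc normcN. Qed.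

Lemma cmodB (R : realType) (x y : R[i]) : cmod (x - y) <= cmod x + cmod y.
Proof. by rewrite -(cmodN y) cmodD. Qed.

Lemma cmod0 (R : realType) : cmod (0 : R[i]) = 0.
Proof. by rewrite cmod_normc ComplexField.Normc.normc0. Qed.

Lemma cmod1 (R : realType) : cmod (1 : R[i]) = 1.
Proof. by rewrite cmod_normc ComplexField.Normc.normc1. Qed.

Lemma cmod_eq0 (R : realType) (x : R[i]) : (cmod x == 0) = (x == 0).
Proof.
apply/eqP/eqP => [|->]; last exact: cmod0.
by rewrite cmod_normc => /ComplexField.Normc.eq0_normc.
Qed.

Lemma cmod_gt0 (R : realType) (x : R[i]) : (0 < cmod x) = (x != 0).
Proof. by rewrite lt_neqAle cmod_ge0 andbT eq_sym cmod_eq0. Qed.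

Lemma cmodX (R : realType) (x : R[i]) n : cmod (x ^+ n) = cmod x ^+ n.
Proof. by elim: n => [|n IH]; rewrite ?expr0 ?cmod1 // !exprS cmodM IH. Qed.

Lemma cmod_real (R : realType) (x : R) : cmod (x%:C)%C = `|x|.
Proof. by rewrite /cmod /= expr0n addr0 sqrtr_sqr. Qed.

Lemma cmod_conj (R : realType) (x : R[i]) : cmod (x^*)%C = cmod x.
Proof. by case: x => a b; rewrite /cmod /= sqrrN. Qed.

Lemma cmod_sum (R : realType) (n : nat) (F : nat -> R[i]) :
  cmod (\sum_(i < n) F i) <= \sum_(i < n) cmod (F i).
Proof.
elim: n => [|n IH]; first by rewrite !big_ord0 cmod0.
by rewrite !big_ord_recr /= (le_trans (cmodD _ _)) // lerD2r.
Qed.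

Lemma le_cmodB_cmod (R : realType) (x y : R[i]) : cmod x - cmod y <= cmod (x - y).
Proof. by rewrite lerBlDr -{1}(subrK y x) cmodD. Qed.

Lemma cmodBC (R : realType) (x y : R[i]) : cmod (x - y) = cmod (y - x).
Proof. by rewrite -cmodN opprB. Qed.

Lemma norm_re_le (R : realType) (z : R[i]) : `|re z| <= cmod z.
Proof.
rewrite -(@ler_pXn2r _ 2) ?nnegrE ?cmod_ge0 // cmod_sqr.
by rewrite real_normK ?num_real // lerDl sqr_ge0.
Qed.

Lemma norm_im_le (R : realType) (z : R[i]) : `|im z| <= cmod z.
Proof.
rewrite -(@ler_pXn2r _ 2) ?nnegrE ?cmod_ge0 // cmod_sqr.
by rewrite real_normK ?num_real // lerDr sqr_ge0.
Qed.

Lemma cmod_le_reim (R : realType) (z : R[i]) : cmod z <= `|re z| + `|im z|.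
Proof.
rewrite -(@ler_pXn2r _ 2) ?nnegrE ?cmod_ge0 ?addr_ge0 // cmod_sqr.
rewrite sqrrD !real_normK ?num_real // addrAC lerDl.
by rewrite mulrn_wge0 // mulr_ge0.
Qed.

Lemma reD (R : realType) (x y : R[i]) : re (x + y) = re x + re y.
Proof. by case: x; case: y. Qed.

Lemma imD (R : realType) (x y : R[i]) : im (x + y) = im x + im y.
Proof. by case: x; case: y. Qed.

Lemma reN (R : realType) (x : R[i]) : re (- x) = - re x.
Proof. by case: x. Qed.

Lemma imN (R : realType) (x : R[i]) : im (- x) = - im x.
Proof. by case: x. Qed.

Lemma reM (R : realType) (x y : R[i]) : re (x * y) = re x * re y - im x * im y.
Proof. by case: x; case: y. Qed.

Lemma imM (R : realType) (x y : R[i]) : im (x * y) = re x * im y + im x * re y.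
Proof. by case: x; case: y. Qed.

Lemma reJ (R : realType) (x : R[i]) : re (x^*)%C = re x.
Proof. by case: x. Qed.

Lemma imJ (R : realType) (x : R[i]) : im (x^*)%C = - im x.
Proof. by case: x. Qed.

Lemma complex_ext (R : realType) (x y : R[i]) : re x = re y -> im x = im y -> x = y.
Proof. by case: x => a b; case: y => c d /= -> ->. Qed.

Lemma cmod_mulJ (R : realType) (x : R[i]) : x * (x^*)%C = ((cmod x ^+ 2)%:C)%C.
Proof.
apply: complex_ext; rewrite ?reM ?imM ?reJ ?imJ /= ?cmod_sqr.
  by rewrite mulrN opprK !expr2.
by rewrite mulrN mulrC addNr.
Qed.

Lemma cmodD_sqr (R : realType) (x y : R[i]) :
  cmod (x + y) ^+ 2 = cmod x ^+ 2 + cmod y ^+ 2 + 2 * re (x * (y^*)%C).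
Proof. by rewrite !cmod_sqr reD imD reM reJ imJ; ring. Qed.

Lemma cmod_small (R : realType) (z : R[i]) : (forall e : R, 0 < e -> cmod z <= e) -> z = 0.
Proof.
move=> H; apply/eqP; rewrite -cmod_eq0 eq_le cmod_ge0 andbT.
by apply/ler_addgt0Pr => e e0; rewrite add0r H.
Qed.

(* Coefficients of a power series whose radius of convergence is at least 1. *)
Definition subexp (R : realType) (a : nat -> R[i]) :=
  forall r : R, 0 < r -> r < 1 -> exists C : R, forall n, cmod (a n) * r ^+ n <= C.

Definition psn (R : realType) (a : nat -> R[i]) (n : nat) (z : R[i]) :=
  \sum_(k < n) a k * z ^+ k.

(** [limn] is total, so the value is meaningful only where the partial sums converge; [subexp a] and
    [cmod z < 1] guarantee this. *)
Definition psum (R : realType) (a : nat -> R[i]) (z : R[i]) : R[i] :=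
  Complex (limn (fun n => re (psn a n z))) (limn (fun n => im (psn a n z))).

Lemma geo_sum_le (R : realType) (q : R) m n : 0 <= q -> q < 1 ->
  \sum_(m <= k < n) q ^+ k <= q ^+ m / (1 - q).
Proof.
move=> q0 q1; have q1' : 0 < 1 - q by rewrite subr_gt0.
have [mn|/ltnW nm] := leqP m n; last by rewrite big_geq // divr_ge0 // ?exprn_ge0 // ltW.
rewrite ler_pdivlMr //.
suff -> : (\sum_(m <= k < n) q ^+ k) * (1 - q) = q ^+ m - q ^+ n.
  by rewrite lerBlDr lerDl exprn_ge0.
elim: n mn => [|n IH]; first by rewrite leqn0 => /eqP ->; rewrite big_geq // mul0r subrr.
rewrite leq_eqVlt => /predU1P[->|]; first by rewrite big_geq // mul0r subrr.
by rewrite ltnS => mn; rewrite big_nat_recr //= mulrDl IH // exprS; ring.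
Qed.

(** Comparison with the geometric series of ratio [r / r']: the k-th term is at most C (r / r')^k in
    modulus. *)
Lemma psn_cauchy (R : realType) (a : nat -> R[i]) (r r' C : R) : 0 < r -> r < r' ->
  (forall n, cmod (a n) * r' ^+ n <= C) ->
  forall z, cmod z <= r -> forall n m, (n <= m)%N ->
  cmod (psn a m z - psn a n z) <= C / (1 - r / r') * (r / r') ^+ n.
Proof.
move=> r0 rr' aC z zr n m nm.
have r'0 : 0 < r' by exact: lt_trans rr'.
have q0 : 0 <= r / r' by rewrite divr_ge0 // ltW.
have q1 : r / r' < 1 by rewrite ltr_pdivrMr // mul1r.
have C0 : 0 <= C by apply: le_trans (aC 0%N); rewrite mulr_ge0 ?cmod_ge0 ?exprn_ge0 // ltW.
have -> : psn a m z - psn a n z = \sum_(n <= k < m) a k * z ^+ k.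
  rewrite /psn -!(big_mkord xpredT (fun k => a k * z ^+ k)) (big_cat_nat (leq0n n) nm) /=.
  by rewrite addrAC subrr add0r.
have H k : cmod (a k * z ^+ k) <= C * (r / r') ^+ k.
  have zk : cmod z ^+ k <= r ^+ k by rewrite lerXn2r ?nnegrE ?cmod_ge0 // ltW.
  rewrite cmodM cmodX (le_trans (ler_wpM2l (cmod_ge0 _) zk)) //.
  have -> : cmod (a k) * r ^+ k = (cmod (a k) * r' ^+ k) * (r / r') ^+ k.
    by rewrite expr_div_n; field; rewrite expf_neq0 // gt_eqF.
  by apply: ler_wpM2r (aC k); rewrite exprn_ge0.
apply: le_trans (_ : \sum_(n <= k < m) C * (r / r') ^+ k <= _).
  elim: m nm => [|m IH]; first by rewrite leqn0 => /eqP->; rewrite !big_geq // cmod0.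
  rewrite leq_eqVlt => /predU1P[->|]; first by rewrite !big_geq // cmod0.
  rewrite ltnS => nm; rewrite !big_nat_recr //=.
  by rewrite (le_trans (cmodD _ _)) // lerD // IH.
rewrite -mulr_sumr -mulrA ler_wpM2l // [leRHS]mulrC; exact: geo_sum_le.
Qed.

Lemma seq_cauchy_cvg (R : realType) (u : nat -> R) (K q : R) : 0 <= q -> q < 1 ->
  (forall n m, (n <= m)%N -> `|u m - u n| <= K * q ^+ n) ->
  cvgn u /\ forall n, `|limn u - u n| <= K * q ^+ n.
Proof.
move=> q0 q1 H.
have qn0 : (fun n => K * q ^+ n) @ \oo --> 0.
  rewrite -[0](mulr0 K); apply: cvgM; first exact: cvg_cst.
  by apply: cvg_expr; rewrite ger0_norm.
have cu : cvgn u.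
  apply/cauchy_cvgP; apply: cauchy_exP => e e0.
  have /cvgrPdist_lt/(_ _ e0) [N _ HN] := qn0.
  exists (u N); exists N => // m /= Nm.
  rewrite /ball /= distrC (le_lt_trans (H _ _ Nm)) //.
  by have := HN _ (leqnn N); rewrite sub0r normrN; apply: le_lt_trans; exact: ler_norm.
split=> // n; apply/ler_addgt0Pr => e e0.
have /cvgrPdist_lt/(_ _ e0) [N _ HN] := cu.
have HM := HN (maxn N n) (leq_maxl _ _); have Hm := H n (maxn N n) (leq_maxr _ _).
rewrite -[limn u](subrK (u (maxn N n))) -addrA (le_trans (ler_normD _ _)) // [leRHS]addrC lerD //.
exact: ltW.
Qed.

Lemma psum_tail (R : realType) (a : nat -> R[i]) (r : R) : subexp a -> 0 < r -> r < 1 ->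
  exists K q : R, [/\ 0 <= K, 0 <= q, q < 1 & forall z, cmod z <= r ->
    forall n, cmod (psum a z - psn a n z) <= K * q ^+ n].
Proof.
move=> ga r0 r1; pose r' := (r + 1) / 2.
have rr' : r < r' by rewrite /r'; lra.
have r'1 : r' < 1 by rewrite /r'; lra.
have r'0 : 0 < r' by lra.
have [C HC] := ga _ r'0 r'1.
have C0 : 0 <= C by apply: le_trans (HC 0%N); rewrite mulr_ge0 ?cmod_ge0 ?exprn_ge0 // ltW.
have q0 : 0 <= r / r' by rewrite divr_ge0 // ltW.
have q1 : r / r' < 1 by rewrite ltr_pdivrMr // mul1r.
(* The factor 2 pays for estimating real and imaginary parts separately. *)
exists (2 * (C / (1 - r / r'))), (r / r'); split => //.
  by rewrite mulr_ge0 // divr_ge0 // subr_ge0 ltW.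
move=> z zr n; have H := psn_cauchy r0 rr' HC zr.
have [_ /(_ n) Hr] : cvgn (fun n => re (psn a n z)) /\ forall n,
    `|limn (fun n => re (psn a n z)) - re (psn a n z)| <= C / (1 - r / r') * (r / r') ^+ n.
  apply: seq_cauchy_cvg => // i j ij; apply: le_trans (H i j ij).
  by rewrite -reN -reD; exact: norm_re_le.
have [_ /(_ n) Hi] : cvgn (fun n => im (psn a n z)) /\ forall n,
    `|limn (fun n => im (psn a n z)) - im (psn a n z)| <= C / (1 - r / r') * (r / r') ^+ n.
  apply: seq_cauchy_cvg => // i j ij; apply: le_trans (H i j ij).
  by rewrite -imN -imD; exact: norm_im_le.
rewrite (le_trans (cmod_le_reim _)) // reD reN imD imN -mulrA mulr2n mulrDl mul1r.
exact: lerD.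
Qed.

(** * Convergence of complex sequences, and termwise operations on power series *)

Definition ccvg (R : realType) (u : nat -> R[i]) (l : R[i]) :=
  forall e : R, 0 < e -> exists N, forall n, (N <= n)%N -> cmod (u n - l) <= e.

Lemma ccvg_uniq (R : realType) (u : nat -> R[i]) l l' : ccvg u l -> ccvg u l' -> l = l'.
Proof.
move=> ul ul'; apply/subr0_eq/cmod_small => e e0.
have e20 : 0 < e / 2 by lra.
have [N HN] := ul _ e20; have [M HM] := ul' _ e20.
have := HN _ (leq_maxl N M); have := HM _ (leq_maxr N M).
set v := u _ => H1 H2; have -> : l - l' = (v - l') - (v - l) by ring.
by rewrite (le_trans (cmodB _ _)) //; lra.
Qed.

Lemma ccvgD (R : realType) (u v : nat -> R[i]) l l' : ccvg u l -> ccvg v l' ->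
  ccvg (fun n => u n + v n) (l + l').
Proof.
move=> ul vl' e e0; have e20 : 0 < e / 2 by lra.
have [N HN] := ul _ e20; have [M HM] := vl' _ e20.
exists (maxn N M) => n; rewrite geq_max => /andP[/HN Hn /HM Hm].
rewrite opprD addrACA (le_trans (cmodD _ _)) //; lra.
Qed.

Lemma ccvgZ (R : realType) (k : R[i]) (u : nat -> R[i]) l : ccvg u l ->
  ccvg (fun n => k * u n) (k * l).
Proof.
move=> ul e e0; have k0 : 0 < cmod k + 1 by rewrite ltr_wpDl ?cmod_ge0.
have [N HN] := ul (e / (cmod k + 1)) (divr_gt0 e0 k0).
exists N => n /HN H; rewrite -mulrBr cmodM.
rewrite (le_trans (ler_wpM2l (cmod_ge0 _) H)) // mulrCA ler_piMr ?ltW //.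
by rewrite ltr_pdivrMr // mul1r ltrDl.
Qed.

Lemma ccvgB (R : realType) (u v : nat -> R[i]) l l' : ccvg u l -> ccvg v l' ->
  ccvg (fun n => u n - v n) (l - l').
Proof.
move=> ul /(ccvgZ (-1)) vl'; rewrite -[- l']mulN1r.
under eq_fun do rewrite -[- v _]mulN1r; exact: ccvgD.
Qed.

Lemma ccvg_cst (R : realType) (l : R[i]) : ccvg (fun=> l) l.
Proof. by move=> e e0; exists 0%N => n _; rewrite subrr cmod0 ltW. Qed.

Lemma ccvg_le (R : realType) (u : nat -> R[i]) l (B : R) : ccvg u l ->
  (forall n, cmod (u n) <= B) -> cmod l <= B.
Proof.
move=> ul uB; apply/ler_addgt0Pr => e e0; have [N /(_ N (leqnn _)) H] := ul _ e0.
rewrite -[l](subrK (u N)) addrC (le_trans (cmodD _ _)) // lerD //.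
by rewrite cmodBC.
Qed.

Lemma ccvg_shift (R : realType) (u : nat -> R[i]) l : ccvg u l -> ccvg (fun n => u n.+1) l.
Proof. by move=> ul e /ul[N HN]; exists N => n Nn; apply: HN; rewrite leqW. Qed.

Lemma expr_small (R : realType) (K q e : R) : 0 <= q -> q < 1 -> 0 < e ->
  exists N, forall n, (N <= n)%N -> K * q ^+ n <= e.
Proof.
move=> q0 q1 e0.
have : (fun n => K * q ^+ n) @ \oo --> 0.
  rewrite -[0](mulr0 K); apply: cvgM; first exact: cvg_cst.
  by apply: cvg_expr; rewrite ger0_norm.
move=> /cvgrPdist_lt/(_ _ e0) [M _ HM]; exists M => n /HM.
by rewrite /= sub0r normrN => /ltW; apply: le_trans; exact: ler_norm.
Qed.

Lemma psum_ccvg (R : realType) (a : nat -> R[i]) (z : R[i]) : subexp a -> cmod z < 1 ->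
  ccvg (fun n => psn a n z) (psum a z).
Proof.
move=> ga z1 e e0.
have [||K [q [K0 q0 q1 HK]]] := psum_tail ga (r := (cmod z + 1) / 2);
  [by have := cmod_ge0 z; lra|lra|].
have /HK {}HK : cmod z <= (cmod z + 1) / 2 by lra.
have [N HN] := expr_small K q0 q1 e0.
by exists N => n /HN; rewrite cmodBC; exact: le_trans.
Qed.

Lemma psumE (R : realType) (a : nat -> R[i]) (z S : R[i]) : subexp a -> cmod z < 1 ->
  ccvg (fun n => psn a n z) S -> psum a z = S.
Proof. by move=> ga z1; apply: ccvg_uniq; exact: psum_ccvg. Qed.

Lemma psnD (R : realType) (a b : nat -> R[i]) n z :
  psn (fun k => a k + b k) n z = psn a n z + psn b n z.
Proof. by rewrite /psn -big_split; apply: eq_bigr => k _; rewrite /= mulrDl. Qed.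

Lemma psnZ (R : realType) (c : R[i]) (a : nat -> R[i]) n z :
  psn (fun k => c * a k) n z = c * psn a n z.
Proof. by rewrite /psn mulr_sumr; apply: eq_bigr => k _; rewrite /= mulrA. Qed.

Lemma psnS (R : realType) (a : nat -> R[i]) n z :
  psn a n.+1 z = a 0%N + z * psn (fun k => a k.+1) n z.
Proof.
rewrite /psn big_ord_recl expr0 mulr1 mulr_sumr; congr (_ + _).
by apply: eq_bigr => k _; rewrite lift0 exprS; ring.
Qed.

Lemma subexpD (R : realType) (a b : nat -> R[i]) :
  subexp a -> subexp b -> subexp (fun k => a k + b k).
Proof.
move=> ga gb r r0 r1; have [C HC] := ga r r0 r1; have [D HD] := gb r r0 r1.
exists (C + D) => n; apply: le_trans (lerD (HC n) (HD n)).
by rewrite -mulrDl ler_wpM2r ?cmodD // exprn_ge0 // ltW.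
Qed.

Lemma subexpZ (R : realType) (c : R[i]) (a : nat -> R[i]) :
  subexp a -> subexp (fun k => c * a k).
Proof.
move=> ga r r0 r1; have [C HC] := ga r r0 r1.
by exists (cmod c * C) => n; rewrite cmodM -mulrA ler_wpM2l ?cmod_ge0.
Qed.

Lemma subexp_shift (R : realType) (a : nat -> R[i]) : subexp a -> subexp (fun k => a k.+1).
Proof.
move=> ga r r0 r1; have [C HC] := ga r r0 r1.
exists (C / r) => n; rewrite ler_pdivlMr //; apply: le_trans (HC n.+1).
by rewrite exprSr mulrA.
Qed.

Lemma subexp_unshift (R : realType) (a : nat -> R[i]) : subexp (fun k => a k.+1) -> subexp a.
Proof.
move=> ga r r0 r1; have [C HC] := ga r r0 r1.
exists (Num.max (cmod (a 0%N)) (C * r)) => -[|n]; first by rewrite expr0 mulr1 le_max lexx.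
by rewrite le_max exprSr mulrA ler_wpM2r ?orbT // ltW.
Qed.

(** Bernoulli's inequality for the powers of [q^-1], which is [H] below, rearranged. *)
Lemma natr_expr_le (R : realType) (q : R) : 0 < q -> q < 1 ->
  forall n, n%:R * q ^+ n <= q / (1 - q).
Proof.
move=> q0 q1 n; have q1' : 0 < 1 - q by rewrite subr_gt0.
have H : 1 + n%:R * (q^-1 - 1) <= q^-1 ^+ n.
  elim: n => [|n IH]; first by rewrite mul0r addr0 expr0.
  have x0 : 0 <= q^-1 - 1 by rewrite subr_ge0 invf_ge1 // ltW.
  rewrite exprS; apply: le_trans (ler_wpM2l _ IH); last by rewrite invr_ge0 ltW.
  rewrite -natr1; have : 0 <= n%:R * (q^-1 - 1) ^+ 2 by rewrite mulr_ge0 // sqr_ge0.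
  by nra.
have qn : 0 < q ^+ n by rewrite exprn_gt0.
have : (1 + n%:R * (q^-1 - 1)) * q ^+ n <= 1.
  by rewrite -ler_pdivlMr // mul1r -exprVn.
rewrite ler_pdivlMr // => H2.
have : n%:R * ((q^-1 - 1) * q) * q ^+ n <= q.
  apply: le_trans (_ : ((1 + n%:R * (q^-1 - 1)) * q ^+ n) * q <= _).
    rewrite !mulrA mulrAC; apply: ler_wpM2r; first exact: ltW.
    by apply: ler_wpM2r; [exact: ltW|rewrite lerDr].
  by rewrite -[leRHS]mul1r ler_wpM2r // ltW.
by rewrite mulrBl mulVf ?gt_eqF // mul1r mulrAC.
Qed.

(** The factor n is absorbed by passing from a radius r' between r and 1 down to r, since n (r /
    r')^n is bounded. *)
Lemma subexp_natM (R : realType) (a : nat -> R[i]) :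
  subexp a -> subexp (fun k => k%:R * a k).
Proof.
move=> ga r r0 r1; pose r' := (r + 1) / 2.
have rr' : r < r' by rewrite /r'; lra.
have r'1 : r' < 1 by rewrite /r'; lra.
have r'0 : 0 < r' by lra.
have [C HC] := ga _ r'0 r'1.
have q0 : 0 < r / r' by rewrite divr_gt0.
have q1 : r / r' < 1 by rewrite ltr_pdivrMr // mul1r.
exists (r / r' / (1 - r / r') * C) => n.
have -> : cmod (n%:R * a n) * r ^+ n = (n%:R * (r / r') ^+ n) * (cmod (a n) * r' ^+ n).
  rewrite cmodM -[n%:R]/((n%:R : R[i])) -(rmorph_nat (real_complex R)) cmod_real normr_nat.
  by rewrite expr_div_n; field; rewrite expf_neq0 // gt_eqF.
apply: ler_pM (natr_expr_le q0 q1 n) (HC n).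
  by rewrite mulr_ge0 // exprn_ge0 // ltW.
by rewrite mulr_ge0 ?cmod_ge0 // exprn_ge0 // ltW.
Qed.

Definition dcoef (R : realType) (a : nat -> R[i]) k := k.+1%:R * a k.+1.

Lemma subexp_dcoef (R : realType) (a : nat -> R[i]) : subexp a -> subexp (dcoef a).
Proof. by move=> /subexp_natM/subexp_shift. Qed.

Lemma cmod_nat (R : realType) n : cmod (n%:R : R[i]) = n%:R.
Proof. by rewrite -(rmorph_nat (real_complex R)) cmod_real normr_nat. Qed.

Lemma subexp_sum (R : realType) (a : nat -> R[i]) (r : R) : subexp a -> 0 < r -> r < 1 ->
  exists M, forall N, \sum_(n < N) cmod (a n) * r ^+ n <= M.
Proof.
move=> ga r0 r1; pose r' := (r + 1) / 2.
have rr' : r < r' by rewrite /r'; lra.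
have r'1 : r' < 1 by rewrite /r'; lra.
have r'0 : 0 < r' by lra.
have [C HC] := ga _ r'0 r'1.
have q0 : 0 < r / r' by rewrite divr_gt0.
have q1 : r / r' < 1 by rewrite ltr_pdivrMr // mul1r.
have C0 : 0 <= C by apply: le_trans (HC 0%N); rewrite mulr_ge0 ?cmod_ge0 ?exprn_ge0 // ltW.
exists (C / (1 - r / r')) => N.
apply: le_trans (_ : \sum_(n < N) C * (r / r') ^+ n <= _).
  apply: ler_sum => n _.
  have -> : cmod (a n) * r ^+ n = (cmod (a n) * r' ^+ n) * (r / r') ^+ n.
    by rewrite (expr_div_n r r') -mulrA; congr (_ * _); rewrite [RHS]mulrC divfK // expf_neq0 // gt_eqF.
  by apply: ler_wpM2r => //; rewrite exprn_ge0 // ltW.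
rewrite -mulr_sumr ler_wpM2l // -(big_mkord xpredT (fun n => (r / r') ^+ n)).
by have := geo_sum_le 0 N (ltW q0) q1; rewrite expr0 mul1r.
Qed.

(** The second-order remainder of z^n is at most n^2 r^(n-2) |h|^2. Multiplying by r^2 avoids the
    exponent n - 2, which would be truncated for n < 2. In the induction, the remainder for n + 1 is
    z + h times the remainder for n, plus h^2 n z^(n-1). *)
Lemma expr_taylor1 (R : realType) (z h : R[i]) (r : R) n : 0 < r -> cmod z <= r ->
  cmod (z + h) <= r ->
  cmod ((z + h) ^+ n - z ^+ n - h * (n%:R * z ^+ n.-1)) * r ^+ 2 <= cmod h ^+ 2 * n%:R ^+ 2 * r ^+ n.
Proof.
move=> r0 zr zhr; elim: n => [|n IH].
  by rewrite !expr0 subrr mul0r mulr0 subrr cmod0 mul0r mulr_ge0 // mulr_ge0 ?sqr_ge0.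
have -> : (z + h) ^+ n.+1 - z ^+ n.+1 - h * (n.+1%:R * z ^+ n.+1.-1) =
  (z + h) * ((z + h) ^+ n - z ^+ n - h * (n%:R * z ^+ n.-1)) + h ^+ 2 * (n%:R * z ^+ n.-1).
  case: n {IH} => [|n] /=; first by ring.
  by rewrite !(exprS _ n.+1) !(exprS _ n) -!natr1; ring.
rewrite (le_trans (ler_wpM2r _ (cmodD _ _))) ?sqr_ge0 // mulrDl.
have -> : cmod h ^+ 2 * n.+1%:R ^+ 2 * r ^+ n.+1 =
  r * (cmod h ^+ 2 * n%:R ^+ 2 * r ^+ n) + cmod h ^+ 2 * (2 * n%:R + 1) * r ^+ n.+1.
  by rewrite (exprS r n) -[n.+1%:R]natr1; ring.
apply: lerD.
  rewrite cmodM -[leLHS]mulrA; apply: ler_pM zhr IH; first exact: cmod_ge0.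
  by rewrite mulr_ge0 ?cmod_ge0 // exprn_ge0 // ltW.
rewrite (cmodM (h ^+ 2)) (cmodX h) (cmodM n%:R) cmod_nat (cmodX z) -[leLHS]mulrA -[leRHS]mulrA.
apply: ler_wpM2l; first by rewrite sqr_ge0.
case: n {IH} => [|n].
  by rewrite !mul0r mulr0 add0r mul1r expr1 ltW.
have H : cmod z ^+ n <= r ^+ n by rewrite lerXn2r ?nnegrE ?cmod_ge0 // ltW.
have -> : r ^+ n.+2 = r ^+ n * r ^+ 2 by rewrite -exprD addn2.
rewrite [leRHS]mulrA; apply: ler_wpM2r; first by rewrite sqr_ge0.
apply: ler_pM; rewrite ?cmod_ge0 ?exprn_ge0 ?cmod_ge0 //.
by have : 0 <= n.+1%:R :> R by []; lra.
Qed.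

(** Summing the remainders of [expr_taylor1] against a_n costs sum n^2 |a_n| r^n, which is finite
    because multiplication by n preserves [subexp]. Termwise differentiation follows. *)
Lemma psum_quadratic (R : realType) (a : nat -> R[i]) (r : R) : subexp a -> 0 < r -> r < 1 ->
  exists M : R, 0 <= M /\ forall z h, cmod z <= r -> cmod (z + h) <= r ->
  cmod (psum a (z + h) - psum a z - h * psum (dcoef a) z) <= M * cmod h ^+ 2.
Proof.
move=> ga r0 r1.
have [M HM] := subexp_sum (subexp_natM (subexp_natM ga)) r0 r1.
have M0 : 0 <= M by apply: le_trans (HM 0%N); rewrite big_ord0.
exists (M / r ^+ 2); split; first by rewrite divr_ge0 ?sqr_ge0.
move=> z h zr zhr.
have z1 := le_lt_trans zr r1; have zh1 := le_lt_trans zhr r1.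
(* One more term is taken for [a] than for [dcoef a], so that the derivative of the partial sum is
   exactly the partial sum of the derivative. *)
have C := ccvgB (ccvgB (ccvg_shift (psum_ccvg ga zh1)) (ccvg_shift (psum_ccvg ga z1)))
  (ccvgZ h (psum_ccvg (subexp_dcoef ga) z1)).
apply: (ccvg_le C) => N /=.
have -> : psn a N.+1 (z + h) - psn a N.+1 z - h * psn (dcoef a) N z =
  \sum_(n < N.+1) a n * ((z + h) ^+ n - z ^+ n - h * (n%:R * z ^+ n.-1)).
  have -> : psn (dcoef a) N z = \sum_(n < N.+1) n%:R * a n * z ^+ n.-1.
    by rewrite big_ord_recl /= mul0r mul0r add0r; apply: eq_bigr => k _.
  rewrite /psn mulr_sumr -!sumrB; apply: eq_bigr => k _; ring.
rewrite (le_trans (cmod_sum _ (fun n => a n * ((z + h) ^+ n - z ^+ n - h * (n%:R * z ^+ n.-1))))) //.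
rewrite mulrAC ler_pdivlMr ?exprn_gt0 //.
rewrite mulr_suml; apply: le_trans (ler_wpM2r (sqr_ge0 _) (HM N.+1)); rewrite mulr_suml.
apply: ler_sum => n _; rewrite cmodM -mulrA.
rewrite (le_trans (ler_wpM2l (cmod_ge0 _) (expr_taylor1 n r0 zr zhr))) //.
by rewrite !cmodM !cmod_nat le_eqVlt; apply/orP; left; apply/eqP; ring.
Qed.

Lemma has_cderiv_psum (R : realType) (a : nat -> R[i]) (z : R[i]) : subexp a -> cmod z < 1 ->
  has_cderiv (psum a) z (psum (dcoef a) z).
Proof.
move=> ga z1 e e0; have z0 := cmod_ge0 z; pose r := (cmod z + 1) / 2.
have r0 : 0 < r by rewrite /r; lra.
have r1 : r < 1 by rewrite /r; lra.
have [M [M0 HM]] := psum_quadratic ga r0 r1.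
have M1 : 0 < M + 1 by lra.
exists (Num.min (r - cmod z) (e / (M + 1))).
  by rewrite lt_min divr_gt0 // andbT /r; lra.
move=> h h0; rewrite lt_min ltr_pdivlMr // => /andP[hr he].
have hp : 0 < cmod h by rewrite cmod_gt0.
have -> : (psum a (z + h) - psum a z) / h - psum (dcoef a) z =
  (psum a (z + h) - psum a z - h * psum (dcoef a) z) / h.
  by rewrite [RHS]mulrBl [h * _]mulrC mulfK.
rewrite cmodM cmodV ltr_pdivrMr //.
apply: (le_lt_trans (HM z h _ _)).
- by rewrite /r; lra.
- by rewrite (le_trans (cmodD _ _)) //; lra.
- by rewrite expr2 mulrA ltr_pM2r //; nra.
Qed.

Lemma psumS (R : realType) (a : nat -> R[i]) (z : R[i]) : subexp a -> cmod z < 1 ->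
  psum a z = a 0%N + z * psum (fun k => a k.+1) z.
Proof.
move=> ga z1; apply: ccvg_uniq (ccvg_shift (psum_ccvg ga z1)) _.
under eq_fun do rewrite psnS.
by apply: ccvgD; [exact: ccvg_cst|apply: ccvgZ; apply: psum_ccvg => //; exact: subexp_shift].
Qed.

Lemma psumD (R : realType) (a b : nat -> R[i]) (z : R[i]) : subexp a -> subexp b ->
  cmod z < 1 -> psum (fun k => a k + b k) z = psum a z + psum b z.
Proof.
move=> ga gb z1; apply: psumE => //; first exact: subexpD.
by under eq_fun do rewrite psnD; apply: ccvgD; exact: psum_ccvg.
Qed.

Lemma psumZ (R : realType) (c : R[i]) (a : nat -> R[i]) (z : R[i]) : subexp a ->
  cmod z < 1 -> psum (fun k => c * a k) z = c * psum a z.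
Proof.
move=> ga z1; apply: psumE => //; first exact: subexpZ.
by under eq_fun do rewrite psnZ; apply: ccvgZ; exact: psum_ccvg.
Qed.

Lemma psum_bounded (R : realType) (a : nat -> R[i]) (r : R) : subexp a -> 0 < r -> r < 1 ->
  exists B, 0 <= B /\ forall z, cmod z <= r -> cmod (psum a z) <= B /\ forall n, cmod (psn a n z) <= B.
Proof.
move=> ga r0 r1; have [M HM] := subexp_sum ga r0 r1.
have M0 : 0 <= M by apply: le_trans (HM 0%N); rewrite big_ord0.
exists M; split => // z zr; have H n : cmod (psn a n z) <= M.
  apply: le_trans (HM n); rewrite (le_trans (cmod_sum _ (fun k => a k * z ^+ k))) //.
  apply: ler_sum => k _; rewrite cmodM cmodX ler_wpM2l ?cmod_ge0 //.
  by rewrite lerXn2r ?nnegrE ?cmod_ge0 // ltW.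
split=> //; apply: ccvg_le H; apply: psum_ccvg => //; exact: le_lt_trans r1.
Qed.

(** The identity theorem. The constant coefficient is the limit at 0; then one divides by z, and
    excluding z = 0 from the hypothesis is what lets it pass to the shifted series. *)
Lemma psum_coef0 (R : realType) (a : nat -> R[i]) (d : R) : subexp a -> 0 < d -> d <= 1 ->
  (forall z, z != 0 -> cmod z < d -> psum a z = 0) -> forall k, a k = 0.
Proof.
move=> ga d0 d1.
have a0 b : subexp b -> (forall z, z != 0 -> cmod z < d -> psum b z = 0) -> b 0%N = 0.
  move=> gb Hb; have r0 : 0 < 2^-1 :> R by lra.
  have r1 : 2^-1 < 1 :> R by lra.
  have [B [B0 HB]] := psum_bounded (subexp_shift gb) r0 r1.
  (* At z = t the equation reads b_0 = - t psi(t), where psi is the shifted series and |psi| <= B on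
     the disc of radius 1/2; hence |b_0| <= t (B + 1) <= e. *)
  apply: cmod_small => e e0; pose t := Num.min (d / 2) (Num.min 2^-1 (e / (B + 1))).
  have B1 : 0 < B + 1 by lra.
  have t0 : 0 < t by rewrite !lt_min r0 !divr_gt0.
  have td : t < d by apply: (@le_lt_trans _ _ (d / 2)); [by rewrite ge_min lexx|lra].
  have t1 : t <= 2^-1 by rewrite /t !ge_min lexx orbT.
  have te : t * (B + 1) <= e by rewrite -ler_pdivlMr // /t !ge_min lexx !orbT.
  have tC : cmod (t%:C)%C = t by rewrite cmod_real gtr0_norm.
  have := Hb (t%:C)%C; rewrite tC -cmod_gt0 tC => /(_ t0 td).
  rewrite psumS // ?tC; last by lra.
  move/eqP; rewrite addr_eq0 => /eqP ->; rewrite cmodN cmodM tC.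
  have [] := HB (t%:C)%C; first by rewrite tC.
  by move=> Hp _; apply: le_trans te; rewrite ler_wpM2l // ?ltW //; lra.
move=> H k; elim: k a ga H => [|k IH] a ga H; first exact: a0.
apply: (IH (fun k => a k.+1)); first exact: subexp_shift.
move=> z z0 zd; have := H z z0 zd; rewrite psumS ?(lt_le_trans zd) //.
by rewrite a0 // add0r => /eqP; rewrite mulf_eq0 (negPf z0) => /eqP.
Qed.

Lemma psum_inj (R : realType) (a b : nat -> R[i]) (d : R) : subexp a -> subexp b ->
  0 < d -> d <= 1 ->
  (forall z, z != 0 -> cmod z < d -> psum a z = psum b z) -> a =1 b.
Proof.
move=> ga gb d0 d1 H k; apply/subr0_eq; rewrite -[- b k]mulN1r.
apply: (@psum_coef0 R (fun k => a k + -1 * b k) d) => //.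
  by apply: subexpD => //; exact: subexpZ.
move=> z z0 zd; have z1 := lt_le_trans zd d1.
by rewrite psumD ?psumZ // ?H ?mulN1r ?subrr //; exact: subexpZ.
Qed.

Lemma has_cderiv_uniq (R : realType) (f : R[i] -> R[i]) z w w' :
  has_cderiv f z w -> has_cderiv f z w' -> w = w'.
Proof.
move=> fw fw'; apply/subr0_eq/cmod_small => e e0; have e20 : 0 < e / 2 by lra.
have [d d0 Hd] := fw _ e20; have [d' d'0 Hd'] := fw' _ e20.
pose t := Num.min d d' / 2.
have m0 : 0 < Num.min d d' by rewrite lt_min d0.
have t0 : 0 < t by rewrite /t; lra.
have [td td'] : t < d /\ t < d'.
  by split; apply: (@lt_le_trans _ _ (Num.min d d')); rewrite ?ge_min ?lexx ?orbT // /t; lra.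
have tC : cmod (t%:C)%C = t by rewrite cmod_real gtr0_norm.
have tn0 : (t%:C)%C != 0 by rewrite -cmod_gt0 tC.
have := Hd _ tn0; have := Hd' _ tn0; rewrite tC => /(_ td') H1 /(_ td) H2.
set q := _ / _ in H1 H2; have -> : w - w' = (q - w') - (q - w) by ring.
by rewrite (le_trans (cmodB _ _)) //; lra.
Qed.

Lemma cderivE (R : realType) (f : R[i] -> R[i]) z w : has_cderiv f z w -> cderiv f z = w.
Proof.
move=> fw; apply: has_cderiv_uniq (fw); rewrite /cderiv.
by case: xgetP => [v -> //|/(_ w)].
Qed.

Lemma eq_has_cderiv (R : realType) (f g : R[i] -> R[i]) z w : in_disc z -> eq_on_disc f g ->
  has_cderiv f z w -> has_cderiv g z w.
Proof.
move=> z1 fg fw e e0; have [d d0 Hd] := fw e e0.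
(* The bound [1 - cmod z] keeps z + h in the disc, the only place where f and g are known to
   agree. *)
exists (Num.min d (1 - cmod z)); first by rewrite lt_min d0 subr_gt0.
move=> h h0; rewrite lt_min => /andP[hd h1]; rewrite -!fg //; first exact: Hd.
rewrite /in_disc (le_lt_trans (cmodD _ _)) //; lra.
Qed.

(** * Cauchy's formula and Taylor expansion *)

(* Goursat's argument: a functional of rectangles that is additive under subdivision
   and [o(diameter^2)] near each point vanishes. *)
Section Bisection.
Variables (R : realType) (L : R -> R -> R -> R -> R[i]) (a b c d : R).
Hypothesis Lx : forall x1 m x2 y1 y2, a <= x1 -> x1 <= m -> m <= x2 -> x2 <= b ->
  c <= y1 -> y1 <= y2 -> y2 <= d -> L x1 x2 y1 y2 = L x1 m y1 y2 + L m x2 y1 y2.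
Hypothesis Ly : forall x1 x2 y1 m y2, a <= x1 -> x1 <= x2 -> x2 <= b ->
  c <= y1 -> y1 <= m -> m <= y2 -> y2 <= d -> L x1 x2 y1 y2 = L x1 x2 y1 m + L x1 x2 m y2.

(** If each of the four quarters had less than a quarter of the total modulus, the triangle
    inequality would fail; so one of them can be kept. *)
Let quarter_step (x y w h : R) : 0 <= w -> 0 <= h -> a <= x -> x + w <= b -> c <= y -> y + h <= d ->
  exists x' y', [/\ x <= x', x' + w / 2 <= x + w, y <= y', y' + h / 2 <= y + h &
    cmod (L x (x + w) y (y + h)) <= 4 * cmod (L x' (x' + w / 2) y' (y' + h / 2))].
Proof.
move=> w0 h0 ax xb cy yd.
have -> : L x (x + w) y (y + h) =
    L x (x + w / 2) y (y + h / 2) + L x (x + w / 2) (y + h / 2) (y + h / 2 + h / 2) +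
    (L (x + w / 2) (x + w / 2 + w / 2) y (y + h / 2) +
     L (x + w / 2) (x + w / 2 + w / 2) (y + h / 2) (y + h / 2 + h / 2)).
  have -> : x + w / 2 + w / 2 = x + w by field.
  have -> : y + h / 2 + h / 2 = y + h by field.
  have -> : L x (x + w) y (y + h) = L x (x + w / 2) y (y + h) + L (x + w / 2) (x + w) y (y + h).
    by apply: Lx; lra.
  by congr (_ + _); apply: Ly; lra.
set A := L x _ y _; set B := L x _ _ _; set C := L _ _ y _; set D := L _ _ _ _.
have H : cmod (A + B + (C + D)) <= cmod A + cmod B + (cmod C + cmod D).
  by rewrite (le_trans (cmodD _ _)) // lerD // cmodD.
have [HA|HA] := leP (cmod (A + B + (C + D))) (4 * cmod A).
  by exists x, y; split => //; lra.
have [HB|HB] := leP (cmod (A + B + (C + D))) (4 * cmod B).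
  by exists x, (y + h / 2); split => //; lra.
have [HC|HC] := leP (cmod (A + B + (C + D))) (4 * cmod C).
  by exists (x + w / 2), y; split => //; lra.
by exists (x + w / 2), (y + h / 2); split => //; lra.
Qed.

Hypotheses (ab : a <= b) (cd : c <= d).
Hypothesis Lloc : forall p q, a <= p -> p <= b -> c <= q -> q <= d ->
  forall e : R, 0 < e -> exists2 D : R, 0 < D &
  forall x1 x2 y1 y2, a <= x1 -> x1 <= p -> p <= x2 -> x2 <= b ->
    c <= y1 -> y1 <= q -> q <= y2 -> y2 <= d -> x2 - x1 < D -> y2 - y1 < D ->
    cmod (L x1 x2 y1 y2) <= e * (x2 - x1 + (y2 - y1)) ^+ 2.

Lemma bisection_eq0 : L a b c d = 0.
Proof.
have ab' := ab; have cd' := cd.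
(* The sides of the n-th rectangle are fixed in advance, so only its lower left corner has to be
   recorded. *)
pose wd n : R := (b - a) * 2^-1 ^+ n; pose ht n : R := (d - c) * 2^-1 ^+ n.
have wd0 n : 0 <= wd n by rewrite /wd mulr_ge0 ?subr_ge0 // exprn_ge0 // invr_ge0.
have ht0 n : 0 <= ht n by rewrite /ht mulr_ge0 ?subr_ge0 // exprn_ge0 // invr_ge0.
have wdS n : wd n.+1 = wd n / 2 by rewrite /wd exprSr mulrA.
have htS n : ht n.+1 = ht n / 2 by rewrite /ht exprSr mulrA.
pose inbox n (s : R * R) := [/\ a <= s.1, s.1 + wd n <= b, c <= s.2 & s.2 + ht n <= d].
pose next n (s s' : R * R) := [/\ s.1 <= s'.1, s'.1 + wd n.+1 <= s.1 + wd n,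
  s.2 <= s'.2, s'.2 + ht n.+1 <= s.2 + ht n &
  cmod (L s.1 (s.1 + wd n) s.2 (s.2 + ht n)) <=
  4 * cmod (L s'.1 (s'.1 + wd n.+1) s'.2 (s'.2 + ht n.+1))].
(* The chosen corner is arbitrary outside [inbox]; the corners built from (a, c) never leave it. *)
have /choice[f Hf] : forall ns : nat * (R * R), exists s', inbox ns.1 ns.2 -> next ns.1 ns.2 s'.
  move=> [n [x y]] /=; have [[/= ax xb cy yd]|] := pselect (inbox n (x, y)); last by exists (x, y).
  have [x' [y' [H1 H2 H3 H4 H5]]] := quarter_step (wd0 n) (ht0 n) ax xb cy yd.
  by exists (x', y') => _; split; rewrite /= ?wdS ?htS.
pose s := fix s n := if n is m.+1 then f (m, s m) else (a, c).
have ins n : inbox n (s n).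
  elim: n => [|n IH]; first by split; rewrite /= /wd /ht ?expr0 ?mulr1 ?lexx // addrC subrK.
  have [H1 H2 H3 H4 _] := Hf (n, s n) IH; case: (IH) => ? ? ? ?.
  by split; rewrite /= ?(le_trans _ H1) ?(le_trans H2) ?(le_trans _ H3) ?(le_trans H4).
have nexts n : next n (s n) (s n.+1) := Hf (n, s n) (ins n).
have mono n m : (n <= m)%N -> [/\ (s n).1 <= (s m).1, (s m).1 + wd m <= (s n).1 + wd n,
   (s n).2 <= (s m).2 & (s m).2 + ht m <= (s n).2 + ht n].
  elim: m => [|m IH]; first by rewrite leqn0 => /eqP ->.
  rewrite leq_eqVlt => /predU1P[-> //|]; rewrite ltnS => /IH[H1 H2 H3 H4].
  have [? ? ? ? _] := nexts m; split.
  - exact: le_trans H1 _. - exact: le_trans H2. - exact: le_trans H3 _. - exact: le_trans H4.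
have q0 : 0 <= 2^-1 :> R by rewrite invr_ge0.
have q1 : 2^-1 < 1 :> R by lra.
have [cx Hx] : cvgn (fun n => (s n).1) /\ forall n, `|limn (fun n => (s n).1) - (s n).1| <= wd n.
  apply: seq_cauchy_cvg => // n m /mono[H1 H2 _ _].
  by rewrite ger0_norm ?subr_ge0 //; have := wd0 m; rewrite -/(wd n); lra.
have [cy Hy] : cvgn (fun n => (s n).2) /\ forall n, `|limn (fun n => (s n).2) - (s n).2| <= ht n.
  apply: seq_cauchy_cvg => // n m /mono[_ _ H1 H2].
  by rewrite ger0_norm ?subr_ge0 //; have := ht0 m; rewrite -/(ht n); lra.
have lx n : (s n).1 <= limn (fun n => (s n).1).
  apply: (@nondecreasing_cvgn_le _ (fun n => (s n).1)) => // i j ij; by case: (mono _ _ ij).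
have ly n : (s n).2 <= limn (fun n => (s n).2).
  apply: (@nondecreasing_cvgn_le _ (fun n => (s n).2)) => // i j ij; by case: (mono _ _ ij).
set p := limn _ in Hx lx; set q := limn _ in Hy ly.
have px n : p <= (s n).1 + wd n by have := Hx n; rewrite ger0_norm ?subr_ge0 //; lra.
have qy n : q <= (s n).2 + ht n by have := Hy n; rewrite ger0_norm ?subr_ge0 //; lra.
have L4 n : cmod (L a b c d) <= 4 ^+ n * cmod (L (s n).1 ((s n).1 + wd n) (s n).2 ((s n).2 + ht n)).
  elim: n => [|n IH].
    by rewrite /= /wd /ht !expr0 !mulr1 mul1r addrC subrK (addrC c) subrK.
  by apply: le_trans IH _; rewrite exprSr -mulrA ler_wpM2l ?exprn_ge0 //; case: (nexts n).
have [a0 b0 c0 d0] := ins 0%N.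
(* The n-th rectangle has width plus height S / 2^n, so the local estimate is of order S^2 / 4^n and
   exactly balances the factor 4^n lost in n subdivisions. *)
apply: cmod_small => e e0; pose S : R := b - a + (d - c).
have S0 : 0 <= S by rewrite /S; lra.
have e'0 : 0 < e / (S ^+ 2 + 1) by rewrite divr_gt0 // ltr_wpDl ?sqr_ge0.
have [| | | |D D0 HD] := Lloc (p := p) (q := q) _ _ _ _ e'0.
- exact: le_trans a0 (lx _). - exact: le_trans (px 0%N) b0.
- exact: le_trans c0 (ly _). - exact: le_trans (qy 0%N) d0.
have D20 : 0 < D / 2 by lra.
have [N HN] := expr_small (b - a) q0 q1 D20; have [M HM] := expr_small (d - c) q0 q1 D20.
pose n := maxn N M; have [an bn cn dn] := ins n.
have wD : wd n < D by have := HN _ (leq_maxl N M); rewrite -/n -/(wd n); lra.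
have hD : ht n < D by have := HM _ (leq_maxr N M); rewrite -/n -/(ht n); lra.
have wE : (s n).1 + wd n - (s n).1 = wd n by ring.
have hE : (s n).2 + ht n - (s n).2 = ht n by ring.
have := HD _ _ _ _ an (lx n) (px n) bn cn (ly n) (qy n) dn; rewrite wE hE => /(_ wD hD) HL.
have H := L4 n.
apply: (le_trans H); apply: le_trans (ler_wpM2l _ HL) _; first by rewrite exprn_ge0.
have -> : 4 ^+ n * (e / (S ^+ 2 + 1) * (wd n + ht n) ^+ 2) = e * (S ^+ 2 / (S ^+ 2 + 1)).
  have -> : wd n + ht n = S * 2^-1 ^+ n by rewrite /wd /ht /S; ring.
  have -> : 4 ^+ n = (2 ^+ n) ^+ 2 :> R by rewrite -exprM mulnC exprM; congr (_ ^+ _); ring.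
  have n0 : 2 ^+ n != 0 :> R by rewrite expf_neq0 // pnatr_eq0.
  have S1 : S ^+ 2 + 1 != 0 by rewrite gt_eqF // ltr_wpDl ?sqr_ge0.
  rewrite exprVn; move: (2 ^+ n) n0 => v v0.
  by field; rewrite v0 S1.
rewrite ler_piMr ?ltW // ltr_pdivrMr ?mul1r ?ltrDl // ltr_wpDl ?sqr_ge0 //.
Qed.

End Bisection.

(** * Continuity and integration of complex functions of a real variable *)

Definition cts (R : realType) (f : R -> R[i]) (t : R) :=
  {for t, continuous (fun x => re (f x))} /\ {for t, continuous (fun x => im (f x))}.

Lemma cts_eps (R : realType) (f : R -> R[i]) (t : R) : cts f t <->
  forall e : R, 0 < e -> exists2 d : R, 0 < d & forall s, `|s - t| < d -> cmod (f s - f t) < e.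
Proof.
split=> [[fr fi] e e0|H].
  have e20 : 0 < e / 2 by lra.
  have /cvgrPdist_lt/(_ _ e20)/nbhs_ballP[d1 /= d10 H1] := fr.
  have /cvgrPdist_lt/(_ _ e20)/nbhs_ballP[d2 /= d20 H2] := fi.
  exists (Num.min d1 d2); first by rewrite lt_min d10.
  move=> s; rewrite lt_min => /andP[s1 s2].
  have := H1 s; rewrite /ball /= distrC => /(_ s1); rewrite distrC => {}H1.
  have := H2 s; rewrite /ball /= distrC => /(_ s2); rewrite distrC => {}H2.
  by rewrite (le_lt_trans (cmod_le_reim _)) // reD imD reN imN; lra.
split; apply/cvgrPdist_lt => e e0; have [d d0 Hd] := H e e0; apply/nbhs_ballP; exists d => //=.
  move=> s; rewrite /ball /= distrC => /Hd; apply: le_lt_trans; rewrite distrC -reN -reD.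
  exact: norm_re_le.
move=> s; rewrite /ball /= distrC => /Hd; apply: le_lt_trans; rewrite distrC -imN -imD.
exact: norm_im_le.
Qed.

Lemma cts_cst (R : realType) (k : R[i]) (t : R) : cts (fun=> k) t.
Proof. by split; exact: cvg_cst. Qed.

Lemma ctsD (R : realType) (f g : R -> R[i]) (t : R) : cts f t -> cts g t ->
  cts (fun x => f x + g x) t.
Proof.
move=> [fr fi] [gr gi]; split; rewrite /prop_for /continuous_at /=.
  by under eq_fun do rewrite reD; rewrite reD; exact: cvgD.
by under eq_fun do rewrite imD; rewrite imD; exact: cvgD.
Qed.

Lemma ctsM (R : realType) (f g : R -> R[i]) (t : R) : cts f t -> cts g t ->
  cts (fun x => f x * g x) t.
Proof.
move=> [fr fi] [gr gi]; split; rewrite /prop_for /continuous_at /=.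
  by under eq_fun do rewrite reM; rewrite reM; apply: cvgB; exact: cvgM.
by under eq_fun do rewrite imM; rewrite imM; apply: cvgD; exact: cvgM.
Qed.

Lemma ctsB (R : realType) (f g : R -> R[i]) (t : R) : cts f t -> cts g t ->
  cts (fun x => f x - g x) t.
Proof.
move=> cf cg; under eq_fun do rewrite -[- g _]mulN1r.
exact: (ctsD cf (ctsM (cts_cst (-1) t) cg)).
Qed.

Lemma ctsX (R : realType) (f : R -> R[i]) (t : R) n : cts f t -> cts (fun x => f x ^+ n) t.
Proof.
move=> cf; elim: n => [|n IH]; first by under eq_fun do rewrite expr0; exact: cts_cst.
by under eq_fun do rewrite exprS; exact: ctsM.
Qed.

Lemma cts_real (R : realType) (f : R -> R) (t : R) : {for t, continuous f} ->
  cts (fun x => (f x)%:C)%C t.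
Proof. by move=> cf; split => //; exact: cvg_cst. Qed.

Lemma ctsV (R : realType) (f : R -> R[i]) (t : R) : f t != 0 -> cts f t ->
  cts (fun x => (f x)^-1) t.
Proof.
move=> ft0 /cts_eps cf; apply/cts_eps => e e0.
have m0 : 0 < cmod (f t) by rewrite cmod_gt0.
(* The first bound keeps |f s| above |f t| / 2; the second then makes |f t - f s| / |f s f t|
   smaller than e. *)
pose e1 := Num.min (cmod (f t) / 2) (e * (cmod (f t) ^+ 2 / 2)).
have e10 : 0 < e1 by rewrite lt_min !mulr_gt0 ?invr_gt0 // ?exprn_gt0.
have [d d0 Hd] := cf _ e10; exists d => // s /Hd; rewrite lt_min => /andP[H1 H2].
have fs : cmod (f t) / 2 < cmod (f s).
  have := le_cmodB_cmod (f t) (f s); rewrite cmodBC; lra.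
have fs0 : 0 < cmod (f s) by lra.
have -> : (f s)^-1 - (f t)^-1 = (f t - f s) / (f s * f t).
  by field; rewrite -!cmod_gt0 ?fs0 ?m0.
rewrite cmodM cmodV cmodM ltr_pdivrMr ?mulr_gt0 // cmodBC.
apply: (lt_le_trans H2); rewrite ler_pM2l // expr2 mulrAC ler_pM2r //; exact: ltW.
Qed.

Definition circ (R : realType) (r t : R) : R[i] := Complex (r * cos t) (r * sin t).

Lemma cts_circ (R : realType) (r t : R) : cts (circ r) t.
Proof.
by split; apply: cvgM; [exact: cvg_cst|exact: continuous_cos|exact: cvg_cst|exact: continuous_sin].
Qed.

Lemma cmod_circ (R : realType) (r t : R) : 0 <= r -> cmod (circ r t) = r.
Proof.
move=> r0; rewrite /cmod /= !exprMn -mulrDr cos2Dsin2 mulr1 sqrtr_sqr ger0_norm //.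
Qed.

Definition cint (R : realType) (a b : R) (f : R -> R[i]) : R[i] :=
  Complex (\int[@lebesgue_measure R]_(t in `[a, b]) re (f t))
          (\int[@lebesgue_measure R]_(t in `[a, b]) im (f t)).

Definition ctson (R : realType) (a b : R) (f : R -> R[i]) :=
  forall t, a <= t -> t <= b -> cts f t.

Lemma cts_integrable (R : realType) (a b : R) (f : R -> R[i]) : ctson a b f ->
  (@lebesgue_measure R).-integrable `[a, b] (EFin \o (fun t => re (f t))) /\
  (@lebesgue_measure R).-integrable `[a, b] (EFin \o (fun t => im (f t))).
Proof.
move=> cf; split; apply: continuous_compact_integrable;
  try exact: segment_compact; apply: continuous_in_subspaceT => t;
  rewrite inE /= in_itv /= => /andP[at_ tb]; by case: (cf _ at_ tb).
Qed.

Lemma eq_cint (R : realType) (a b : R) (f g : R -> R[i]) :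
  (forall t, a <= t -> t <= b -> f t = g t) -> cint a b f = cint a b g.
Proof.
move=> fg; congr Complex; apply: eq_Rintegral => t;
  by rewrite inE /= in_itv /= => /andP[/fg H /H ->].
Qed.

Lemma cintD (R : realType) (a b : R) (f g : R -> R[i]) : ctson a b f -> ctson a b g ->
  cint a b (fun t => f t + g t) = cint a b f + cint a b g.
Proof.
move=> /cts_integrable[fr fi] /cts_integrable[gr gi]; apply: complex_ext; rewrite ?reD ?imD /=.
  by under eq_Rintegral do rewrite reD; rewrite RintegralD.
by under eq_Rintegral do rewrite imD; rewrite RintegralD.
Qed.

Lemma cintZ (R : realType) (a b : R) (k : R[i]) (f : R -> R[i]) : ctson a b f ->
  cint a b (fun t => k * f t) = k * cint a b f.
Proof.
move=> /cts_integrable[fr fi]; have Z (x : R) (h : R -> R) :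
  (@lebesgue_measure R).-integrable `[a, b] (EFin \o h) ->
  (@lebesgue_measure R).-integrable `[a, b] (EFin \o (fun t => x * h t)).
  by move=> ih; apply: (integrableZl _ x ih).
apply: complex_ext; rewrite ?reM ?imM /=.
  under eq_Rintegral do rewrite reM.
  by rewrite RintegralB ?RintegralZl //; exact: Z.
under eq_Rintegral do rewrite imM.
by rewrite RintegralD ?RintegralZl //; exact: Z.
Qed.

Lemma cintB (R : realType) (a b : R) (f g : R -> R[i]) : ctson a b f -> ctson a b g ->
  cint a b (fun t => f t - g t) = cint a b f - cint a b g.
Proof.
move=> cf cg; rewrite -[- cint a b g]mulN1r -cintZ // -cintD //.
  by apply: eq_cint => t _ _; rewrite mulN1r.
by move=> t at_ tb; apply: ctsM; [exact: cts_cst|exact: cg].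
Qed.

Lemma cint_cst (R : realType) (a b : R) (k : R[i]) : a <= b ->
  cint a b (fun=> k) = ((b - a)%:C)%C * k.
Proof.
move=> ab; apply: complex_ext; rewrite ?reM ?imM /= Rintegral_cst //=;
  by rewrite lebesgue_measure_itv /= lte_fin; case: ltgtP ab => //= [ab|->] _; ring.
Qed.

Lemma cint_split (R : realType) (a m b : R) (f : R -> R[i]) : a <= m -> m <= b ->
  ctson a b f -> cint a b f = cint a m f + cint m b f.
Proof.
move=> am mb /[dup] cf /cts_integrable[fr fi].
have H (h : R -> R) : (@lebesgue_measure R).-integrable `[a, b] (EFin \o h) ->
   \int[@lebesgue_measure R]_(t in `[a, b]) h t =
   \int[@lebesgue_measure R]_(t in `[a, m]) h t + \int[@lebesgue_measure R]_(t in `[m, b]) h t.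
  move=> ih; have := @Rintegral_itvB R h (BLeft a) (BRight b) m ih.
  rewrite !bnd_simp => /(_ am mb) /eqP; rewrite subr_eq addrC => /eqP ->; congr (_ + _).
  rewrite Rintegral_itv_obnd_cbnd //; apply: integrableS ih => //.
  by apply: subset_itvr; rewrite bnd_simp.
by apply: complex_ext; rewrite ?reD ?imD /= H.
Qed.

(** The factor 2 comes from treating real and imaginary parts separately; it is harmless because the
    lemma only serves to show that integrals are small. *)
Lemma cint_le (R : realType) (a b M : R) (f : R -> R[i]) : a <= b -> ctson a b f ->
  (forall t, a <= t -> t <= b -> cmod (f t) <= M) -> cmod (cint a b f) <= 2 * M * (b - a).
Proof.
move=> ab /cts_integrable[fr fi] fM.
have H (h : R -> R) : (@lebesgue_measure R).-integrable `[a, b] (EFin \o h) ->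
   (forall t, a <= t -> t <= b -> `|h t| <= M) ->
   `|\int[@lebesgue_measure R]_(t in `[a, b]) h t| <= M * (b - a).
  move=> ih hM; apply: (le_trans (le_normr_Rintegral _ ih)) => //.
  apply: le_trans (_ : \int[@lebesgue_measure R]_(t in `[a, b]) M <= _).
    apply: le_Rintegral => //.
    - exact: integrable_norm.
    - apply: continuous_compact_integrable; first exact: segment_compact.
      by apply: continuous_subspaceT => t; exact: cvg_cst.
    - by move=> t; rewrite /= in_itv /= => /andP[/hM H /H].
  rewrite Rintegral_cst //= lebesgue_measure_itv /= lte_fin.
  by move: ab; rewrite le_eqVlt => /predU1P[->|ab]; rewrite ?ltxx ?ab ?subrr /=.
rewrite (le_trans (cmod_le_reim _)) //= -mulrA mulr2n mulrDl mul1r; apply: lerD; apply: H => //.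
  by move=> t /fM H1 /H1; apply: le_trans; exact: norm_re_le.
by move=> t /fM H1 /H1; apply: le_trans; exact: norm_im_le.
Qed.

Lemma Rint_FTC (R : realType) (a b : R) (f F : R -> R) : a <= b ->
  (forall t, {for t, continuous f}) -> (forall t : R, is_derive t 1 F (f t)) ->
  \int[@lebesgue_measure R]_(t in `[a, b]) f t = F b - F a.
Proof.
rewrite le_eqVlt => /predU1P[->|ab] cf dF; first by rewrite set_itv1 Rintegral_set1 subrr.
have cF t : {for t, continuous F}.
  by apply/differentiable_continuous/derivable1_diffP; case: (dF t).
rewrite /Rintegral (@continuous_FTC2 _ f F) //.
- by apply: continuous_subspaceT.
- split; first by move=> t _; case: (dF t).
  + exact/cvg_at_right_filter/cF.
  + exact/cvg_at_left_filter/cF.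
- by move=> t _; rewrite derive1E; case: (dF t).
Qed.

(** The integrand is the derivative of [circ r]. *)
Lemma cint_circ (R : realType) (r a b : R) : a <= b ->
  cint a b (fun t => Complex 0 1 * circ r t) = circ r b - circ r a.
Proof.
move=> ab; apply: complex_ext; rewrite ?reD ?imD ?reN ?imN.
  transitivity (\int[@lebesgue_measure R]_(t in `[a, b]) (r * - sin t)).
    by apply: eq_Rintegral => t _; rewrite reM /=; ring.
  apply: (@Rint_FTC _ a b _ (fun t => r * cos t)) => // t.
    by apply: cvgM; [exact: cvg_cst|apply: cvgN; exact: continuous_sin].
transitivity (\int[@lebesgue_measure R]_(t in `[a, b]) (r * cos t)).
  by apply: eq_Rintegral => t _; rewrite imM /=; ring.
apply: (@Rint_FTC _ a b _ (fun t => r * sin t)) => // t.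
by apply: cvgM; [exact: cvg_cst|exact: continuous_cos].
Qed.

Lemma has_cderiv_lin (R : realType) (g : R[i] -> R[i]) (z w : R[i]) : has_cderiv g z w ->
  forall e : R, 0 < e -> exists2 d : R, 0 < d &
  forall h, cmod h < d -> cmod (g (z + h) - g z - h * w) <= e * cmod h.
Proof.
move=> gw e e0; have [d d0 Hd] := gw e e0; exists d => // h hd.
have [->|h0] := eqVneq h 0; first by rewrite addr0 subrr mul0r subrr cmod0 mulr0.
have -> : g (z + h) - g z - h * w = ((g (z + h) - g z) / h - w) * h by field.
by rewrite cmodM ler_wpM2r ?cmod_ge0 // ltW // Hd.
Qed.

Lemma has_cderiv_cts (R : realType) (g : R[i] -> R[i]) (z w : R[i]) : has_cderiv g z w ->
  forall e : R, 0 < e -> exists2 d : R, 0 < d & forall h, cmod h < d -> cmod (g (z + h) - g z) < e.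
Proof.
move=> /has_cderiv_lin gw e e0; have [d d0 Hd] := gw 1 ltr01.
have k0 : 0 < 2 + cmod w by have := cmod_ge0 w; lra.
exists (Num.min d (e / (2 + cmod w))); first by rewrite lt_min d0 divr_gt0.
move=> h; rewrite lt_min ltr_pdivlMr // => /andP[/Hd H1 H2].
have -> : g (z + h) - g z = (g (z + h) - g z - h * w) + h * w by ring.
have := cmod_ge0 h; rewrite (le_lt_trans (cmodD _ _)) // cmodM.
have [->|] := eqVneq h 0; last by rewrite -cmod_gt0; nra.
by rewrite addr0 subrr mul0r subr0 cmod0 mul0r addr0.
Qed.

Lemma cts_comp (R : realType) (g : R[i] -> R[i]) (u : R -> R[i]) (t : R) w :
  cts u t -> has_cderiv g (u t) w -> cts (fun x => g (u x)) t.
Proof.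
move=> /cts_eps cu /has_cderiv_cts dg; apply/cts_eps => e /dg[d d0 Hd].
have [d' d'0 Hd'] := cu d d0; exists d' => // s /Hd' /Hd.
by rewrite (addrC (u t)) subrK.
Qed.

Lemma circ_2pi (R : realType) (r : R) : circ r (2 * pi) = circ r 0.
Proof. by rewrite /circ mulr_natl cos2pi sin2pi cos0 sin0. Qed.

Lemma circM (R : realType) (r s t u : R) : circ r t * circ s u = circ (r * s) (t + u).
Proof. by apply: complex_ext; rewrite ?reM ?imM /= ?cosD ?sinD; ring. Qed.

Lemma circX (R : realType) (r t : R) k : circ r t ^+ k = circ (r ^+ k) (k%:R * t).
Proof.
elim: k => [|k IH]; first by rewrite !expr0 mul0r /circ cos0 sin0 mulr1 mulr0.
by rewrite !exprS IH circM -natr1 mulrDl mul1r addrC.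
Qed.

Lemma circV (R : realType) (r t : R) : r != 0 -> (circ r t)^-1 = circ r^-1 (- t).
Proof.
move=> r0; have H : circ r t * circ r^-1 (- t) = 1.
  by rewrite circM subrr divff // /circ cos0 sin0 mulr1 mulr0.
have n0 : circ r t != 0.
  by apply/eqP => z0; move/eqP: H; rewrite z0 mul0r eq_sym oner_eq0.
by apply: (mulfI n0); rewrite H divff.
Qed.

(** The two trigonometric hypotheses say that [m] is an integer; in this form the opposite of a
    natural number or a difference of two can be used as [m]. *)
Lemma cint_circ_freq (R : realType) (r m : R) : m != 0 -> cos (m * (2 * pi)) = 1 ->
  sin (m * (2 * pi)) = 0 -> cint 0 (2 * pi) (fun t => circ r (m * t)) = 0.
Proof.
move=> m0 c1 s0; have tpi0 : 0 <= 2 * pi :> R by rewrite mulr_ge0 // pi_ge0.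
have dm (t : R) : is_derive t 1 (fun t => m * t) m.
  by apply: is_derive_eq; rewrite /GRing.scale /= mulr1.
have cm (t : R) : {for t, continuous (fun t => m * t)}.
  by apply: cvgM; [exact: cvg_cst|exact: cvg_id].
have Ds (t : R) : is_derive t 1 (fun t => r / m * sin (m * t)) (r * cos (m * t)).
  have D := is_derive1_comp (is_derive_sin (m * t)) (dm t).
  have -> : r * cos (m * t) = r / m * (cos (m * t) * m) by field.
  exact: is_deriveZ.
have Dc (t : R) : is_derive t 1 (fun t => - (r / m) * cos (m * t)) (r * sin (m * t)).
  have D := is_derive1_comp (is_derive_cos (m * t)) (dm t).
  have -> : r * sin (m * t) = - (r / m) * (- sin (m * t) * m) by field.
  exact: is_deriveZ.
apply: complex_ext.
  transitivity (\int[@lebesgue_measure R]_(t in `[0, 2 * pi]) (r * cos (m * t))) => //.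
  rewrite (Rint_FTC tpi0 _ Ds) ?s0 ?mulr0 ?sin0 ?mulr0 ?subrr // => t.
  apply: cvgM; first exact: cvg_cst.
  by apply: continuous_comp; [exact: cm|exact: continuous_cos].
transitivity (\int[@lebesgue_measure R]_(t in `[0, 2 * pi]) (r * sin (m * t))) => //.
rewrite (Rint_FTC tpi0 _ Dc) ?c1 ?mulr0 ?cos0 ?subrr // => t.
apply: cvgM; first exact: cvg_cst.
by apply: continuous_comp; [exact: cm|exact: continuous_sin].
Qed.

Lemma cos_nat2pi (R : realType) k : cos (k%:R * (2 * pi)) = 1 :> R.
Proof.
elim: k => [|k IH]; first by rewrite mul0r cos0.
by rewrite -natr1 mulrDl mul1r [X in _ + X]mulr_natl cosD2pi.
Qed.

Lemma sin_nat2pi (R : realType) k : sin (k%:R * (2 * pi)) = 0 :> R.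
Proof.
elim: k => [|k IH]; first by rewrite mul0r sin0.
by rewrite -natr1 mulrDl mul1r [X in _ + X]mulr_natl sinD2pi.
Qed.

Lemma cint_circXN (R : realType) (r : R) k : 0 < r -> (0 < k)%N ->
  cint 0 (2 * pi) (fun t => (circ r t)^-1 ^+ k) = 0.
Proof.
move=> r0 k0; under eq_cint do rewrite circV ?gt_eqF // circX mulrN -mulNr.
apply: cint_circ_freq; rewrite ?mulNr ?cosN ?sinN ?cos_nat2pi ?sin_nat2pi ?oppr0 //.
by rewrite oppr_eq0 pnatr_eq0 -lt0n.
Qed.

Section Cauchy.
Variables (R : realType) (r : R) (a : R[i]).
Hypotheses (r0 : 0 < r) (r1 : r < 1) (ar : cmod a < r).

(** As [tau] goes from 1 to 0, the circle is contracted onto [a] along segments. *)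
Let Z (tau t : R) : R[i] := a + (tau%:C)%C * (circ r t - a).
(** This is dw / (w - a) on the circle w = [circ r t]. On the contracted circles [Z tau] it is the
    same function of t, because dw and w - a are both multiplied by [tau]. *)
Definition cauchy_kernel (t : R) : R[i] := Complex 0 1 * circ r t / (circ r t - a).
Let kap := cauchy_kernel.

Let za_neq0 t : circ r t - a != 0.
Proof.
rewrite -cmod_gt0; apply: lt_le_trans (le_cmodB_cmod _ _).
by rewrite cmod_circ ?subr_gt0 // ltW.
Qed.

Let za_le t : cmod (circ r t - a) <= 2.
Proof.
have := r1; have := ar; move=> ? ?.
by rewrite (le_trans (cmodB _ _)) // cmod_circ ?(ltW r0) //; lra.
Qed.

Let K : R := r / (r - cmod a).

Let K0 : 0 <= K. Proof. by rewrite /K divr_ge0 ?subr_ge0 // ltW. Qed.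

Let kap_le t : cmod (kap t) <= K.
Proof.
rewrite /kap /cauchy_kernel !cmodM cmodV cmod_circ ?(ltW r0) //.
have -> : cmod (Complex 0 1 : R[i]) = 1 by rewrite /cmod /= expr0n expr1n add0r sqrtr1.
rewrite mul1r /K ler_wpM2l ?(ltW r0) // lef_pV2 ?posrE ?subr_gt0 // ?cmod_gt0 //.
by apply: le_trans (le_cmodB_cmod _ _); rewrite cmod_circ // ltW.
Qed.

Lemma cts_cauchy_kernel t : cts cauchy_kernel t.
Proof.
apply: ctsM; first by apply: ctsM; [exact: cts_cst|exact: cts_circ].
by apply: ctsV => //; apply: ctsB; [exact: cts_circ|exact: cts_cst].
Qed.

Let cts_Zt tau t : cts (Z tau) t.
Proof.
apply: ctsD; first exact: cts_cst.
by apply: ctsM; [exact: cts_cst|apply: ctsB; [exact: cts_circ|exact: cts_cst]].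
Qed.

Let cts_Ztau tau t : cts (Z^~ t) tau.
Proof.
apply: ctsD; first exact: cts_cst.
by apply: ctsM; [apply: cts_real; exact: cvg_id|exact: cts_cst].
Qed.

Let Z_disc tau t : 0 <= tau -> tau <= 1 -> cmod (Z tau t) < 1.
Proof.
move=> t0 t1; have -> : Z tau t = ((1 - tau)%:C)%C * a + (tau%:C)%C * circ r t.
  by rewrite /Z rmorphB rmorph1; ring.
rewrite (le_lt_trans (cmodD _ _)) // !cmodM !cmod_real cmod_circ ?(ltW r0) //.
rewrite !ger0_norm ?subr_ge0 //; move: ar r1 r0; have := cmod_ge0 a; nra.
Qed.

Variables (g : R[i] -> R[i]).
Hypothesis hg : holomorphic_on_disc g.

Let cts_gZt tau t : 0 <= tau -> tau <= 1 -> cts (fun t => g (Z tau t)) t.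
Proof. by move=> t0 t1; have [w Hw] := hg (Z_disc t t0 t1); exact: cts_comp Hw. Qed.

Let cts_gZtau tau t : 0 <= tau -> tau <= 1 -> cts (fun tau => g (Z tau t)) tau.
Proof.
move=> t0 t1; have [w Hw] := hg (Z_disc t t0 t1).
by apply: (@cts_comp _ g (Z^~ t) tau w).
Qed.

(* [L] is the integral of [g(w) dw / (w - a)] along the image under [Z] of the boundary
   of a rectangle, with [dw / (w - a)] written as [kap t dt] on the sides where [tau]
   is fixed and as [dtau / tau] on the others. *)
Let F1 x1 x2 t := (g (Z x2 t) - g (Z x1 t)) * kap t.
Let F2 y1 y2 tau := (g (Z tau y2) - g (Z tau y1)) * (tau%:C)%C^-1.
Let L x1 x2 y1 y2 := cint y1 y2 (F1 x1 x2) - cint x1 x2 (F2 y1 y2).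

Let cts_F1 x1 x2 t : 0 <= x1 -> x1 <= 1 -> 0 <= x2 -> x2 <= 1 -> cts (F1 x1 x2) t.
Proof.
by move=> *; apply: ctsM; [apply: ctsB; exact: cts_gZt|exact: cts_cauchy_kernel].
Qed.

Let cts_F2 y1 y2 tau : 0 < tau -> tau <= 1 -> cts (F2 y1 y2) tau.
Proof.
move=> t0 t1; apply: ctsM; first by apply: ctsB; apply: cts_gZtau => //; exact: ltW.
apply: ctsV; last by apply: cts_real; exact: cvg_id.
by rewrite -cmod_gt0 cmod_real gtr0_norm.
Qed.

Let circ_lip t q : cmod (circ r t - circ r q) <= 2 * `|t - q|.
Proof.
wlog qt : t q / q <= t.
  by move=> W; have [|/ltW] := leP q t; [exact: W|move=> /W; rewrite cmodBC distrC].
rewrite -cint_circ // ger0_norm ?subr_ge0 //.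
apply: (le_trans (@cint_le _ q t 1 _ qt _ _)); last by rewrite mulr1.
- by move=> s _ _; apply: ctsM; [exact: cts_cst|exact: cts_circ].
- move=> s _ _; rewrite cmodM cmod_circ ?(ltW r0) //.
  have -> : cmod (Complex 0 1 : R[i]) = 1 by rewrite /cmod /= expr0n expr1n add0r sqrtr1.
  by rewrite mul1r ltW.
Qed.

(** Near [Z p q] the function g is affine up to a small error. A constant contributes nothing to
    either integral, and the linear part contributes the same amount to both ([I1] and [I2]), so
    only the error is left. The lower bound e0 on [tau] keeps the factor 1 / [tau] bounded. *)
Let L_loc e0 : 0 < e0 -> e0 <= 1 -> forall p q : R, e0 <= p -> p <= 1 ->
  forall e : R, 0 < e -> exists2 D : R, 0 < D &
  forall x1 x2 y1 y2, e0 <= x1 -> x1 <= p -> p <= x2 -> x2 <= 1 ->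
    y1 <= q -> q <= y2 -> x2 - x1 < D -> y2 - y1 < D ->
    cmod (L x1 x2 y1 y2) <= e * (x2 - x1 + (y2 - y1)) ^+ 2.
Proof.
move=> e00 e01 p q ep p1 e ee0.
have p0 : 0 <= p by lra.
have [be Hbe] := hg (Z_disc q p0 p1).
have M0 : 0 < 8 * (K + e0^-1) by rewrite mulr_gt0 // ltr_wpDl // invr_gt0.
(* The 8 collects the 2 of [cint_le] and the 4 of the error bound, which is e' (2 S) at each of two
   points; K and e0^-1 bound the kernels on the two kinds of sides. *)
pose e' := e / (8 * (K + e0^-1)).
have e'0 : 0 < e' by rewrite divr_gt0.
have [d d0 Hd] := has_cderiv_lin Hbe e'0.
exists (d / 4); first by rewrite divr_gt0.
move=> x1 x2 y1 y2 ex1 x1p px2 x21 y1q qy2 xD yD.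
pose S : R := x2 - x1 + (y2 - y1).
have S0 : 0 <= S by rewrite /S; lra.
pose er tau t := g (Z tau t) - g (Z p q) - (Z tau t - Z p q) * be.
have er_le tau t : x1 <= tau -> tau <= x2 -> y1 <= t -> t <= y2 ->
    cmod (er tau t) <= e' * (2 * S).
  move=> xt tx yt ty.
  have dZ : cmod (Z tau t - Z p q) <= 2 * S.
    have -> : Z tau t - Z p q = ((tau - p)%:C)%C * (circ r t - a) + (p%:C)%C * (circ r t - circ r q).
      by rewrite /Z rmorphB; ring.
    rewrite (le_trans (cmodD _ _)) // !cmodM !cmod_real (ger0_norm p0).
    have H1 : `|tau - p| <= x2 - x1 by rewrite ler_norml; lra.
    have H2 : `|t - q| <= y2 - y1 by rewrite ler_norml; lra.
    have H3 := circ_lip t q; have H4 := za_le t; have := cmod_ge0 (circ r t - a).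
    have := normr_ge0 (tau - p); have := cmod_ge0 (circ r t - circ r q).
    by rewrite /S; nra.
  have := Hd (Z tau t - Z p q); rewrite (addrC (Z p q)) subrK => H.
  have dd : cmod (Z tau t - Z p q) < d by rewrite /S in dZ; lra.
  by apply: le_trans (H dd) _; rewrite ler_wpM2l // ltW.
have y12 : y1 <= y2 by lra.
have x12 : x1 <= x2 by lra.
have x10 : 0 <= x1 by lra.
have x20 : 0 <= x2 by lra.
have x11 : x1 <= 1 by lra.
pose dz := circ r y2 - circ r y1.
have I1 : cint y1 y2 (fun t => ((x2 - x1)%:C)%C * be * (Complex 0 1 * circ r t)) =
    ((x2 - x1)%:C)%C * be * dz.
  rewrite cintZ ?cint_circ // => t _ _.
  by apply: ctsM; [exact: cts_cst|exact: cts_circ].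
have I2 : cint x1 x2 (fun=> be * dz) = ((x2 - x1)%:C)%C * be * dz by rewrite cint_cst // mulrA.
have -> : L x1 x2 y1 y2 =
    (cint y1 y2 (F1 x1 x2) - cint y1 y2 (fun t => ((x2 - x1)%:C)%C * be * (Complex 0 1 * circ r t))) -
    (cint x1 x2 (F2 y1 y2) - cint x1 x2 (fun=> be * dz)).
  by rewrite I1 I2 /L; ring.
have c1 : ctson y1 y2 (F1 x1 x2) by move=> t _ _; exact: cts_F1.
have c1' : ctson y1 y2 (fun t => ((x2 - x1)%:C)%C * be * (Complex 0 1 * circ r t)).
  by move=> t _ _; apply: ctsM; [exact: cts_cst|apply: ctsM; [exact: cts_cst|exact: cts_circ]].
have c2 : ctson x1 x2 (F2 y1 y2) by move=> t *; apply: cts_F2; lra.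
have c2' : ctson x1 x2 (fun=> be * dz) by move=> t *; exact: cts_cst.
rewrite -cintB // -(cintB c2) //.
have B1 : cmod (cint y1 y2 (fun t => F1 x1 x2 t - ((x2 - x1)%:C)%C * be * (Complex 0 1 * circ r t)))
    <= 2 * (e' * (4 * S) * K) * (y2 - y1).
  apply: cint_le => //; first by move=> t *; apply: ctsB; [exact: c1|exact: c1'].
  move=> t yt ty; have -> : F1 x1 x2 t - ((x2 - x1)%:C)%C * be * (Complex 0 1 * circ r t) =
     (er x2 t - er x1 t) * kap t.
    rewrite /F1 /er /Z /kap /cauchy_kernel rmorphB; move: (za_neq0 t) => H.
    by field.
  rewrite cmodM; apply: ler_pM; rewrite ?cmod_ge0 //.
  rewrite (le_trans (cmodB _ _)) //.
  have -> : e' * (4 * S) = e' * (2 * S) + e' * (2 * S) by ring.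
  by apply: lerD; apply: er_le; lra.
have B2 : cmod (cint x1 x2 (fun tau => F2 y1 y2 tau - be * dz)) <=
    2 * (e' * (4 * S) * e0^-1) * (x2 - x1).
  apply: cint_le => //; first by move=> t *; apply: ctsB; [exact: c2|exact: c2'].
  move=> tau xt tx; have tau0 : 0 < tau by lra.
  have tn0 : (tau%:C)%C != 0 by rewrite -cmod_gt0 cmod_real gtr0_norm.
  have -> : F2 y1 y2 tau - be * dz = (er tau y2 - er tau y1) * (tau%:C)%C^-1.
    by rewrite /F2 /er /Z /dz; field.
  rewrite cmodM; apply: ler_pM; rewrite ?cmod_ge0 //; last first.
    rewrite cmodV cmod_real gtr0_norm // lef_pV2 ?posrE //; lra.
  rewrite (le_trans (cmodB _ _)) //.
  have -> : e' * (4 * S) = e' * (2 * S) + e' * (2 * S) by ring.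
  by apply: lerD; apply: er_le; lra.
rewrite (le_trans (cmodB _ _)) // (le_trans (lerD B1 B2)) // -/S.
have -> : e * S ^+ 2 = e' * (8 * (K + e0^-1)) * S ^+ 2 by rewrite /e' divfK // gt_eqF.
have e0V : 0 < e0^-1 by rewrite invr_gt0.
have eS : 0 <= 8 * e' * S by rewrite mulr_ge0 // mulr_ge0 // ltW.
have H1 : 0 <= (8 * e' * S) * (K * (x2 - x1)) by rewrite mulr_ge0 // mulr_ge0 // subr_ge0.
have H2 : 0 <= (8 * e' * S) * (e0^-1 * (y2 - y1)).
  by rewrite mulr_ge0 // mulr_ge0 ?subr_ge0 // ltW.
rewrite -subr_ge0.
have -> : e' * (8 * (K + e0^-1)) * S ^+ 2 - (2 * (e' * (4 * S) * K) * (y2 - y1) +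
    2 * (e' * (4 * S) * e0^-1) * (x2 - x1)) =
    (8 * e' * S) * (K * (x2 - x1)) + (8 * e' * S) * (e0^-1 * (y2 - y1)).
  by rewrite /S; ring.
exact: addr_ge0.
Qed.

Let tpi0 : 0 <= 2 * pi :> R. Proof. by rewrite mulr_ge0 // pi_ge0. Qed.

(** The sides t = 0 and t = 2 pi of the rectangle have the same image, so they cancel and L reduces
    to the difference between the outer circle and the contracted one. The contraction stops at e0 >
    0 because of the factor 1 / [tau]. *)
Let homotopy e0 : 0 < e0 -> e0 <= 1 ->
  cint 0 (2 * pi) (fun t => (g (Z 1 t) - g (Z e0 t)) * kap t) = 0.
Proof.
move=> e00 e01.
have e0' : 0 <= e0 by exact: ltW.
have <- : L e0 1 0 (2 * pi) = cint 0 (2 * pi) (fun t => (g (Z 1 t) - g (Z e0 t)) * kap t).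
  rewrite /L [X in _ - X](_ : _ = 0) ?subr0 //.
  rewrite (@eq_cint _ _ _ _ (fun=> 0)) ?cint_cst ?mulr0 // => tau _ _.
  by rewrite /F2 /Z circ_2pi subrr mul0r.
apply: (@bisection_eq0 R L e0 1 0 (2 * pi)) => //; last first.
  move=> p q ep p1 _ _ e ee0; have [D D0 HD] := L_loc e00 e01 q ep p1 ee0.
  by exists D => // x1 x2 y1 y2 ? ? ? ? _ ? ? _; exact: HD.
- move=> x1 x2 y1 m y2 ex1 x12 x21 _ y1m my2 _.
  have x10 : 0 <= x1 by lra.
  have x20 : 0 <= x2 by lra.
  have x11 : x1 <= 1 by lra.
  rewrite /L (@cint_split _ y1 m y2) //; last by move=> t _ _; exact: cts_F1.
  have -> : cint x1 x2 (F2 y1 y2) = cint x1 x2 (F2 y1 m) + cint x1 x2 (F2 m y2).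
    rewrite -cintD; first by apply: eq_cint => t _ _; rewrite /F2; ring.
    + by move=> t *; apply: cts_F2; lra.
    + by move=> t *; apply: cts_F2; lra.
  by ring.
- move=> x1 m x2 y1 y2 ex1 x1m mx2 x21 _ y12 _.
  have x10 : 0 <= x1 by lra.
  have x11 : x1 <= 1 by lra.
  have x20 : 0 <= x2 by lra.
  have m0 : 0 <= m by lra.
  have m1 : m <= 1 by lra.
  rewrite /L (@cint_split _ x1 m x2) //; last by move=> t *; apply: cts_F2; lra.
  have -> : cint y1 y2 (F1 x1 x2) = cint y1 y2 (F1 x1 m) + cint y1 y2 (F1 m x2).
    rewrite -cintD; first by apply: eq_cint => t _ _; rewrite /F1; ring.
    + by move=> t *; exact: cts_F1.
    + by move=> t *; exact: cts_F1.
  by ring.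
Qed.

(** By [homotopy] the circle may be contracted until g is as close to [g a] as desired on it. *)
Let cauchy_mean : cint 0 (2 * pi) (fun t => g (circ r t) * kap t) = g a * cint 0 (2 * pi) kap.
Proof.
apply/subr0_eq/cmod_small => e e0.
have k0 : 0 < 2 * K * (2 * pi) + 1 by rewrite ltr_wpDl // mulr_ge0 // mulr_ge0.
have e'0 : 0 < e / (2 * K * (2 * pi) + 1) by rewrite divr_gt0.
have a1 : cmod a < 1 by exact: lt_trans r1.
have [w Hw] := hg a1; have [d d0 Hd] := has_cderiv_cts Hw e'0.
pose t0 := Num.min 1 (d / 4).
have t00 : 0 < t0 by rewrite lt_min ltr01 divr_gt0.
have t01 : t0 <= 1 by rewrite ge_min lexx.
have t0d : t0 <= d / 4 by rewrite ge_min lexx orbT.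
have t00' := ltW t00.
have ckap : ctson 0 (2 * pi) kap by move=> t _ _; exact: cts_cauchy_kernel.
have cga : ctson 0 (2 * pi) (fun t => g a * kap t).
  by move=> t _ _; apply: ctsM; [exact: cts_cst|exact: cts_cauchy_kernel].
have cgt : ctson 0 (2 * pi) (fun t => g (Z t0 t) * kap t).
  by move=> t _ _; apply: ctsM; [exact: cts_gZt|exact: cts_cauchy_kernel].
have Z1 t : Z 1 t = circ r t by rewrite /Z rmorph1; ring.
have -> : cint 0 (2 * pi) (fun t => g (circ r t) * kap t) =
    cint 0 (2 * pi) (fun t => g (Z t0 t) * kap t).
  apply/subr0_eq; rewrite -cintB //; last first.
    move=> t _ _; apply: ctsM; last exact: cts_cauchy_kernel.
    by under eq_fun do rewrite -Z1; exact: cts_gZt.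
  rewrite -[RHS](homotopy t00 t01); apply: eq_cint => t _ _.
  by rewrite Z1 mulrBl.
rewrite -cintZ // -cintB //.
apply: (le_trans (@cint_le _ 0 (2 * pi) (e / (2 * K * (2 * pi) + 1) * K) _ tpi0 _ _)).
- by move=> t *; apply: ctsB; [exact: cgt|exact: cga].
- move=> t _ _; rewrite -mulrBl cmodM; apply: ler_pM; rewrite ?cmod_ge0 //.
  apply: ltW; apply: Hd; rewrite cmodM cmod_real ger0_norm //.
  by apply: (@le_lt_trans _ _ (t0 * 2)); [rewrite ler_wpM2l|lra].
rewrite subr0 (_ : _ * _ * _ = e * ((2 * K * (2 * pi)) / (2 * K * (2 * pi) + 1))); last first.
  by move: (_^-1) => v; ring.
by rewrite ler_piMr ?ltW // ltr_pdivrMr // mul1r ltrDl.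
Qed.

(** Geometric expansion of 1 / (w - a) in powers of a / w. The remainder after N terms is the same
    integral with the additional factor (a / w)^N, which is the identity [E]; its modulus is at most
    a constant times (|a| / r)^N. *)
Let kernel_series (G : R -> R[i]) (B : R) : ctson 0 (2 * pi) G ->
  (forall t, 0 <= t -> t <= 2 * pi -> cmod (G t) <= B) ->
  ccvg (fun N => \sum_(k < N)
     Complex 0 1 * cint 0 (2 * pi) (fun t => G t * (circ r t)^-1 ^+ k) * a ^+ k)
    (cint 0 (2 * pi) (fun t => G t * kap t)).
Proof.
move=> cG GB.
have B0 : 0 <= B by apply: le_trans (GB 0 _ _); rewrite ?cmod_ge0.
have z0 t : circ r t != 0 by rewrite -cmod_gt0 cmod_circ // ltW.
have cq N : ctson 0 (2 * pi) (fun t => G t * kap t * (a / circ r t) ^+ N).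
  move=> t ? ?; apply: ctsM; first by apply: ctsM; [exact: cG|exact: cts_cauchy_kernel].
  by apply: ctsX; apply: ctsM; [exact: cts_cst|apply: ctsV => //; exact: cts_circ].
have cz N : ctson 0 (2 * pi) (fun t => G t * (circ r t)^-1 ^+ N).
  by move=> t ? ?; apply: ctsM; [exact: cG|apply: ctsX; apply: ctsV => //; exact: cts_circ].
have E N : cint 0 (2 * pi) (fun t => G t * kap t) - \sum_(k < N)
     Complex 0 1 * cint 0 (2 * pi) (fun t => G t * (circ r t)^-1 ^+ k) * a ^+ k =
   cint 0 (2 * pi) (fun t => G t * kap t * (a / circ r t) ^+ N).
  elim: N => [|N IH].
    by rewrite big_ord0 subr0; apply: eq_cint => t _ _; rewrite expr0 mulr1.
  rewrite big_ord_recr /= opprD addrA IH mulrAC -cintZ // -cintB //; last first.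
    by move=> t ? ?; apply: ctsM; [exact: cts_cst|exact: cz].
  apply: eq_cint => t _ _; rewrite /kap /cauchy_kernel exprSr expr_div_n exprVn.
  move: (z0 t) (za_neq0 t) => z1 z2; have z3 : circ r t ^+ N != 0 by rewrite expf_neq0.
  by field; rewrite z1 z2 z3.
have q0 : 0 <= cmod a / r by rewrite divr_ge0 ?cmod_ge0 // ltW.
have q1 : cmod a / r < 1 by rewrite ltr_pdivrMr // mul1r.
move=> e e0; have [N HN] := expr_small (2 * (B * K) * (2 * pi)) q0 q1 e0.
exists N => n /HN; apply: le_trans; rewrite cmodBC E.
apply: (le_trans (@cint_le _ 0 (2 * pi) (B * K * (cmod a / r) ^+ n) _ tpi0 (cq n) _)).
  move=> t ? ?; rewrite cmodM; apply: ler_pM; rewrite ?cmod_ge0 //.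
    by rewrite cmodM; apply: ler_pM; rewrite ?cmod_ge0 // GB.
  by rewrite cmodX cmodM cmodV cmod_circ // ltW.
rewrite subr0 le_eqVlt; apply/orP; left; apply/eqP; ring.
Qed.

(** The winding number, obtained from [kernel_series] with G = 1: every term except k = 0 is the
    integral of a nonzero frequency and vanishes. *)
Let cint_kernel : cint 0 (2 * pi) kap = Complex 0 1 * ((2 * pi)%:C)%C.
Proof.
have H : ctson 0 (2 * pi) (fun=> 1 : R[i]) by move=> t _ _; exact: cts_cst.
have := kernel_series (B := 1) H; rewrite cmod1 => /(_ (fun _ _ _ => lexx _)) /ccvg_shift C.
have -> : cint 0 (2 * pi) kap = cint 0 (2 * pi) (fun t => 1 * kap t).
  by apply: eq_cint => t _ _; rewrite mul1r.
apply: (ccvg_uniq C); move=> e e0; exists 0%N => n _.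
rewrite big_ord_recl big1 ?addr0 => [|i _]; last first.
  rewrite (@eq_cint _ _ _ _ (fun t => (circ r t)^-1 ^+ (lift ord0 i))).
    by rewrite cint_circXN // mulr0 mul0r.
  by move=> t _ _; rewrite mul1r.
rewrite (@eq_cint _ _ _ _ (fun=> 1)) => [|t _ _]; last by rewrite expr0 mulr1.
by rewrite cint_cst // expr0 !mulr1 subr0 subrr cmod0 ltW.
Qed.

Lemma cauchy_taylor : ccvg (fun N => psn (fun k =>
    cint 0 (2 * pi) (fun t => g (circ r t) * (circ r t)^-1 ^+ k) / ((2 * pi)%:C)%C) N a) (g a).
Proof.
have Z1 t : Z 1 t = circ r t by rewrite /Z rmorph1; ring.
have cg : ctson 0 (2 * pi) (fun t => g (circ r t)).
  by move=> t _ _; under eq_fun do rewrite -Z1; exact: cts_gZt.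
have [B HB] : exists B, forall t, 0 <= t -> t <= 2 * pi -> cmod (g (circ r t)) <= B.
  have H (h : R -> R) : (forall t, 0 <= t -> t <= 2 * pi -> {for t, continuous h}) ->
    exists B, forall t, 0 <= t -> t <= 2 * pi -> `|h t| <= B.
    move=> ch; have [|c _ Hc] := @EVT_max R (fun t => `|h t|) 0 (2 * pi) tpi0.
      apply: continuous_in_subspaceT => t; rewrite inE /= in_itv /= => /andP[t0 t1].
      by apply: cvg_norm; exact: ch.
    by exists `|h c| => t t0 t1; apply: Hc; rewrite in_itv /= t0.
  have [B1 H1] := H (fun t => re (g (circ r t))) (fun t t0 t1 => (cg t t0 t1).1).
  have [B2 H2] := H (fun t => im (g (circ r t))) (fun t t0 t1 => (cg t t0 t1).2).
  by exists (B1 + B2) => t t0 t1; rewrite (le_trans (cmod_le_reim _)) // lerD // ?H1 ?H2.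
have tpn0 : ((2 * pi)%:C)%C != 0 :> R[i].
  by rewrite -cmod_gt0 cmod_real gtr0_norm mulr_gt0 // pi_gt0.
have i0 : Complex 0 1 != 0 :> R[i] by rewrite eq_complex /= oner_eq0 andbF.
have := kernel_series cg HB; rewrite cauchy_mean cint_kernel => /(ccvgZ (Complex 0 1 * ((2 * pi)%:C)%C)^-1).
have E1 (x y z : R[i]) : x != 0 -> y != 0 -> (x * y)^-1 * (z * (x * y)) = z.
  by move=> x0 y0; field; rewrite x0 y0.
have E2 (x y c p : R[i]) : x != 0 -> y != 0 -> (x * y)^-1 * (x * c * p) = c / y * p.
  by move=> x0 y0; field; rewrite x0 y0.
rewrite E1 //; congr (ccvg _ _); apply/funext => N; rewrite /psn mulr_sumr.
by apply: eq_bigr => k _; rewrite E2.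
Qed.

End Cauchy.

Lemma ccvg_bounded (R : realType) (u : nat -> R[i]) l : ccvg u l ->
  exists B, forall n, cmod (u n) <= B.
Proof.
move=> /(_ 1 ltr01)[N HN]; exists (\sum_(k < N) cmod (u k) + (cmod l + 1)) => n.
have S0 (F : nat -> R[i]) m : 0 <= \sum_(k < m) cmod (F k) by apply: sumr_ge0 => *; exact: cmod_ge0.
have [Nn|nN] := leqP N n.
  have := HN n Nn; have := S0 u N; have := cmodD (u n - l) l; rewrite subrK; lra.
rewrite (bigD1 (Ordinal nN)) //= -addrA lerDl.
by rewrite addr_ge0 ?sumr_ge0 ?addr_ge0 ?cmod_ge0 // => *; rewrite cmod_ge0.
Qed.

(** The terms are differences of consecutive partial sums, and these are bounded. *)
Lemma psn_coef_bounded (R : realType) (c : nat -> R[i]) (z S : R[i]) :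
  ccvg (fun N => psn c N z) S -> exists C : R, forall n, cmod (c n) * cmod z ^+ n <= C.
Proof.
move=> /ccvg_bounded[B HB]; exists (B + B) => n; rewrite -cmodX -cmodM.
have -> : c n * z ^+ n = psn c n.+1 z - psn c n z by rewrite /psn big_ord_recr /= addrAC subrr add0r.
by rewrite (le_trans (cmodB _ _)) // lerD.
Qed.

(* Cauchy's formula gives a series for each radius; the series agree because
   they have the same sum near the origin. *)
Lemma taylor_expansion (R : realType) (g : R[i] -> R[i]) : holomorphic_on_disc g ->
  exists2 c : nat -> R[i], subexp c & forall z, in_disc z -> g z = psum c z.
Proof.
move=> hg.
have [cc ccP] : exists cc : R -> nat -> R[i], forall r z, 0 < r -> r < 1 -> cmod z < r ->
    ccvg (fun N => psn (cc r) N z) (g z).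
  exists (fun r k =>
    cint 0 (2 * pi) (fun t => g (circ r t) * (circ r t)^-1 ^+ k) / ((2 * pi)%:C)%C).
  by move=> r z r0 r1 zr; exact: cauchy_taylor.
have ccB r s : 0 < r -> r < 1 -> 0 < s -> s < r -> exists C : R, forall n, cmod (cc r n) * s ^+ n <= C.
  move=> r0 r1 s0 sr; have sC : cmod (s%:C)%C = s by rewrite cmod_real gtr0_norm.
  have sr' : cmod (s%:C)%C < r by rewrite sC.
  have [C HC] := psn_coef_bounded (ccP r (s%:C)%C r0 r1 sr').
  by exists C => n; have := HC n; rewrite sC.
have cc_eq r s k : 0 < r -> r < 1 -> 0 < s -> s < 1 -> cc r k = cc s k.
  move=> r0 r1 s0 s1; pose u := Num.min r s / 2.
  have m0 : 0 < Num.min r s by rewrite lt_min r0.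
  have u0 : 0 < u by rewrite divr_gt0.
  have ur : u < r by apply: (@lt_le_trans _ _ (Num.min r s)); rewrite ?ge_min ?lexx // /u; lra.
  have us : u < s by apply: (@lt_le_trans _ _ (Num.min r s)); rewrite ?ge_min ?lexx ?orbT // /u; lra.
  have uC : cmod (u%:C)%C = u by rewrite cmod_real gtr0_norm.
  (* The coefficients found on the circle of radius v are so far controlled only at radii below v.
     Rescaling the variable by u makes them [subexp], as [psum_inj] requires. *)
  have ge v : 0 < v -> v < 1 -> u < v -> subexp (fun n => cc v n * (u%:C)%C ^+ n).
    move=> v0 v1 uv t t0 t1; have [C HC] := ccB v u v0 v1 u0 uv.
    exists C => n; apply: le_trans (HC n); rewrite cmodM cmodX uC ler_piMr //.
      by rewrite mulr_ge0 ?cmod_ge0 // exprn_ge0 // ltW.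
    by rewrite exprn_ile1 // ltW.
  have gs v z : 0 < v -> v < 1 -> u < v -> cmod z < 1 ->
      psum (fun n => cc v n * (u%:C)%C ^+ n) z = g ((u%:C)%C * z).
    move=> v0 v1 uv z1; apply: psumE => //; first exact: ge.
    have uz : u * cmod z < v.
      by apply: le_lt_trans uv; rewrite ler_piMr // ltW.
    have := ccP v ((u%:C)%C * z) v0 v1; rewrite cmodM uC => /(_ uz).
    rewrite (_ : (fun N => psn (cc v) N ((u%:C)%C * z)) =
      (fun N => psn (fun n => cc v n * (u%:C)%C ^+ n) N z)) //.
    by apply/funext => N; apply: eq_bigr => n _; rewrite exprMn mulrA.
  have E : (fun n => cc r n * (u%:C)%C ^+ n) =1 (fun n => cc s n * (u%:C)%C ^+ n).
    apply: (@psum_inj R _ _ 1) => //; [exact: ge|exact: ge|].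
    by move=> z _ z1; rewrite !gs.
  by have := E k; apply: mulIf; rewrite expf_neq0 // -cmod_gt0 uC.
have h0 : 0 < 2^-1 :> R by lra.
have h1 : 2^-1 < 1 :> R by lra.
have gc : subexp (cc 2^-1).
  move=> r r0 r1; pose s := (r + 1) / 2.
  have s0 : 0 < s by rewrite /s; lra.
  have s1 : s < 1 by rewrite /s; lra.
  have rs : r < s by rewrite /s; lra.
  have [C HC] := ccB s r s0 s1 r0 rs.
  by exists C => n; rewrite (cc_eq _ s).
exists (cc 2^-1) => // z z1; apply/esym/psumE => //.
pose s := (cmod z + 1) / 2; have z0 := cmod_ge0 z; rewrite /in_disc in z1.
have s0 : 0 < s by rewrite /s; lra.
have s1 : s < 1 by rewrite /s; lra.
have zs : cmod z < s by rewrite /s; lra.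
have := ccP s z s0 s1 zs.
rewrite (_ : (fun N => psn (cc s) N z) = (fun N => psn (cc 2^-1) N z)) //.
by apply/funext => N; apply: eq_bigr => n _; rewrite (cc_eq s 2^-1).
Qed.

(** * Integration over discs *)

Section PlaneMeasure.
Context {R : realType}.
Local Notation mu := (@lebesgue_measure R).

Lemma integral_affine (a b : R) (f : R -> \bar R) : 0 < a ->
  measurable_fun setT f -> (forall x, 0 <= f x)%E ->
  (\int[mu]_x f x = a%:E * \int[mu]_x f (a * x + b)%R)%E.
Proof.
move=> a0 mf f0.
pose phi := (fun x : R => a * x + b) : measurableTypeR R -> measurableTypeR R.
have mphi : measurable_fun setT phi.
  have : measurable_fun setT (fun x : R => a * x + b).
    by apply: measurable_funD => //; exact: measurable_funM.
  exact.
(* The image of Lebesgue measure under [phi], multiplied by a, agrees with Lebesgue measure on the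
   intervals []u, v]], hence everywhere by uniqueness. *)
pose m0 := mscale (NngNum (ltW a0)) (pushforward mu phi).
pose m := m0 mphi.
transitivity (\int[m]_x f x)%E.
  apply: eq_measure_integral => A mA _; apply: lebesgue_measure_unique => // _ [[u v]] _ <-.
  transitivity (a%:E * mu (phi @^-1` `]u, v]))%E; last by [].
  rewrite (_ : phi @^-1` _ = `](u - b) / a, (v - b) / a]%classic); last first.
    apply/seteqP; split => x /=; rewrite !in_itv /= ltr_pdivrMr // ler_pdivlMr // mulrC;
    by rewrite /phi /= mulrC ltrBlDr lerBrDr.
  rewrite !lebesgue_measure_itv /= !lte_fin ltr_pM2r ?invr_gt0 // ltrD2r.
  case: ltP => uv; last by rewrite mule0.
  by rewrite -EFinB -EFinM; congr EFin; field; rewrite gt_eqF.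
rewrite ge0_integral_mscale //=; congr (_ * _)%E.
have := @ge0_integral_pushforward _ _ (measurableTypeR R) (measurableTypeR R) R phi mphi mu
  setT f measurableT mf (fun x _ => f0 x).
by rewrite preimage_setT => <-.
Qed.

Local Notation mu2 := (mu \x mu)%E.

Lemma integral_shear1 (s : R) (F : R * R -> \bar R) : measurable_fun setT F ->
  (forall p, 0 <= F p)%E ->
  (\int[mu2]_p F p = \int[mu2]_p F (p.1 + s * p.2, p.2)%R)%E.
Proof.
move=> mF F0.
have mphi : measurable_fun setT (fun p : R * R => (p.1 + s * p.2, p.2)%R).
  apply: measurable_fun_pair => //; apply: measurable_funD => //.
  by apply: measurable_funM.
rewrite !fubini_tonelli2 //; last exact: measurableT_comp.
apply: eq_integral => y _; rewrite /fubini_G /=.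
rewrite (@integral_affine 1 (s * y) (fun x => F (x, y))) //.
  by rewrite mul1e; apply: eq_integral => x _; rewrite mul1r.
exact: measurable_fun_pair1.
Qed.

Lemma integral_shear2 (s : R) (F : R * R -> \bar R) : measurable_fun setT F ->
  (forall p, 0 <= F p)%E ->
  (\int[mu2]_p F p = \int[mu2]_p F (p.1, p.2 + s * p.1)%R)%E.
Proof.
move=> mF F0.
have mphi : measurable_fun setT (fun p : R * R => (p.1, p.2 + s * p.1)%R).
  apply: measurable_fun_pair => //; apply: measurable_funD => //.
  by apply: measurable_funM.
rewrite !fubini_tonelli1 //; last exact: measurableT_comp.
apply: eq_integral => x _; rewrite /fubini_F /=.
rewrite (@integral_affine 1 (s * x) (fun y => F (x, y))) //.
  by rewrite mul1e; apply: eq_integral => y _; rewrite mul1r.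
exact: measurable_fun_pair2.
Qed.

Lemma integral_scale (s : R) (F : R * R -> \bar R) : 0 < s -> measurable_fun setT F ->
  (forall p, 0 <= F p)%E ->
  (\int[mu2]_p F p = (s ^+ 2)%:E * \int[mu2]_p F (s * p.1, s * p.2)%R)%E.
Proof.
move=> s0 mF F0.
have mphi : measurable_fun setT (fun p : R * R => (s * p.1, s * p.2)%R).
  by apply: measurable_fun_pair; apply: measurable_funM.
have mFphi : measurable_fun setT (fun p : R * R => F (s * p.1, s * p.2)%R).
  exact: measurableT_comp.
rewrite !fubini_tonelli1 // (@integral_affine s 0) //; last 2 first.
- exact: measurable_fun_fubini_tonelli_F.
- by move=> x; apply: integral_ge0.
rewrite expr2 EFinM -muleA; congr (_ * _)%E.
rewrite -ge0_integralZl ?lee_fin ?ltW //; last 2 first.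
- exact: measurable_fun_fubini_tonelli_F.
- by move=> x _; apply: integral_ge0.
apply: eq_integral => x _; rewrite /fubini_F /= addr0.
rewrite (@integral_affine s 0 (fun y => F (s * x, y))) //; last exact: measurable_fun_pair2.
by congr (_ * _)%E; apply: eq_integral => y _; rewrite addr0.
Qed.

(* A rotation by an angle outside [pi Z] is a product of three shears. *)
Let integral_rotation_neq0 (c s : R) (F : R * R -> \bar R) : c ^+ 2 + s ^+ 2 = 1 -> s != 0 ->
  measurable_fun setT F -> (forall p, 0 <= F p)%E ->
  (\int[mu2]_p F p = \int[mu2]_p F (c * p.1 - s * p.2, s * p.1 + c * p.2)%R)%E.
Proof.
(* For c = cos theta and s = sin theta this is - tan (theta / 2): the rotation is a shear by a in x,
   a shear by s in y, and again a shear by a in x. *)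
move=> cs s0 mF F0; pose a := (c - 1) / s.
have m1 (t : R) : measurable_fun setT (fun p : R * R => (p.1 + t * p.2, p.2)%R).
  by apply: measurable_fun_pair => //; apply: measurable_funD => //; apply: measurable_funM.
have m2 (t : R) : measurable_fun setT (fun p : R * R => (p.1, p.2 + t * p.1)%R).
  by apply: measurable_fun_pair => //; apply: measurable_funD => //; apply: measurable_funM.
rewrite (integral_shear1 a mF F0).
have mF1 : measurable_fun setT (fun p : R * R => F (p.1 + a * p.2, p.2)%R).
  exact: (measurableT_comp mF).
rewrite (integral_shear2 s mF1) //=.
have mF2 : measurable_fun setT (fun p : R * R => F (p.1 + a * (p.2 + s * p.1), p.2 + s * p.1)%R).
  exact: (measurableT_comp mF1 (m2 s)).
rewrite (integral_shear1 a mF2) //=.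
have e1 : a * s = c - 1 by rewrite /a divfK.
have e2 : a * (c + 1) = - s.
  apply: (mulIf s0); rewrite mulrAC e1; move: cs; rewrite !expr2 => cs.
  by rewrite (_ : - s * s = c * c - 1); [ring|lra].
apply: eq_integral => -[x y] _ /=; congr F; congr pair.
  have -> : x + a * y + a * (y + s * (x + a * y)) = (1 + a * s) * x + a * (2 + a * s) * y by ring.
  rewrite e1; have -> : 2 + (c - 1) = c + 1 by ring.
  by rewrite e2; ring.
have -> : y + s * (x + a * y) = s * x + (1 + a * s) * y by ring.
by rewrite e1; ring.
Qed.

Lemma integral_rotation (c s : R) (F : R * R -> \bar R) : c ^+ 2 + s ^+ 2 = 1 ->
  measurable_fun setT F -> (forall p, 0 <= F p)%E ->
  (\int[mu2]_p F p = \int[mu2]_p F (c * p.1 - s * p.2, s * p.1 + c * p.2)%R)%E.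
Proof.
move=> cs mF F0; have [s0|] := eqVneq s 0; last by move=> s0; exact: integral_rotation_neq0.
move: cs; rewrite s0 expr0n addr0 => /eqP; rewrite sqrf_eq1 => /orP[] /eqP ->.
  by apply: eq_integral => -[x y] _ /=; congr F; congr pair; ring.
(* The half turn c = -1 is performed as two quarter turns, each of which has s = 1. *)
have m1 : measurable_fun setT (fun p : R * R => (0 * p.1 - 1 * p.2, 1 * p.1 + 0 * p.2)%R).
  by apply: measurable_fun_pair; [apply: measurable_funB|apply: measurable_funD];
    apply: measurable_funM.
have i1 : 0 ^+ 2 + 1 ^+ 2 = 1 :> R by ring.
rewrite (integral_rotation_neq0 i1 (oner_neq0 _) mF F0).
have mF1 : measurable_fun setT (fun p : R * R => F (0 * p.1 - 1 * p.2, 1 * p.1 + 0 * p.2)%R).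
  exact: (measurableT_comp mF m1).
rewrite (integral_rotation_neq0 i1 (oner_neq0 _) mF1 (fun p => F0 _)).
by apply: eq_integral => -[x y] _ /=; congr F; congr pair; ring.
Qed.

(** The parameter is the square of the radius, so radial moments become powers of t without square
    roots. *)
Definition discr (t : R) : set (R * R) := [set p | p.1 ^+ 2 + p.2 ^+ 2 < t].

Lemma measurable_sqnorm : measurable_fun setT (fun p : R * R => p.1 ^+ 2 + p.2 ^+ 2).
Proof. by apply: measurable_funD; apply: measurable_funX. Qed.

Lemma measurable_discr (t : R) : measurable (discr t).
Proof.
have := measurable_fun_ltr measurable_sqnorm (@measurable_cst _ _ (R * R)%type R setT t).
move=> /(_ measurableT [set true]) /(_ I); rewrite setTI.
by congr measurable; apply/seteqP; split.
Qed.

(** The vertical sections have length 2 sqrt (1 - x^2). The substitution x = sin theta turns their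
    integral into that of 2 cos^2, with primitive theta + sin theta cos theta. *)
Lemma area_disc : mu2 (discr 1) = pi%:E.
Proof.
rewrite /product_measure1.
pose G (x : R) := 2 * Num.sqrt (1 - x ^+ 2).
have sec x : (mu \o xsection (discr 1)) x = (G x)%:E.
  rewrite /=.
  have -> : xsection (discr 1) x =
      [set` `](- Num.sqrt (1 - x ^+ 2)), (Num.sqrt (1 - x ^+ 2))[%R].
    apply/seteqP; split => y; rewrite /xsection /discr /= inE /= in_itv /= -ltr_norml.
      move=> H; rewrite -[ltLHS]sqrtr_sqr ltr_sqrt; last by have := sqr_ge0 y; lra.
      lra.
    (* For |x| > 1 the square root of a negative number is 0 by convention, in agreement with an
       empty section. *)
    have [h|h] := leP 0 (1 - x ^+ 2); last by rewrite ltr0_sqrtr // ltNge normr_ge0.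
    rewrite -(@ltr_pXn2r _ 2) ?nnegrE ?sqrtr_ge0 // sqr_sqrtr // real_normK ?num_real //; lra.
  rewrite lebesgue_measure_itv /= lte_fin.
  have := sqrtr_ge0 (1 - x ^+ 2); rewrite le_eqVlt => /predU1P[e|s0].
    by rewrite /G -e oppr0 ltxx mulr0.
  rewrite (_ : _ < _); last lra.
  by rewrite -EFinB; congr EFin; rewrite /G; ring.
under eq_integral do rewrite sec.
have cG : continuous G.
  move=> x; apply: cvgM; first exact: cvg_cst.
  apply: continuous_cvg; first exact: sqrt_continuous.
  by apply: cvgB; [exact: cvg_cst|exact: exprn_continuous].
transitivity (\int[mu]_(x in `[sin (- (pi / 2)), sin (pi / 2)]) (G x)%:E)%E.
  rewrite [RHS]integral_mkcond; apply: eq_integral => x _; rewrite patchE.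
  case: ifPn => //; rewrite notin_setE /= in_itv /= sinN sin_pihalf => H.
  rewrite /G (_ : Num.sqrt _ = 0) ?mulr0 //; apply/eqP; rewrite sqrtr_eq0.
  rewrite subr_le0 -(ger0_norm (sqr_ge0 x)) normrX expr_ge1 //.
  by rewrite leNgt; apply/negP => /ltW; rewrite ler_norml.
have sin' : (@sin R)^`() = cos by apply/funext => x; rewrite derive1E; exact: derive_val.
have pih : - (pi / 2) <= pi / 2 :> R by have := @pi_ge0 R; lra.
have cc (x : R) : {for x, continuous (fun y => 2 * cos y ^+ 2)}.
  apply: cvgM; first exact: cvg_cst.
  by under eq_fun do rewrite expr2; rewrite expr2; apply: cvgM; exact: continuous_cos.
rewrite integration_by_substitution_increasing //.
- rewrite sin'.
  pose F (x : R) := x + sin x * cos x.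
  have dF (x : R) : is_derive x 1 F (2 * cos x ^+ 2).
    apply: is_derive_eq; rewrite /GRing.scale /=.
    by have := cos2Dsin2 x; rewrite !expr2 => h; lra.
  transitivity (\int[mu]_(x in `[(- (pi / 2)), (pi / 2)]) (2 * cos x ^+ 2))%:E.
    rewrite /Rintegral fineK.
      apply: eq_integral => x; rewrite inE /= in_itv /= => /cos_ge0_pihalf c0.
      congr EFin; change (2 * Num.sqrt (1 - sin x ^+ 2) * cos x = 2 * cos x ^+ 2); rewrite (_ : 1 - sin x ^+ 2 = cos x ^+ 2).
        by rewrite sqrtr_sqr ger0_norm //; ring.
      by have := cos2Dsin2 x; lra.
    apply: integrable_fin_num => //.
    apply: continuous_compact_integrable; first exact: segment_compact.
    apply: continuous_subspaceT => x; exact: cc.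
  congr EFin; rewrite (Rint_FTC pih _ dF).
    by rewrite /F cosN sinN cos_pihalf; field.
  exact: cc.
- by move=> x y xi yi; rewrite ltr_sin.
- by rewrite sin' => x _; exact: continuous_cos.
- by rewrite sin'; apply/cvg_ex; eexists; apply: cvg_at_right_filter; exact: continuous_cos.
- by rewrite sin'; apply/cvg_ex; eexists; apply: cvg_at_left_filter; exact: continuous_cos.
- split; first by move=> x _; exact: derivable_sin.
  + by apply: cvg_at_right_filter; exact: continuous_sin.
  + by apply: cvg_at_left_filter; exact: continuous_sin.
- exact: continuous_subspaceT.
Qed.

End PlaneMeasure.

Section DiscIntegrals.
Context {R : realType}.
Local Notation mu := (@lebesgue_measure R).
Local Notation mu2 := (mu \x mu)%E.

Definition plane (p : R * R) : R[i] := Complex p.1 p.2.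
Definition sqn (p : R * R) : R := p.1 ^+ 2 + p.2 ^+ 2.

Lemma cmod_plane p : cmod (plane p) ^+ 2 = sqn p.
Proof. by rewrite cmod_sqr. Qed.

Lemma sqn_ge0 p : 0 <= sqn p.
Proof. by rewrite addr_ge0 ?sqr_ge0. Qed.

Lemma measurable_sqnX m : measurable_fun setT (fun p => sqn p ^+ m).
Proof. apply: measurable_funX; exact: measurable_sqnorm. Qed.

Lemma discr_scale (t : R) m : 0 < t ->
  (\int[mu2]_(p in discr t) (sqn p ^+ m)%:E =
   (t ^+ m.+1)%:E * \int[mu2]_(p in discr 1) (sqn p ^+ m)%:E)%E.
Proof.
move=> t0; have st0 : 0 < Num.sqrt t by rewrite sqrtr_gt0.
have st2 : Num.sqrt t ^+ 2 = t by rewrite sqr_sqrtr // ltW.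
rewrite integral_mkcond (integral_scale st0); last 2 first.
- apply/(measurable_restrictT _ (measurable_discr t)); apply/measurable_funTS/measurable_EFinP.
  exact: measurable_sqnX.
- by move=> p; apply: erestrict_ge0 => q _; rewrite lee_fin exprn_ge0 // sqn_ge0.
rewrite st2 exprS EFinM -muleA; congr (_ * _)%E.
rewrite [in RHS]integral_mkcond -ge0_integralZl ?lee_fin ?exprn_ge0 ?ltW //; last 2 first.
- apply/(measurable_restrictT _ (measurable_discr 1)); apply/measurable_funTS/measurable_EFinP.
  exact: measurable_sqnX.
- by move=> p _; apply: erestrict_ge0 => q _; rewrite lee_fin exprn_ge0 // sqn_ge0.
apply: eq_integral => p _; rewrite !patchE.
have E : sqn (Num.sqrt t * p.1, Num.sqrt t * p.2) = t * sqn p.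
  by rewrite /sqn /= !exprMn st2 mulrDr.
have -> : ((Num.sqrt t * p.1, Num.sqrt t * p.2) \in discr t) = (p \in discr 1).
  by apply/idP/idP; rewrite !inE /discr /= -!/(sqn _) -/(sqn (_, _)) E => H;
    [rewrite -(ltr_pM2l t0) mulr1|rewrite -[ltRHS]mulr1 ltr_pM2l].
by case: ifP => _; rewrite ?mule0 // E exprMn EFinM.
Qed.

Lemma discr0_sub (s t : R) : s <= t -> discr s `<=` discr t.
Proof. by move=> st p; rewrite /discr /=; move=> /lt_le_trans; apply. Qed.

Local Notation mm2 := ((mu2 : {measure set (measurableTypeR R * measurableTypeR R) -> \bar R})%E).

Let area_disc' : mm2 (discr 1) = pi%:E.
Proof. exact: area_disc. Qed.

Lemma area_discr (t : R) : 0 < t -> mm2 (discr t) = (t * pi)%:E.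
Proof.
move=> t0; have := discr_scale 0 t0.
under eq_integral do rewrite expr0.
under [in RHS]eq_integral do rewrite expr0.
rewrite !integral_cst ?mul1e ?area_disc' ?expr1; first by move=> ->; rewrite EFinM.
- exact: measurable_discr.
- exact: measurable_discr.
Qed.

(** Lets x tend to 1 quantitatively: Bernoulli's inequality x^m >= 1 - m (1 - x) is applied at x = 1
    - y with y small. *)
Let expr_squeeze (a b : R) m : 0 <= a -> (forall x : R, 0 < x -> x < 1 -> x ^+ m * a <= b) -> a <= b.
Proof.
move=> a0 H; apply/ler_addgt0Pr => e e0.
have B (x : R) : 0 < x -> x < 1 -> 1 - m%:R * (1 - x) <= x ^+ m.
  move=> x0 x1; elim: m {H} => [|m IH]; first by rewrite mul0r subr0 expr0.
  have m0 : 0 <= m%:R * (1 - x) ^+ 2 by rewrite mulr_ge0 ?ler0n ?sqr_ge0.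
  rewrite exprS; apply: le_trans (ler_wpM2l (ltW x0) IH).
  rewrite -natr1; move: m0; rewrite !expr2; nra.
have k0 : 0 < a * m%:R + 1 by rewrite ltr_wpDl // mulr_ge0.
pose y := Num.min 2^-1 (e / (a * m%:R + 1)).
have y0 : 0 < y by rewrite lt_min invr_gt0 ltr0n divr_gt0.
have y1 : y <= 2^-1 by rewrite ge_min lexx.
have ye : y * (a * m%:R + 1) <= e by rewrite -ler_pdivlMr // ge_min lexx orbT.
have h : 1 - y < 1 by lra.
have h0 : 0 < 1 - y by lra.
have := H _ h0 h; have := ler_wpM2r a0 (B _ h0 h).
have -> : (1 - m%:R * (1 - (1 - y))) * a = a - y * (a * m%:R) by ring.
have : y * (a * m%:R + 1) = y * (a * m%:R) + y by ring.
lra.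
Qed.

(* By scaling, the integral [j] over the unit disc equals [x ^+ m.+1 * j] plus the
   integral over the annulus [x <= |p|^2 < 1], on which the integrand lies between
   [x ^+ m] and [1]; then [x] tends to [1]. *)
Lemma radial_moment1 m : (\int[mu2]_(p in discr 1) (sqn p ^+ m)%:E = (pi / m.+1%:R)%:E)%E.
Proof.
have mD (t : R) : measurable (discr t : set (measurableTypeR R * measurableTypeR R)).
  exact: measurable_discr.
have mf (D : set (measurableTypeR R * measurableTypeR R)) : measurable_fun D (fun p => (sqn p ^+ m)%:E).
  by apply/measurable_funTS/measurable_EFinP; exact: measurable_sqnX.
have f0 p : (0 <= (sqn p ^+ m)%:E)%E.
  by rewrite lee_fin exprn_ge0 // sqn_ge0.
have le1 : (\int[mu2]_(p in discr 1) (sqn p ^+ m)%:E <= pi%:E)%E.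
  apply: le_trans (_ : (\int[mu2]_(p in discr 1) (cst 1%E p) <= _)%E).
    apply: ge0_le_integral => //.
    by move=> p; rewrite /discr /= lee_fin => /ltW p1; rewrite exprn_ile1 // sqn_ge0.
  by rewrite integral_cst // mul1e area_disc'.
have ge0 : (0 <= \int[mu2]_(p in discr 1) (sqn p ^+ m)%:E)%E by apply: integral_ge0 => ? _; exact: f0.
have [j jE] : exists j, (\int[mu2]_(p in discr 1) (sqn p ^+ m)%:E)%E = j%:E.
  exists (fine (\int[mu2]_(p in discr 1) (sqn p ^+ m)%:E)%E); rewrite fineK //.
  by rewrite ge0_fin_numE // (le_lt_trans le1) // ltry.
have j0 : 0 <= j by move: ge0; rewrite jE lee_fin.
(* Both 1 - x^(m+1) and the area pi (1 - x) of the annulus contain the factor 1 - x. After division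
   a geometric sum is left, which tends to m + 1. *)
have key (x : R) : 0 < x -> x < 1 -> x ^+ m * pi <= j * \sum_(i < m.+1) x ^+ i /\
    j * \sum_(i < m.+1) x ^+ i <= pi.
  move=> x0 x1; have xm : measurable (discr 1 `\` discr x : set (measurableTypeR R * measurableTypeR R)).
    exact: measurableD.
  have U : discr 1 = discr x `|` (discr 1 `\` discr x).
    by apply/esym/setDUK; apply: discr0_sub; exact: ltW.
  have dis : [disjoint discr x & discr 1 `\` discr x] by apply/disj_setPS => p [? []].
  have sp := discr_scale m x0; rewrite jE in sp.
  have aA : (mm2 (discr 1 `\` discr x) = (pi - x * pi)%:E)%E.
    have : (mm2 (discr 1) = mu2 (discr x) + mm2 (discr 1 `\` discr x))%E.
      by rewrite {1}U measureU // ; apply/disj_set2P.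
    rewrite area_disc' area_discr // => /eqP.
    rewrite eq_sym addeC; case: (mm2 _) => [r||] //; rewrite -EFinD eqe => /eqP e.
    by congr EFin; lra.
  have s : (j%:E = (x ^+ m.+1 * j)%:E + \int[mu2]_(p in discr 1 `\` discr x) (sqn p ^+ m)%:E)%E.
    by rewrite -jE {1}U ge0_integral_setU // ?sp ?EFinM //; (move=> ? _; exact: f0).
  have up : (\int[mu2]_(p in discr 1 `\` discr x) (sqn p ^+ m)%:E <= (pi - x * pi)%:E)%E.
    apply: le_trans (_ : (\int[mu2]_(p in discr 1 `\` discr x) (cst 1%E p) <= _)%E).
      apply: ge0_le_integral => //.
      by move=> p []; rewrite /discr /= lee_fin => /ltW p1 _; rewrite exprn_ile1 // sqn_ge0.
    by rewrite integral_cst // mul1e aA.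
  have lo : ((x ^+ m * (pi - x * pi))%:E <= \int[mu2]_(p in discr 1 `\` discr x) (sqn p ^+ m)%:E)%E.
    have -> : ((x ^+ m * (pi - x * pi))%:E =
        \int[mu2]_(p in discr 1 `\` discr x) (cst (x ^+ m)%:E p))%E.
      by rewrite integral_cst // aA EFinM.
    apply: ge0_le_integral => //.
    - by move=> p _; rewrite lee_fin exprn_ge0 // ltW.
    - move=> p [_] /negP; rewrite /discr /= lee_fin -leNgt => xp.
      by rewrite lerXn2r ?nnegrE ?sqn_ge0 // ltW.
  have g : (1 - x) * \sum_(i < m.+1) x ^+ i = 1 - x ^+ m.+1.
    by rewrite -[1 - x]opprB mulNr -subrX1 opprB.
  move: s up lo; case: (integral _ _ _) => [r||] //.
  rewrite -EFinD !lee_fin => -[s] up lo.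
  have x1' : 0 < 1 - x by rewrite subr_gt0.
  have rE : r = (1 - x) * (j * \sum_(i < m.+1) x ^+ i).
    by rewrite mulrCA g; lra.
  split; rewrite -(ler_pM2l x1') -rE.
    by have -> : (1 - x) * (x ^+ m * pi) = x ^+ m * (pi - x * pi) by ring.
  by have -> : (1 - x) * pi = pi - x * pi by ring.
have m0 : 0 < m.+1%:R :> R by [].
rewrite jE; congr EFin; apply: (mulIf (lt0r_neq0 m0)); rewrite divfK ?lt0r_neq0 //.
apply/eqP; rewrite eq_le; apply/andP; split.
  apply: (@expr_squeeze _ _ m); first by rewrite mulr_ge0.
  move=> x x0 x1; have [_ H] := key x x0 x1; apply: le_trans H.
  rewrite mulrCA; apply: ler_wpM2l => //.
  rewrite mulr_natr -[leLHS]/(x ^+ m *+ m.+1) -[m.+1 in leLHS]card_ord -sumr_const.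
  apply: ler_sum => i _; rewrite ler_wiXn2l ?ltW // -ltnS; exact: ltn_ord.
apply: (@expr_squeeze _ _ m); first exact: pi_ge0.
move=> x x0 x1; have [H _] := key x x0 x1; apply: (le_trans H).
apply: ler_wpM2l => //; rewrite -[m.+1 in leRHS]card_ord -sumr_const.
by apply: ler_sum => i _; rewrite exprn_ile1 // ltW.
Qed.

Lemma radial_moment (t : R) m : 0 < t ->
  (\int[mu2]_(p in discr t) (sqn p ^+ m)%:E = (t ^+ m.+1 * (pi / m.+1%:R))%:E)%E.
Proof. by move=> t0; rewrite discr_scale // radial_moment1 EFinM. Qed.

End DiscIntegrals.

(** * Parseval identities *)

Section DiscreteParseval.
Context {R : realType}.

Definition root1 (N : nat) : R[i] := circ 1 (2 * pi / N%:R).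

Lemma cmod_root1 N : cmod (root1 N) = 1.
Proof. by rewrite cmod_circ. Qed.

Lemma root1X N : (0 < N)%N -> root1 N ^+ N = 1.
Proof.
move=> N0; rewrite circX expr1n mulrC divfK ?pnatr_eq0 -?lt0n // circ_2pi.
by rewrite /circ cos0 sin0 mulr1 mulr0.
Qed.

Lemma root1_neq1 N d : (0 < d)%N -> (d < N)%N -> root1 N ^+ d != 1.
Proof.
move=> d0 dN; apply/eqP; rewrite circX expr1n => /(congr1 (@re R)) /=; rewrite mul1r.
have N0 : 0 < N%:R :> R by rewrite ltr0n (leq_trans _ dN).
set x := _ * _.
(* With theta = pi d / N strictly between 0 and pi, the cosine of 2 theta is 1 - 2 (sin theta)^2,
   hence less than 1. *)
have -> : x = pi * (d%:R / N%:R) + pi * (d%:R / N%:R) by rewrite /x; field; rewrite gt_eqF.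
rewrite cosD => H; have := cos2Dsin2 (pi * (d%:R / N%:R) : R).
have s0 : 0 < sin (pi * (d%:R / N%:R) : R).
  apply: sin_gt0_pi; rewrite mulr_gt0 ?pi_gt0 ?divr_gt0 // ?ltr0n //=.
  by rewrite gtr_pMr ?pi_gt0 // ltr_pdivrMr // mul1r ltr_nat.
have s2 := mulr_gt0 s0 s0.
by rewrite !expr2 => h; lra.
Qed.

Lemma geo_root_sum N (v : R[i]) : v ^+ N = 1 -> v != 1 -> \sum_(j < N) v ^+ j = 0.
Proof.
move=> vN v1; have := subrX1 v N; rewrite vN subrr => /esym/eqP.
by rewrite mulf_eq0 subr_eq0 (negPf v1) => /eqP.
Qed.

Let conjcX (z : R[i]) n : ((z ^+ n)^*)%C = ((z^*)%C) ^+ n.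
Proof. exact: rmorphXn. Qed.

(** Orthogonality of the characters of Z/N. The polynomial has degree below N, so distinct exponents
    stay distinct modulo N and no cross term survives. *)
Lemma discrete_parseval (b : nat -> R[i]) (N : nat) (z : R[i]) :
  \sum_(j < N) cmod (psn b N (root1 N ^+ j * z)) ^+ 2 =
  N%:R * \sum_(k < N) cmod (b k) ^+ 2 * (cmod z ^+ 2) ^+ k.
Proof.
have [->|N0] := posnP N; first by rewrite !big_ord0 mulr0.
have wc := cmod_root1 N; have wN := root1X N0; have w1n := @root1_neq1 N.
move: (root1 N) wc wN w1n => w wc wN w1n.
have w1 : w * ((w)^*)%C = 1.
  by rewrite cmod_mulJ wc expr1n.
have wn0 : w != 0 by rewrite -cmod_gt0 wc.
have E : \sum_(j < N) ((cmod (psn b N (w ^+ j * z)) ^+ 2)%:C)%C =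
    ((N%:R * \sum_(k < N) cmod (b k) ^+ 2 * (cmod z ^+ 2) ^+ k)%:C)%C.
  transitivity (\sum_(j < N) \sum_(k < N) \sum_(l < N)
      (b k * z ^+ k * ((b l * z ^+ l)^*)%C) * (w ^+ k * ((w)^*)%C ^+ l) ^+ j).
    apply: eq_bigr => j _; rewrite -cmod_mulJ /psn rmorph_sum mulr_suml.
    apply: eq_bigr => k _; rewrite mulr_sumr; apply: eq_bigr => l _.
    rewrite !rmorphM !rmorphXn !rmorphM !rmorphXn !exprMn.
    by rewrite -!exprM (mulnC k) (mulnC l); ring.
  rewrite exchange_big /= rmorphM rmorph_nat rmorph_sum mulr_sumr.
  apply: eq_bigr => k _; rewrite exchange_big /= (bigD1 k) //= [X in _ + X]big1 ?addr0.
    rewrite -exprMn w1 expr1n -mulr_sumr.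
    under eq_bigr do rewrite expr1n.
    rewrite sumr_const card_ord cmod_mulJ cmodM cmodX exprMn -!exprM (mulnC k) mulrC.
    by rewrite -mulr_natl mulr1.
  move=> l lk; rewrite -mulr_sumr geo_root_sum ?mulr0 //.
    by rewrite exprMn -!exprM !(mulnC _ N) !exprM -conjcX wN rmorph1 !expr1n mulr1.
  apply/eqP => H; have {H} H : w ^+ k = w ^+ l.
    have : w ^+ k * (w * ((w)^*)%C) ^+ l = w ^+ l.
      by rewrite exprMn mulrCA H mulr1.
    by rewrite w1 expr1n mulr1.
  have [kl|lk'|/val_inj e] := ltngtP k l; last by rewrite e eqxx in lk.
    have := w1n (l - k)%N; rewrite subn_gt0 kl (leq_ltn_trans (leq_subr _ _)) // => /(_ isT isT).
    move/eqP; apply; apply: (mulfI (expf_neq0 k wn0)).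
    by rewrite -exprD subnKC ?mulr1 // ltnW.
  have := w1n (k - l)%N; rewrite subn_gt0 lk' (leq_ltn_trans (leq_subr _ _)) // => /(_ isT isT).
  move/eqP; apply; apply: (mulfI (expf_neq0 l wn0)).
  by rewrite -exprD subnKC ?mulr1 // ltnW.
by have := E; rewrite -rmorph_sum => /complexI.
Qed.

End DiscreteParseval.

Section CMeasurable.
Context {R : realType} {d : measure_display} {T : measurableType d} (D : set T).

Definition cmeas (f : T -> R[i]) :=
  measurable_fun D (fun x => re (f x)) /\ measurable_fun D (fun x => im (f x)).

Lemma cmeas_cst k : cmeas (fun=> k).
Proof. by split; exact: measurable_cst. Qed.

Lemma cmeasD f g : cmeas f -> cmeas g -> cmeas (fun x => f x + g x).
Proof.
move=> [fr fi] [gr gi]; split.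
  by under eq_fun do rewrite reD; exact: measurable_funD.
by under eq_fun do rewrite imD; exact: measurable_funD.
Qed.

Lemma cmeasM f g : cmeas f -> cmeas g -> cmeas (fun x => f x * g x).
Proof.
move=> [fr fi] [gr gi]; split.
  by under eq_fun do rewrite reM; apply: measurable_funB; exact: measurable_funM.
by under eq_fun do rewrite imM; apply: measurable_funD; exact: measurable_funM.
Qed.

Lemma cmeas_psn a n f : cmeas f -> cmeas (fun x => psn a n (f x)).
Proof.
move=> mf; elim: n => [|n IH]; first by under eq_fun do rewrite /psn big_ord0; exact: cmeas_cst.
under eq_fun do rewrite /psn big_ord_recr /=.
apply: cmeasD => //; apply: cmeasM; first exact: cmeas_cst.
elim: n {IH} => [|n IH]; first by under eq_fun do rewrite expr0; exact: cmeas_cst.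
by under eq_fun do rewrite exprS; exact: cmeasM.
Qed.

Lemma cmeas_cmod f : cmeas f -> measurable_fun D (fun x => cmod (f x) ^+ 2).
Proof.
move=> [fr fi]; under eq_fun do rewrite cmod_sqr.
by apply: measurable_funD; exact: measurable_funX.
Qed.

End CMeasurable.

Lemma psn_cmod_cvg (R : realType) (a : nat -> R[i]) z : subexp a -> cmod z < 1 ->
  (fun n => cmod (psn a n z) ^+ 2) @ \oo --> cmod (psum a z) ^+ 2.
Proof.
move=> ga z1; under eq_fun do rewrite expr2; rewrite expr2.
have H : (fun n => cmod (psn a n z)) @ \oo --> cmod (psum a z).
  apply/cvgrPdist_le => e e0; have [N HN] := psum_ccvg ga z1 e0.
  exists N => // n /HN; apply: le_trans; rewrite ler_norml; apply/andP; split.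
    rewrite lerNl opprB; exact: le_cmodB_cmod.
  by rewrite cmodBC; exact: le_cmodB_cmod.
exact: cvgM.
Qed.

(** Dominated convergence with a constant majorant: the partial sums are uniformly bounded on |u| <=
    r < 1 and m is finite on D. It serves for discs and circles alike. *)
Lemma parseval_limit (R : realType) d (T : measurableType d) (m : {measure set T -> \bar R})
    (D : set T) (u : T -> R[i]) (w : T -> R) (r W : R) (a : nat -> R[i]) (S : nat -> R) :
  measurable D -> (m D < +oo)%E -> cmeas D u -> 0 < r -> r < 1 ->
  (forall x, D x -> cmod (u x) <= r) -> measurable_fun D w ->
  (forall x, D x -> 0 <= w x) -> (forall x, D x -> w x <= W) -> subexp a ->
  (forall N, \int[m]_(x in D) (cmod (psn a N (u x)) ^+ 2 * w x)%:E = (S N)%:E)%E ->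
  (fun N => (S N)%:E) @ \oo --> (\int[m]_(x in D) (cmod (psum a (u x)) ^+ 2 * w x)%:E)%E.
Proof.
move=> mD mDoo mu r0 r1 ur mw w0 wW ga HS.
have [B [B0 HB]] := psum_bounded ga r0 r1.
have mN N : measurable_fun D (fun x => cmod (psn a N (u x)) ^+ 2 * w x).
  by apply: measurable_funM => //; apply: cmeas_cmod; exact: cmeas_psn.
have cN x : D x -> (fun N => cmod (psn a N (u x)) ^+ 2 * w x) @ \oo --> cmod (psum a (u x)) ^+ 2 * w x.
  move=> Dx; apply: cvgM; last exact: cvg_cst.
  by apply: psn_cmod_cvg => //; apply: le_lt_trans r1; exact: ur.
have [|||||_ _] := @dominated_convergence _ _ _ m D mD
  (fun N x => (cmod (psn a N (u x)) ^+ 2 * w x)%:E)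
  (fun x => (cmod (psum a (u x)) ^+ 2 * w x)%:E) (cst (B ^+ 2 * W)%:E).
- by move=> N; apply/measurable_EFinP.
- by apply/measurable_EFinP; apply: measurable_fun_cvg mN cN.
- by apply: aeW => x Dx; apply: cvg_EFin; [exact: nearW|exact: cN].
- by apply/integrableP; split; [exact: measurable_cst|rewrite integral_cst // lte_mul_pinfty].
- apply: aeW => x N Dx; have p0 := mulr_ge0 (sqr_ge0 (cmod (psn a N (u x)))) (w0 _ Dx).
  rewrite /= lee_fin ger0_norm //.
  apply: ler_pM; rewrite ?sqr_ge0 ?w0 ?wW //.
  have [_ /(_ N) H] := HB _ (ur _ Dx).
  by apply: lerXn2r => //; rewrite nnegrE ?cmod_ge0.
- move=> H; rewrite [X in X @ _](_ : _ = (fun N => \int[m]_(x in D) (cmod (psn a N (u x)) ^+ 2 * w x)%:E)%E) //.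
  by apply/funext => N; rewrite HS.
Qed.

Lemma cvgn_sum (R : realType) (F : nat -> nat -> R) (l : nat -> R) N :
  (forall k, (fun n => F k n) @ \oo --> l k) ->
  (fun n => \sum_(k < N) F k n) @ \oo --> \sum_(k < N) l k.
Proof.
move=> H; elim: N => [|N IH].
  by under eq_fun do rewrite big_ord0; rewrite big_ord0; exact: cvg_cst.
by under eq_fun do rewrite big_ord_recr; rewrite big_ord_recr; exact: cvgD.
Qed.

Section DiscParseval.
Context {R : realType}.
Local Notation mu := (@lebesgue_measure R).
Local Notation mu2 := (mu \x mu)%E.
Local Notation RR := (measurableTypeR R * measurableTypeR R)%type.

(** The radial numerator of the sum of the three Poisson kernels. *)
Definition wt (p : R * R) : R := 3 * (1 - sqn p ^+ 3).
Definition wmom (t : R) (m : nat) : R :=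
  3 * pi * (t ^+ m.+1 / m.+1%:R - t ^+ m.+4 / m.+4%:R).

Let mD (t : R) : measurable (discr t : set RR).
Proof. exact: measurable_discr. Qed.

Lemma measurable_wt : measurable_fun setT (wt : RR -> R).
Proof.
apply: measurable_funM; first exact: measurable_cst.
by apply: measurable_funB; [exact: measurable_cst|exact: measurable_sqnX].
Qed.

Lemma wt_ge0 (t : R) p : t <= 1 -> discr t p -> 0 <= wt p.
Proof.
move=> t1 pt; rewrite mulr_ge0 // subr_ge0 exprn_ile1 // ?sqn_ge0 //.
by apply: ltW; exact: lt_le_trans t1.
Qed.

Lemma wt_le p : wt p <= 3.
Proof. by rewrite /wt -[leRHS]mulr1 ler_pM2l // lerBlDr lerDl exprn_ge0 // sqn_ge0. Qed.

Lemma cmeas_plane (D : set RR) : cmeas D (plane : RR -> R[i]).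
Proof. by split; apply: measurable_funTS; [exact: measurable_fst|exact: measurable_snd]. Qed.

Lemma moment_wt (t : R) m : 0 < t -> t <= 1 ->
  (\int[mu2]_(p in discr t) (sqn p ^+ m * wt p)%:E = (wmom t m)%:E)%E.
Proof.
move=> t0 t1.
have mS k : measurable_fun (discr t : set RR) (fun p : RR => (sqn p ^+ k)%:E).
  by apply/measurable_funTS/measurable_EFinP; exact: measurable_sqnX.
have mw : measurable_fun (discr t : set RR) (fun p : RR => (sqn p ^+ m * wt p)%:E).
  apply/measurable_EFinP/measurable_funTS; apply: measurable_funM; first exact: measurable_sqnX.
  exact: measurable_wt.
(* The difference of two moments is stated as a sum, because subtraction of extended reals is
   delicate; the common finite term is cancelled at the end. *)
have E : ((wmom t m)%:E + 3%:E * \int[mu2]_(p in discr t) (sqn p ^+ (m + 3))%:E =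
    3%:E * \int[mu2]_(p in discr t) (sqn p ^+ m)%:E)%E.
  rewrite !radial_moment // -!EFinM -EFinD; congr EFin; rewrite /wmom addn3; ring.
have F : (\int[mu2]_(p in discr t) (sqn p ^+ m * wt p)%:E +
    3%:E * \int[mu2]_(p in discr t) (sqn p ^+ (m + 3))%:E =
    3%:E * \int[mu2]_(p in discr t) (sqn p ^+ m)%:E)%E.
  rewrite -!ge0_integralZl //; try by move=> p _; rewrite lee_fin exprn_ge0 // sqn_ge0.
  rewrite -ge0_integralD //.
  - apply: eq_integral => p _; rewrite -!EFinM -EFinD; congr EFin.
    by rewrite /wt exprD; ring.
  - by move=> p pt; rewrite lee_fin mulr_ge0 ?exprn_ge0 ?sqn_ge0 // (wt_ge0 t1).
  - by move=> p pt; rewrite mule_ge0 // lee_fin exprn_ge0 // sqn_ge0.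
  - exact: emeasurable_funM.
move: E F; rewrite !radial_moment // -!EFinM.
case: (integral _ _ _) => [r||] //; rewrite -!EFinD => E; rewrite -E => /eqP.
by rewrite eqe => /eqP/addIr ->.
Qed.

Lemma rot_disc (t : R) (u : R[i]) (h : R[i] -> R) : t <= 1 -> cmod u = 1 ->
  (forall z, 0 <= h z) -> measurable_fun setT (fun p : RR => h (plane p)) ->
  (\int[mu2]_(p in discr t) (h (plane p) * wt p)%:E =
   \int[mu2]_(p in discr t) (h (u * plane p) * wt p)%:E)%E.
Proof.
move=> t1 u1 h0 mh; have cs : re u ^+ 2 + im u ^+ 2 = 1 by rewrite -cmod_sqr u1 expr1n.
rewrite integral_mkcond (integral_rotation cs); last 2 first.
- apply/(measurable_restrictT _ (mD t)); apply/measurable_funTS/measurable_EFinP.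
  by apply: measurable_funM => //; exact: measurable_wt.
- by move=> p; apply: erestrict_ge0 => q qt; rewrite lee_fin mulr_ge0 // (wt_ge0 t1).
rewrite [in RHS]integral_mkcond; apply: eq_integral => p _; rewrite !patchE.
set q : R * R := (re u * p.1 - im u * p.2, im u * p.1 + re u * p.2); have qE : plane q = u * plane p.
  by apply: complex_ext; rewrite ?reM ?imM /=; ring.
have sE : sqn q = sqn p by rewrite -!cmod_plane qE cmodM u1 mul1r.
have -> : (q \in discr t) = (p \in discr t).
  by apply/idP/idP; rewrite !inE /discr /= -/(sqn p) -/(sqn q) sE.
by case: ifP => // _; rewrite qE /wt sE.
Qed.

(* Averaging over the rotations by [N]-th roots of unity, under which the weight is
   invariant, reduces this to [discrete_parseval]. *)
Lemma poly_parseval (t : R) (b : nat -> R[i]) N : 0 < t -> t <= 1 ->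
  (\int[mu2]_(p in discr t) (cmod (psn b N (plane p)) ^+ 2 * wt p)%:E =
   (\sum_(k < N) cmod (b k) ^+ 2 * wmom t k)%:E)%E.
Proof.
move=> t0 t1; have [->|N0] := posnP N.
  rewrite big_ord0; apply: integral0_eq => p _.
  by rewrite /psn big_ord0 cmod0 expr0n mul0r.
have Nr : 0 < N%:R :> R by rewrite ltr0n.
pose h z := cmod (psn b N z) ^+ 2.
have h0 z : 0 <= h z by rewrite sqr_ge0.
have mh (v : R[i]) (D : set RR) : measurable_fun D (fun p : RR => h (v * plane p)).
  apply: cmeas_cmod; apply: cmeas_psn; apply: cmeasM; first exact: cmeas_cst.
  exact: cmeas_plane.
have mwt (D : set RR) : measurable_fun D wt by apply: measurable_funTS; exact: measurable_wt.
pose I := (\int[mu2]_(p in discr t) (h (plane p) * wt p)%:E)%E.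
have Ij (j : nat) : I = (\int[mu2]_(p in discr t) (h (root1 N ^+ j * plane p) * wt p)%:E)%E.
  apply: rot_disc => //; first by rewrite cmodX cmod_root1 expr1n.
  by apply: cmeas_cmod; apply: cmeas_psn; exact: cmeas_plane.
transitivity ((N%:R^-1)%:E * \sum_(j < N) I)%E.
  rewrite sumr_const card_ord -[(I *+ N)%R]mule_natl muleA -EFinM mulVf ?gt_eqF // mul1e //.
rewrite (eq_bigr (fun j : 'I_N =>
  \int[mu2]_(p in discr t) (h (root1 N ^+ j * plane p) * wt p)%:E)%E); last by move=> j _; exact: Ij.
have nn (j : 'I_N) p : discr t p -> (0 <= (h (root1 N ^+ j * plane p) * wt p)%:E)%E.
  by move=> pt; rewrite lee_fin mulr_ge0 // (wt_ge0 t1).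
rewrite -ge0_integral_sum //; last first.
  by move=> j; apply/measurable_EFinP; apply: measurable_funM.
rewrite -ge0_integralZl ?lee_fin ?invr_ge0 ?ltW //; last 2 first.
- apply: emeasurable_fun_sum => j; apply/measurable_EFinP; apply: measurable_funM => //.
- by move=> p pt; apply: sume_ge0 => j _; exact: nn.
transitivity (\int[mu2]_(p in discr t) \sum_(k < N) ((cmod (b k) ^+ 2)%:E * (sqn p ^+ k * wt p)%:E))%E.
  apply: eq_integral => p _; rewrite sumEFin -EFinM -mulr_suml discrete_parseval.
  rewrite mulrA mulKf ?gt_eqF // mulr_suml -sumEFin; apply: eq_bigr => k _.
  by rewrite cmod_plane -EFinM -mulrA.
have mk (k : nat) : measurable_fun (discr t : set RR) (fun p : RR => (sqn p ^+ k * wt p)%:E).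
  by apply/measurable_EFinP; apply: measurable_funM => //; apply: measurable_funTS; exact: measurable_sqnX.
have kk (k : nat) p : discr t p -> (0 <= (sqn p ^+ k * wt p)%:E)%E.
  by move=> pt; rewrite lee_fin mulr_ge0 ?exprn_ge0 ?sqn_ge0 // (wt_ge0 t1).
rewrite ge0_integral_sum //; last 2 first.
- by move=> k; apply: emeasurable_funM.
- by move=> k p pt; rewrite mule_ge0 ?kk // lee_fin sqr_ge0.
rewrite -sumEFin; apply: eq_bigr => k _.
by rewrite ge0_integralZl ?lee_fin ?sqr_ge0 // ?moment_wt ?EFinM // => p; exact: kk.
Qed.

Lemma wmom_ge0 (t : R) k : 0 < t -> t <= 1 -> 0 <= wmom t k.
Proof.
move=> t0 t1; rewrite mulr_ge0 ?mulr_ge0 ?pi_ge0 // subr_ge0.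
apply: ler_pM; rewrite ?exprn_ge0 ?invr_ge0 ?(ltW t0) //; first by apply: ler_wiXn2l; rewrite ?(ltW t0) //; lia.
by rewrite lef_pV2 ?posrE ?ltr0n // ler_nat; lia.
Qed.

(** Clearer from the integral than from the formula: the discs are nested and the integrand is
    nonnegative. *)
Lemma wmom_le (t : R) k : 0 < t -> t <= 1 -> (wmom t k <= wmom 1 k).
Proof.
move=> t0 t1; rewrite -lee_fin -!moment_wt //.
apply: ge0_subset_integral => //.
- apply/measurable_EFinP/measurable_funTS; apply: measurable_funM; first exact: measurable_sqnX.
  exact: measurable_wt.
- by move=> p pt; rewrite lee_fin mulr_ge0 ?exprn_ge0 ?sqn_ge0 // (@wt_ge0 1).
- exact: discr0_sub.
Qed.

(** The partial sums need not be bounded on the whole disc, so [parseval_limit] is applied on the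
    discs [discr (t n)] with t n < 1, which exhaust [discr 1] by monotone convergence. The exchange
    of the two limits is proved as two inequalities. *)
Lemma disc_parseval (a : nat -> R[i]) : subexp a ->
  (\int[mu2]_(p in discr 1) (cmod (psum a (plane p)) ^+ 2 * wt p)%:E =
   ereal_sup (range (fun N => (\sum_(k < N) cmod (a k) ^+ 2 * wmom 1 k)%:E)))%E.
Proof.
move=> ga; pose t n : R := 1 - n.+2%:R^-1.
have t0 n : 0 < t n by rewrite subr_gt0 invf_lt1 // ltr1n.
have t1 n : t n < 1 by rewrite gtrBl invr_gt0.
have t1' n := ltW (t1 n).
have tcvg : t @ \oo --> (1 : R).
  rewrite -[X in _ --> X]subr0; apply: cvgB; first exact: cvg_cst.
  by have := @cvg_harmonic R; rewrite -cvg_shiftS.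
have planelt p : discr 1 p -> cmod (plane p) < 1.
  move=> p1; rewrite -(@ltr_pXn2r _ 2) ?nnegrE ?cmod_ge0 // expr1n cmod_plane.
  exact: p1.
have mf : measurable_fun (discr 1 : set RR) (fun p : RR => cmod (psum a (plane p)) ^+ 2 * wt p).
  apply: measurable_funM; last by apply: measurable_funTS; exact: measurable_wt.
  apply: (@measurable_fun_cvg _ _ _ _ (fun N p => cmod (psn a N (plane p)) ^+ 2)).
    by move=> N; apply: cmeas_cmod; apply: cmeas_psn; exact: cmeas_plane.
  by move=> p /planelt p1; exact: psn_cmod_cvg.
pose S (s : R) N := \sum_(k < N) cmod (a k) ^+ 2 * wmom s k.
have Snd s : 0 < s -> s <= 1 -> {homo S s : n m / (n <= m)%N >-> n <= m}.
  move=> s0 s1; apply/nondecreasing_seqP => n; rewrite /S big_ord_recr /= lerDl.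
  by rewrite mulr_ge0 ?sqr_ge0 // wmom_ge0.
have lim_n n : (fun N => (S (t n) N)%:E) @ \oo -->
    (\int[mu2]_(p in discr (t n)) (cmod (psum a (plane p)) ^+ 2 * wt p)%:E)%E.
  have st0 : 0 < Num.sqrt (t n) by rewrite sqrtr_gt0.
  have st1 : Num.sqrt (t n) < 1 by rewrite -sqrtr1 ltr_sqrt.
  apply: (@parseval_limit R _ RR mu2 (discr (t n)) plane wt (Num.sqrt (t n)) 3) => //.
  - apply: (@le_lt_trans _ _ ((t n * pi)%:E)); last exact: ltry.
    by have := @area_discr R (t n) (t0 n) => ->.
  - exact: cmeas_plane.
  - move=> p pt; rewrite -(@ler_pXn2r _ 2) ?nnegrE ?cmod_ge0 ?sqrtr_ge0 //.
    by rewrite cmod_plane sqr_sqrtr ?ltW //; exact: ltW.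
  - by apply: measurable_funTS; exact: measurable_wt.
  - by move=> p; exact: wt_ge0.
  - by move=> p _; exact: wt_le.
  - by move=> N; exact: poly_parseval.
have Un : \bigcup_n (discr (t n)) = discr 1.
  apply/seteqP; split => p.
    by move=> [n _]; apply: discr0_sub.
  rewrite /discr /= => p1.
  have /cvgrPdist_lt/(_ (1 - (p.1 ^+ 2 + p.2 ^+ 2))) := tcvg.
  rewrite subr_gt0 => /(_ p1)[n _ /(_ n (leqnn n))] /= H; exists n => //=.
  by rewrite ger0_norm ?subr_ge0 // in H; lra.
have ndt : nondecreasing_seq (fun n => discr (t n)).
  move=> n m nm; rewrite subsetEset; apply: discr0_sub; rewrite lerD2l lerN2.
  by rewrite lef_pV2 ?posrE // ler_nat !ltnS.
have L : (\int[mu2]_(p in discr (t n)) (cmod (psum a (plane p)) ^+ 2 * wt p)%:E)%E @[n --> \oo] -->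
    (\int[mu2]_(p in discr 1) (cmod (psum a (plane p)) ^+ 2 * wt p)%:E)%E.
  rewrite -Un; apply: ge0_nondecreasing_set_cvg_integral => //.
  - move=> n; apply/measurable_EFinP; apply: measurable_funS mf => //; exact: discr0_sub.
  - by move=> n p pt; rewrite lee_fin mulr_ge0 ?sqr_ge0 // (wt_ge0 (t1' n)).
apply/eqP; rewrite eq_le; apply/andP; split.
  rewrite -(cvg_lim _ L) //; apply: lime_le; first exact: cvgP L.
  apply: nearW => n; rewrite -(cvg_lim _ (lim_n n)) //; apply: lime_le; first exact: cvgP (lim_n n).
  apply: nearW => N; apply: le_trans (ereal_sup_ubound _); last by exists N.
  rewrite lee_fin; apply: ler_sum => k _; rewrite ler_wpM2l ?sqr_ge0 //.
  exact: wmom_le.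
(* For the converse N is fixed first: a finite sum of moments over [discr (t n)] converges to the
   sum over [discr 1], and each is at most the integral. *)
apply: ge_ereal_sup => _ [N _ <-].
have tX m : (fun n => t n ^+ m) @ \oo --> (1 : R) ^+ m.
  elim: m => [|m IH]; first by under eq_fun do rewrite expr0; rewrite expr0; exact: cvg_cst.
  by under eq_fun do rewrite exprS; rewrite exprS; exact: cvgM.
have SN : (fun n => (S (t n) N)%:E) @ \oo --> (S 1 N)%:E.
  apply: cvg_EFin; first exact: nearW.
  apply: (cvgn_sum (F := fun k n => cmod (a k) ^+ 2 * wmom (t n) k)
    (l := fun k => cmod (a k) ^+ 2 * wmom 1 k)) => k.
  apply: cvgM; first exact: cvg_cst.
  apply: cvgM; first exact: cvg_cst.
  by apply: cvgB; apply: cvgM; [exact: tX|exact: cvg_cst|exact: tX|exact: cvg_cst].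
rewrite -/(S 1 N) -(cvg_lim _ SN) //; apply: lime_le; first exact: cvgP SN.
apply: nearW => n; apply: (@le_trans _ _ (\int[mu2]_(p in discr (t n))
    (cmod (psum a (plane p)) ^+ 2 * wt p)%:E)%E).
  rewrite -(cvg_lim _ (lim_n n)) //; apply: lime_ge; first exact: cvgP (lim_n n).
  by exists N => // M; rewrite /= lee_fin => NM; exact: Snd.
apply: ge0_subset_integral => //.
- exact/measurable_EFinP.
- by move=> p pt; rewrite lee_fin mulr_ge0 ?sqr_ge0 // (@wt_ge0 1).
- exact: discr0_sub.
Qed.

End DiscParseval.

(** * Parseval on circles, and the Hardy norm in coefficients *)

Section CircleParseval.
Context {R : realType}.
Local Notation mu := (@lebesgue_measure R).

Lemma circJ (r t : R) : ((circ r t)^*)%C = circ r (- t).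
Proof. by rewrite /circ cosN sinN mulrN. Qed.

Lemma cts_psn (b : nat -> R[i]) N (f : R -> R[i]) t : cts f t -> cts (fun t => psn b N (f t)) t.
Proof.
move=> cf; elim: N => [|N IH]; first by under eq_fun do rewrite /psn big_ord0; exact: cts_cst.
under eq_fun do rewrite /psn big_ord_recr /=.
by apply: ctsD => //; apply: ctsM; [exact: cts_cst|exact: ctsX].
Qed.

Lemma ctsJ (f : R -> R[i]) t : cts f t -> cts (fun t => ((f t)^*)%C) t.
Proof.
move=> [fr fi]; split; rewrite /prop_for /continuous_at ?reJ ?imJ.
  by under eq_fun do rewrite reJ; exact: fr.
by under eq_fun do rewrite imJ; exact: cvgN.
Qed.

Let tpi0 : 0 <= 2 * pi :> R. Proof. by rewrite mulr_ge0 // pi_ge0. Qed.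

Let cint_orth (b : nat -> R[i]) (r : R) M N : (M <= N)%N ->
  cint 0 (2 * pi) (fun t => psn b M (circ r t) * ((circ r t)^*)%C ^+ N) = 0.
Proof.
elim: M => [_|M IH MN].
  rewrite (@eq_cint _ _ _ _ (fun=> 0)) ?cint_cst ?mulr0 // => t _ _.
  by rewrite /psn big_ord0 mul0r.
have c1 (k : nat) : ctson 0 (2 * pi) (fun t => circ r t ^+ k * ((circ r t)^*)%C ^+ N).
  by move=> t _ _; apply: ctsM; apply: ctsX; rewrite ?circJ; [exact: cts_circ|apply: ctsJ; exact: cts_circ].
rewrite (@eq_cint _ _ _ _ (fun t => psn b M (circ r t) * ((circ r t)^*)%C ^+ N +
    b M * (circ r t ^+ M * ((circ r t)^*)%C ^+ N))); last first.
  by move=> t _ _; rewrite /psn big_ord_recr /= mulrDl mulrA.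
rewrite cintD; last 2 first.
- move=> t _ _; apply: ctsM; first by apply: cts_psn; exact: cts_circ.
  by apply: ctsX; apply: ctsJ; exact: cts_circ.
- by move=> t *; apply: ctsM; [exact: cts_cst|exact: c1].
rewrite IH ?(ltnW MN) // add0r cintZ // (@eq_cint _ _ _ _
   (fun t => circ (r ^+ M * r ^+ N) ((M%:R - N%:R) * t))); last first.
  by move=> t _ _; rewrite circJ !circX circM mulrN mulrBl.
rewrite cint_circ_freq ?mulr0 //.
- by rewrite subr_eq0 eqr_nat neq_ltn MN.
- by rewrite mulrBl cosB !cos_nat2pi !sin_nat2pi mulr0 addr0 mulr1.
- by rewrite mulrBl sinB !cos_nat2pi !sin_nat2pi mulr0 mul0r subrr.
Qed.

(** Induction on N: by [cint_orth] the new top term is orthogonal to the lower ones, so the real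
    part of the cross term integrates to 0. *)
Lemma circle_poly_parseval (b : nat -> R[i]) (r : R) N : 0 <= r ->
  (\int[mu]_(t in `[0%R, (2 * pi)%R]) (cmod (psn b N (circ r t)) ^+ 2)%:E =
   (2 * pi * \sum_(k < N) cmod (b k) ^+ 2 * (r ^+ 2) ^+ k)%:E)%E.
Proof.
move=> r0; pose P M t := psn b M (circ r t).
have cP M t : cts (P M) t by apply: cts_psn; exact: cts_circ.
have cz M t : cts (fun t => b M * circ r t ^+ M) t.
  by apply: ctsM; [exact: cts_cst|apply: ctsX; exact: cts_circ].
have csq (f : R -> R[i]) t : cts f t -> cts (fun t => ((cmod (f t) ^+ 2)%:C)%C) t.
  by move=> cf; under eq_fun do rewrite -cmod_mulJ; apply: ctsM => //; exact: ctsJ.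
have E : cint 0 (2 * pi) (fun t => ((cmod (P N t) ^+ 2)%:C)%C) =
    ((2 * pi * \sum_(k < N) cmod (b k) ^+ 2 * (r ^+ 2) ^+ k)%:C)%C.
  elim: N => [|N IH].
    rewrite big_ord0 mulr0 (@eq_cint _ _ _ _ (fun=> 0)) ?cint_cst ?mulr0 // => t _ _.
    by rewrite /P /psn big_ord0 cmod0 expr0n.
  pose h t := P N t * ((b N * circ r t ^+ N)^*)%C.
  have ch t : cts h t by apply: ctsM => //; exact: ctsJ.
  have cre t : cts (fun t => ((re (h t))%:C)%C) t by apply: cts_real; case: (ch t).
  have h0 : cint 0 (2 * pi) h = 0.
    rewrite (@eq_cint _ _ _ _ (fun t => ((b N)^*)%C * (P N t * ((circ r t)^*)%C ^+ N))).
      rewrite cintZ ?cint_orth ?mulr0 // => t _ _; apply: ctsM => //.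
      by apply: ctsX; apply: ctsJ; exact: cts_circ.
    by move=> t _ _; rewrite /h rmorphM rmorphXn; ring.
  have hr : cint 0 (2 * pi) (fun t => ((re (h t))%:C)%C) = 0.
    apply: complex_ext.
      by have /(congr1 (@re R)) := h0.
    by rewrite -[LHS]/(\int[mu]_(t in _) 0) Rintegral_cst // mul0r.
  rewrite (@eq_cint _ _ _ _ (fun t => ((cmod (P N t) ^+ 2)%:C)%C +
     (((cmod (b N) ^+ 2 * (r ^+ 2) ^+ N)%:C)%C + 2%:R * ((re (h t))%:C)%C))); last first.
    move=> t _ _; rewrite /P /psn big_ord_recr /= cmodD_sqr -/(psn b N _) -/(P N t).
    rewrite cmodM cmodX cmod_circ // exprMn -!exprM (mulnC N) /h.
    by rewrite !rmorphD /= addrA [((2 * re _)%:C)%C]rmorphM rmorph_nat.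
  rewrite cintD; last 2 first.
  - by move=> t _ _; exact: csq.
  - by move=> t _ _; apply: ctsD; [exact: cts_cst|apply: ctsM => //; exact: cts_cst].
  rewrite IH cintD; last 2 first.
  - by move=> t _ _; exact: cts_cst.
  - by move=> t _ _; apply: ctsM => //; exact: cts_cst.
  rewrite cint_cst // cintZ; last by move=> t *; exact: cre.
  have H (x y z : R) : (x%:C)%C + (y%:C)%C * (z%:C)%C = ((x + y * z)%:C)%C by rewrite rmorphD rmorphM.
  by rewrite hr mulr0 addr0 subr0 H big_ord_recr [2 * pi * (_ + _)]mulrDr.
have ci : ctson 0 (2 * pi) (fun t => ((cmod (P N t) ^+ 2)%:C)%C) by move=> t *; exact: csq.
have [ii _] := cts_integrable ci.
rewrite -[LHS]fineK; last exact: integrable_fin_num ii.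
by congr EFin; have /(congr1 (@re R)) := E.
Qed.

Lemma circle_parseval (a : nat -> R[i]) (r : R) : 0 <= r -> r < 1 -> subexp a ->
  (fun N => (\sum_(k < N) cmod (a k) ^+ 2 * (r ^+ 2) ^+ k)%:E) @ \oo -->
  (((2 * pi)^-1)%R%:E * \int[mu]_(t in [set t : R | (0 <= t <= 2 * pi)%R])
    (cmod (psum a (circ r t)) ^+ 2)%R%:E)%E.
Proof.
move=> r0 r1 ga.
have -> : [set t : R | 0 <= t <= 2 * pi] = `[0, 2 * pi]%classic.
  by apply/seteqP; split => t; rewrite /= in_itv.
pose s := (r + 1) / 2.
have s0 : 0 < s by rewrite /s; lra.
have s1 : s < 1 by rewrite /s; lra.
have rs : r <= s by rewrite /s; lra.
have mcirc : cmeas `[0, 2 * pi]%classic (circ r).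
  by split; apply: measurable_funTS; apply: continuous_measurable_fun => t; case: (cts_circ r t).
have L := @parseval_limit R _ _ mu `[0, 2 * pi]%classic (circ r) (fun=> 1) s 1 a
  (fun N => 2 * pi * \sum_(k < N) cmod (a k) ^+ 2 * (r ^+ 2) ^+ k) _ _ mcirc s0 s1 _ _ _ _ ga _.
have {}L := L (measurable_itv _).
have {}L : (fun N => (2 * pi * \sum_(k < N) cmod (a k) ^+ 2 * (r ^+ 2) ^+ k)%:E) @ \oo -->
   (\int[mu]_(t in `[0%R, (2 * pi)%R]) (cmod (psum a (circ r t)) ^+ 2)%:E)%E.
  under eq_integral do rewrite -[_ ^+ 2]mulr1.
  apply: L => //.
  - have H : (@lebesgue_measure R `[0%R, (2 * pi)%R] < +oo)%E.
      by rewrite lebesgue_measure_itv /=; case: ifP => _; rewrite ?ltry // -EFinB ltry.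
    exact: H.
  - by move=> t _; rewrite cmod_circ.
  - move=> N; under eq_integral do rewrite mulr1; exact: circle_poly_parseval.
have tpn0 : 2 * pi != 0 :> R by rewrite mulf_neq0 // gt_eqF // pi_gt0.
have -> : (fun N => (\sum_(k < N) cmod (a k) ^+ 2 * (r ^+ 2) ^+ k)%:E) =
    (fun N => ((2 * pi)^-1)%:E * (2 * pi * \sum_(k < N) cmod (a k) ^+ 2 * (r ^+ 2) ^+ k)%:E)%E.
  by apply/funext => N; rewrite -EFinM mulKf.
exact: cvgeZl.
Qed.

Lemma H2_norm2E (a : nat -> R[i]) (f : R[i] -> R[i]) : subexp a ->
  (forall z, in_disc z -> f z = psum a z) ->
  H2_norm2 f = ereal_sup (range (fun N => (\sum_(k < N) cmod (a k) ^+ 2)%:E)).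
Proof.
move=> ga fa; rewrite /H2_norm2.
have rS r : 0 <= r -> r < 1 -> (((2 * pi)^-1)%R%:E *
      \int[@lebesgue_measure R]_(t in [set t : R | (0 <= t <= 2 * pi)%R])
        ((cmod (f (Complex (r * cos t) (r * sin t)))) ^+ 2)%R%:E)%E =
   (((2 * pi)^-1)%R%:E * \int[mu]_(t in [set t : R | (0 <= t <= 2 * pi)%R])
    (cmod (psum a (circ r t)) ^+ 2)%R%:E)%E.
  move=> r0 r1; congr (_ * _)%E; apply: eq_integral => t _.
  by rewrite -[Complex _ _]/(circ r t) fa // /in_disc cmod_circ.
apply/eqP; rewrite eq_le; apply/andP; split.
  apply: ge_ereal_sup => _ [r /andP[r0 r1] <-]; rewrite rS //.
  have L := circle_parseval r0 r1 ga; rewrite -(cvg_lim _ L) //.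
  apply: lime_le; first exact: cvgP L.
  apply: nearW => N; apply: le_trans (ereal_sup_ubound _); last by exists N.
  rewrite lee_fin; apply: ler_sum => k _; rewrite -[leRHS]mulr1 ler_wpM2l ?sqr_ge0 //.
  by rewrite exprn_ile1 ?exprn_ge0 // exprn_ile1 // ltW.
apply: ge_ereal_sup => _ [N _ <-].
pose t n : R := 1 - n.+2%:R^-1.
have t0 n : 0 <= t n by rewrite subr_ge0 invf_le1 // ler1n.
have t1 n : t n < 1 by rewrite gtrBl invr_gt0.
have tcvg : t @ \oo --> (1 : R).
  rewrite -[X in _ --> X]subr0; apply: cvgB; first exact: cvg_cst.
  by have := @cvg_harmonic R; rewrite -cvg_shiftS.
have tX m : (fun n => t n ^+ m) @ \oo --> (1 : R) ^+ m.
  elim: m => [|m IH]; first by under eq_fun do rewrite expr0; rewrite expr0; exact: cvg_cst.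
  by under eq_fun do rewrite exprS; rewrite exprS; exact: cvgM.
have SN : (fun n => (\sum_(k < N) cmod (a k) ^+ 2 * (t n ^+ 2) ^+ k)%:E) @ \oo -->
    (\sum_(k < N) cmod (a k) ^+ 2)%:E.
  apply: cvg_EFin; first exact: nearW.
  apply: (cvgn_sum (F := fun k n => cmod (a k) ^+ 2 * (t n ^+ 2) ^+ k)
    (l := fun k => cmod (a k) ^+ 2)) => k.
  rewrite -[X in _ --> X]mulr1 -(expr1n R (2 * k)); apply: cvgM; first exact: cvg_cst.
  by under eq_fun do rewrite -exprM; exact: tX.
rewrite -(cvg_lim _ SN) //; apply: lime_le; first exact: cvgP SN.
apply: nearW => n; have L := circle_parseval (t0 n) (t1 n) ga.
apply: (@le_trans _ _ (((2 * pi)^-1)%R%:E * \int[mu]_(x in [set x : R | (0 <= x <= 2 * pi)%R])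
    (cmod (psum a (circ (t n) x)) ^+ 2)%R%:E)%E).
  rewrite -(cvg_lim _ L) //; apply: lime_ge; first exact: cvgP L.
  exists N => // M; rewrite /= lee_fin => NM; rewrite -(subnKC NM) big_split_ord /= lerDl.
  by apply: sumr_ge0 => k _; rewrite mulr_ge0 ?sqr_ge0 // exprn_ge0 // sqr_ge0.
apply: ereal_sup_ubound; exists (t n); last by rewrite rS.
by rewrite /= t0 t1.
Qed.

End CircleParseval.

(** * The norm in terms of Taylor coefficients *)

Section Geo3.
Context {R : realType}.
Variable q : R[i].

(* Coefficients of [(\sum_k b_k z^k) / (1 - q z^3)]. *)
Definition geo3 (b : nat -> R[i]) (m : nat) : R[i] :=
  \sum_(i < (m %/ 3).+1) q ^+ i * b (m - 3 * i)%N.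

Lemma geo3_small b m : (m < 3)%N -> geo3 b m = b m.
Proof. by move=> m3; rewrite /geo3 divn_small // big_ord1 expr0 mul1r subn0. Qed.

Lemma geo3_rec b m : geo3 b (m + 3) = b (m + 3)%N + q * geo3 b m.
Proof.
rewrite /geo3 divnDr // divnn /= addn1 big_ord_recl expr0 mul1r subn0; congr (_ + _).
rewrite mulr_sumr; apply: eq_bigr => i _; rewrite lift0 exprS mulrA; congr (_ * b _).
lia.
Qed.

Lemma geo3D b c m : geo3 (fun k => b k + c k) m = geo3 b m + geo3 c m.
Proof. by rewrite /geo3 -big_split; apply: eq_bigr => i _; rewrite /= mulrDr. Qed.

Lemma geo3Z k b m : geo3 (fun i => k * b i) m = k * geo3 b m.
Proof. by rewrite /geo3 mulr_sumr; apply: eq_bigr => i _; rewrite mulrCA. Qed.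

Lemma eq_geo3 b c m : b =1 c -> geo3 b m = geo3 c m.
Proof. by move=> bc; apply: eq_bigr => i _; rewrite bc. Qed.

Hypothesis q1 : cmod q = 1.

(** Since |q| = 1 and r < 1, the n-th term |geo3 b n| r^n is at most the sum of the |b k| r^k for k
    <= n. *)
Lemma subexp_geo3 b : subexp b -> subexp (geo3 b).
Proof.
move=> gb r r0 r1; have [M HM] := subexp_sum gb r0 r1.
exists M => n; apply: le_trans (HM n.+1).
have T0 k : 0 <= cmod (b k) * r ^+ k by rewrite mulr_ge0 ?cmod_ge0 // exprn_ge0 // ltW.
elim/ltn_ind: n => n IH; have [n3|n3] := ltnP n 3.
  rewrite geo3_small // big_ord_recr /= lerDr.
  by apply: sumr_ge0 => i _; exact: T0.
have -> : n = ((n - 3) + 3)%N by rewrite subnK.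
rewrite geo3_rec; set m := (n - 3)%N.
rewrite (le_trans (ler_wpM2r _ (cmodD _ _))) ?exprn_ge0 ?(ltW r0) // mulrDl.
rewrite big_ord_recr /= [leRHS]addrC lerD2l cmodM q1 mul1r exprD mulrA.
have mn : (m < n)%N by rewrite /m; lia.
apply: le_trans (_ : cmod (geo3 b m) * r ^+ m <= _).
  by rewrite ler_piMr ?mulr_ge0 ?cmod_ge0 ?exprn_ge0 ?exprn_ile1 // ltW.
apply: (le_trans (IH m mn)); rewrite addn3 !big_ord_recr /= -!addrA lerD2l lerDl.
by rewrite addr_ge0.
Qed.

(** Once the first three terms of both series are split off, [geo3_rec] closes the identity. *)
Lemma psum_geo3 b z : subexp b -> cmod z < 1 -> (1 - q * z ^+ 3) * psum (geo3 b) z = psum b z.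
Proof.
move=> gb z1; have gg := subexp_geo3 gb.
have S3 c : subexp c -> psum c z =
    c 0%N + z * (c 1%N + z * (c 2%N + z * psum (fun k => c (k + 3)%N) z)).
  move=> gc; have gc1 := subexp_shift gc; have gc2 := subexp_shift gc1.
  rewrite psumS // (psumS gc1) // (psumS gc2) //.
  by rewrite (_ : (fun k => c (k + 3)%N) = fun k => c k.+3) //; apply/funext => k; rewrite addn3.
rewrite mulrBl mul1r {1}(S3 _ gg) (S3 _ gb) !geo3_small //.
have -> : psum (fun k => geo3 b (k + 3)) z = psum (fun k => b (k + 3)%N) z + q * psum (geo3 b) z.
  have g3 : subexp (fun k => b (k + 3)%N).
    rewrite (_ : (fun k => b (k + 3)%N) = fun k => b k.+3); last by apply/funext => k; rewrite addn3.
    by do 3! (apply: (@subexp_shift _ (fun k => _))).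
  rewrite -psumZ // -psumD //; last exact: subexpZ.
  by congr psum; apply/funext => k; rewrite geo3_rec.
ring.
Qed.

End Geo3.

Section Dirichlet.
Context {R : realType}.
Local Notation mu := (@lebesgue_measure R).
Local Notation mu2 := (mu \x mu)%E.

Lemma omega3E : @omega3 R = root1 3.
Proof. by rewrite /omega3 /root1 /circ !mul1r. Qed.

Lemma omega3_sum : 1 + omega3 + omega3 ^+ 2 = 0 :> R[i].
Proof.
rewrite omega3E; have := @geo_root_sum R 3 (root1 3) (@root1X R 3 isT) (@root1_neq1 R 3 1 isT isT).
by rewrite !big_ord_recr big_ord0 /= add0r expr0 expr1.
Qed.

Lemma omega3_cube : omega3 ^+ 3 = 1 :> R[i].
Proof. by rewrite omega3E root1X. Qed.

Lemma cmod_omega3 : cmod (omega3 : R[i]) = 1.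
Proof. by rewrite omega3E cmod_root1. Qed.

(** The Poisson kernel as the real part of the Herglotz kernel (1 + w) / (1 - w), where w is z times
    the conjugate of e. Adding kernels thus becomes adding rational functions of z. *)
Lemma poisson_re (z e : R[i]) : cmod z < 1 -> cmod e = 1 ->
  (1 - cmod z ^+ 2) / cmod (z - e) ^+ 2 = 2 * re ((1 - z * (e^*)%C)^-1) - 1.
Proof.
move=> z1 e1; set w := z * (e^*)%C.
have zw : cmod z = cmod w by rewrite /w cmodM cmod_conj e1 mulr1.
have ew : cmod (z - e) = cmod (1 - w).
  rewrite -[RHS]mulr1 -e1 -cmodM cmodBC mulrBl mul1r /w -mulrA (mulrC _ e) cmod_mulJ e1 expr1n.
  by rewrite rmorph1 mulr1.
rewrite zw ew; have n0 : 0 < cmod (1 - w).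
  by apply: lt_le_trans (le_cmodB_cmod _ _); rewrite cmod1 subr_gt0 -zw.
have -> : (1 - w)^-1 = ((1 - w)^*)%C * ((cmod (1 - w) ^+ 2)^-1%:C)%C.
  have w0 : 1 - w != 0 by rewrite -cmod_gt0.
  apply: (mulfI w0); rewrite divff // mulrA cmod_mulJ -rmorphM divff ?rmorph1 //.
  by rewrite expf_neq0 // gt_eqF.
have -> : re (((1 - w)^*)%C * ((cmod (1 - w) ^+ 2)^-1%:C)%C) = re (1 - w) / cmod (1 - w) ^+ 2.
  by rewrite reM reJ /= mulr0 subr0.
have c2 : cmod (1 - w) ^+ 2 != 0 by rewrite expf_neq0 // gt_eqF.
apply: (mulIf c2); rewrite divfK // mulrBl mul1r mulrA divfK //.
by rewrite !cmod_sqr reD imD reN imN /=; ring.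
Qed.

Variable zeta : R[i].
Hypothesis zeta1 : cmod zeta = 1.
Let pts := [:: zeta; zeta * omega3; zeta * omega3 ^+ 2].
Let q : R[i] := (((zeta ^+ 3)^*)%C).

Lemma cmod_q : cmod q = 1.
Proof. by rewrite cmod_conj cmodX zeta1 expr1n. Qed.

Lemma poisson_ptsE z : cmod z < 1 ->
  poisson_pts pts z = 3 * (1 - (cmod z ^+ 2) ^+ 3) / cmod (1 - q * z ^+ 3) ^+ 2.
Proof.
move=> z1; rewrite /poisson_pts /pts !big_cons big_nil addr0.
rewrite !poisson_re ?cmodM ?cmodX ?cmod_omega3 ?zeta1 ?expr1n ?mulr1 //.
set w := z * (zeta^*)%C; pose v : R[i] := (omega3^*)%C.
have v3 : v ^+ 3 = 1 by rewrite /v -(rmorphXn (@conjc R)) omega3_cube rmorph1.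
have vs : 1 + v + v ^+ 2 = 0.
  by have := congr1 (@conjc R) omega3_sum; rewrite !rmorphD rmorph1 rmorphXn rmorph0.
have -> : z * ((zeta * omega3)^*)%C = w * v by rewrite rmorphM mulrA.
have -> : z * ((zeta * omega3 ^+ 2)^*)%C = w * v ^+ 2 by rewrite rmorphM rmorphXn mulrA.
have w1 : cmod w < 1 by rewrite /w cmodM cmod_conj zeta1 mulr1.
have nz (x : R[i]) : cmod x < 1 -> 1 - x != 0.
  move=> x1; rewrite -cmod_gt0; apply: lt_le_trans (le_cmodB_cmod _ _).
  by rewrite cmod1 subr_gt0.
have v1 : cmod v = 1 by rewrite cmod_conj cmod_omega3.
(* Partial fractions of 3 / (1 - w^3) over the cube roots of unity. *)
have E : (1 - w)^-1 + (1 - w * v)^-1 + (1 - w * v ^+ 2)^-1 = 3%:R * (1 - w ^+ 3)^-1.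
  have n1 := nz _ w1.
  have n2 : 1 - w * v != 0 by apply: nz; rewrite cmodM v1 mulr1.
  have n3 : 1 - w * v ^+ 2 != 0 by apply: nz; rewrite cmodM cmodX v1 expr1n mulr1.
  have n4 : 1 - w ^+ 3 != 0 by apply: nz; rewrite cmodX exprn_ilt1 ?cmod_ge0.
  have v2 : v ^+ 2 = - 1 - v by apply/eqP; rewrite -subr_eq0 -vs; apply/eqP; ring.
  have P : (1 - w) * (1 - w * v) * (1 - w * v ^+ 2) = 1 - w ^+ 3.
    have -> : (1 - w) * (1 - w * v) * (1 - w * v ^+ 2) =
      1 - w * (1 + v + v ^+ 2) + w ^+ 2 * v * (1 + v + v ^+ 2) - w ^+ 3 * v ^+ 3 by ring.
    by rewrite vs v3; ring.
  apply: (mulIf n4); rewrite -[RHS]mulrA mulVf // mulr1 -P.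
  transitivity ((1 - w * v) * (1 - w * v ^+ 2) + (1 - w) * (1 - w * v ^+ 2) + (1 - w) * (1 - w * v)).
    by field; rewrite n1 n2 n3.
  have -> : (1 - w * v) * (1 - w * v ^+ 2) + (1 - w) * (1 - w * v ^+ 2) + (1 - w) * (1 - w * v) =
     3%:R - 2%:R * w * (1 + v + v ^+ 2) + w ^+ 2 * (v ^+ 3 + v ^+ 2 + v) by ring.
  rewrite vs v3; have -> : 1 + v ^+ 2 + v = 0 by rewrite -vs; ring.
  ring.
have w3 : w ^+ 3 = q * z ^+ 3 by rewrite /w /q exprMn rmorphXn mulrC.
have := congr1 (@re R) E; rewrite !reD w3.
have -> : re (3%:R * (1 - q * z ^+ 3)^-1) = 3 * re ((1 - q * z ^+ 3)^-1).
  by rewrite reM /= /re /im /=; ring.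
move=> Er.
(* The same formula is now read backwards at the point q z^3, with pole 1. *)
have := @poisson_re (q * z ^+ 3) 1.
rewrite cmodM cmodX cmod_q mul1r cmod1 rmorph1 mulr1 exprn_ilt1 ?cmod_ge0 // => /(_ isT erefl).
rewrite cmodBC -exprM (mulnC 3) exprM -[3 * _ / _]mulrA => ->.
lra.
Qed.

Lemma ereal_sup_scale (k : R) (X : nat -> R) : 0 < k -> {homo X : n m / (n <= m)%N >-> n <= m} ->
  (k%:E * ereal_sup (range (fun N => (X N)%:E)) = ereal_sup (range (fun N => (k * X N)%:E)))%E.
Proof.
move=> k0 hX.
have H1 : (fun N => (X N)%:E) @ \oo --> ereal_sup (range (fun N => (X N)%:E)).
  by apply: ereal_nondecreasing_cvgn => n m /hX; rewrite lee_fin.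
have H2 : (fun N => (k * X N)%:E) @ \oo --> ereal_sup (range (fun N => (k * X N)%:E)).
  by apply: ereal_nondecreasing_cvgn => n m /hX; rewrite lee_fin ler_pM2l.
have H3 : (fun N => (k * X N)%:E) @ \oo --> (k%:E * ereal_sup (range (fun N => (X N)%:E)))%E.
  have -> : (fun N => (k * X N)%:E) = (fun N => k%:E * (X N)%:E)%E.
    by apply/funext => N; rewrite EFinM.
  exact: cvgeZl.
by rewrite -(cvg_lim _ H3) // -(cvg_lim _ H2).
Qed.

(* The integral of [3 (1 - |z|^6) |z|^(2k)] with respect to normalized area. *)
Definition cw (k : nat) : R := 9 / (k.+1%:R * k.+4%:R).

Lemma cw_gt0 k : 0 < cw k.
Proof. by rewrite divr_gt0 // mulr_gt0. Qed.

Lemma dirichlet_intE (a : nat -> R[i]) (f : R[i] -> R[i]) : subexp a ->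
  (forall z, in_disc z -> f z = psum a z) ->
  dirichlet_int pts f =
  ereal_sup (range (fun N => (\sum_(k < N) cmod (geo3 q (dcoef a) k) ^+ 2 * cw k)%:E)).
Proof.
move=> ga fa; have gd := subexp_dcoef ga; have gg := subexp_geo3 cmod_q gd.
rewrite /dirichlet_int.
have -> : (\int[mu2]_(p in [set p : R * R | (p.1 ^+ 2 + p.2 ^+ 2 < 1)%R])
      ((cmod (cderiv f (Complex p.1 p.2)) ^+ 2 * poisson_pts pts (Complex p.1 p.2))%R%:E) =
    \int[mu2]_(p in discr 1) (cmod (psum (geo3 q (dcoef a)) (plane p)) ^+ 2 * wt p)%:E)%E.
  apply: eq_integral => p; rewrite inE /= => p1; congr EFin.
  have z1 : cmod (plane p) < 1.
    by rewrite -(@ltr_pXn2r _ 2) ?nnegrE ?cmod_ge0 // expr1n cmod_plane.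
  rewrite -/(plane p) (@cderivE _ _ _ (psum (dcoef a) (plane p))); last first.
    apply: (@eq_has_cderiv _ (psum a)) => //; last exact: has_cderiv_psum.
    by move=> z Hz; rewrite fa.
  (* The factor |1 - q z^3|^2 of |f'|^2 cancels the denominator of the Poisson sum. *)
  have := psum_geo3 cmod_q gd z1 => <-.
  have n0 : cmod (1 - q * plane p ^+ 3) != 0.
    rewrite cmod_eq0 -cmod_gt0; apply: lt_le_trans (le_cmodB_cmod _ _).
    by rewrite cmod1 subr_gt0 cmodM cmod_q mul1r cmodX exprn_ilt1 ?cmod_ge0.
  by rewrite poisson_ptsE // cmodM cmod_plane /wt; field.
rewrite disc_parseval // ereal_sup_scale ?invr_gt0 ?pi_gt0 //; last first.
  apply/nondecreasing_seqP => n; rewrite big_ord_recr /= lerDl.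
  by rewrite mulr_ge0 ?sqr_ge0 // wmom_ge0.
suff H k : pi^-1 * wmom 1 k = cw k.
  have E N : pi^-1 * \sum_(k < N) cmod (geo3 q (dcoef a) k) ^+ 2 * wmom 1 k =
      \sum_(k < N) cmod (geo3 q (dcoef a) k) ^+ 2 * cw k.
    by rewrite mulr_sumr; apply: eq_bigr => k _; rewrite mulrCA H.
  by congr (ereal_sup _); apply/seteqP; split=> x [N _ <-]; exists N => //; rewrite E.
have k1 : k.+1%:R != 0 :> R by rewrite pnatr_eq0.
have k4 : k.+4%:R != 0 :> R by rewrite pnatr_eq0.
have p0 : pi != 0 :> R by rewrite gt_eqF // pi_gt0.
have e4 : k.+4%:R = k.+1%:R + 3 :> R by rewrite -natrD addn3.
rewrite /wmom /cw !expr1n !mul1r [3 * pi]mulrC -[_ * 3 * _]mulrA mulKf //.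
move: k1 k4; rewrite e4; move: (k.+1%:R) => x x1 x4.
by field; rewrite x1 x4.
Qed.

End Dirichlet.

Lemma sqr_le2 (R : realType) (u v w : R) : 0 <= u -> u <= v + w -> u ^+ 2 <= 2 * v ^+ 2 + 2 * w ^+ 2.
Proof.
move=> u0 uvw; have uv2 : u ^+ 2 <= (v + w) ^+ 2.
  by rewrite lerXn2r ?nnegrE // (le_trans u0).
apply: (le_trans uv2).
by have := sqr_ge0 (v - w); rewrite !expr2; lra.
Qed.

(** * Sequences of finite energy and their stability under both shifts *)

Section CoefficientSpace.
Context {R : realType}.
Variable q : R[i].
Hypothesis q1 : cmod q = 1.

Definition dgeo (a : nat -> R[i]) := geo3 q (dcoef a).

Definition finite_energy (a : nat -> R[i]) :=
  exists B : R, forall N, \sum_(k < N) cmod (dgeo a k) ^+ 2 * cw k <= B.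

(** Telescoping, since [cw k] = 3 (1 / (k+1) - 1 / (k+4)). *)
Lemma sum_cw N : \sum_(k < N) cw k =
  3 * (11 / 6 - N.+1%:R^-1 - N.+2%:R^-1 - N.+3%:R^-1) :> R.
Proof.
elim: N => [|N IH]; first by rewrite big_ord0; field.
rewrite big_ord_recr /= IH /cw.
have e (k : nat) : N.+1%:R + k%:R = (N.+1 + k)%:R :> R by rewrite natrD.
have -> : N.+2%:R = N.+1%:R + 1 :> R by rewrite (e 1%N) addn1.
have -> : N.+3%:R = N.+1%:R + 2 :> R by rewrite (e 2%N) addn2.
have -> : N.+4%:R = N.+1%:R + 3 :> R by rewrite (e 3%N) addn3.
have x0 : 0 < N.+1%:R :> R by [].
move: (N.+1%:R) x0 => x x0.
by field; rewrite !gt_eqF //; lra.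
Qed.

Lemma sum_cw_le N : \sum_(k < N) cw k <= 6 :> R.
Proof.
rewrite sum_cw; have H k : 0 <= k.+1%:R^-1 :> R by rewrite invr_ge0.
have := H N.+2; have := H N.+1; have := H N.
by move: (N.+1%:R^-1) (N.+2%:R^-1) (N.+3%:R^-1) => x y z x0 y0 z0; lra.
Qed.

Lemma cw_ge0 k : 0 <= cw k :> R.
Proof. exact/ltW/cw_gt0. Qed.

Lemma energy_term_ge0 (a : nat -> R[i]) k : 0 <= cmod (dgeo a k) ^+ 2 * cw k.
Proof. by apply: mulr_ge0; [exact: sqr_ge0|exact: cw_ge0]. Qed.

Lemma sqr_cmodD_le (x y : R[i]) : cmod (x + y) ^+ 2 <= 2 * cmod x ^+ 2 + 2 * cmod y ^+ 2.
Proof.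
exact: sqr_le2 (cmod_ge0 _) (cmodD x y).
Qed.

Lemma dgeoD a b k : dgeo (fun k => a k + b k) k = dgeo a k + dgeo b k.
Proof. by rewrite /dgeo -geo3D; apply: eq_geo3 => i; rewrite /dcoef mulrDr. Qed.

Lemma dgeoZ c a k : dgeo (fun k => c * a k) k = c * dgeo a k.
Proof. by rewrite /dgeo -geo3Z; apply: eq_geo3 => i; rewrite /dcoef mulrCA. Qed.

Lemma finite_energyD a b : finite_energy a -> finite_energy b ->
  finite_energy (fun k => a k + b k).
Proof.
move=> [A HA] [B HB]; exists (2 * A + 2 * B) => N.
apply: (@le_trans _ _ (2 * \sum_(k < N) cmod (dgeo a k) ^+ 2 * cw k +
    2 * \sum_(k < N) cmod (dgeo b k) ^+ 2 * cw k)); last first.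
  by apply: lerD; rewrite ler_pM2l ?HA ?HB.
rewrite !mulr_sumr -big_split /=; apply: ler_sum => k _.
rewrite dgeoD [2 * (cmod (dgeo a k) ^+ 2 * _)]mulrA [2 * (cmod (dgeo b k) ^+ 2 * _)]mulrA -mulrDl.
by apply: ler_wpM2r; [exact: cw_ge0|exact: sqr_cmodD_le].
Qed.

Lemma finite_energyZ c a : finite_energy a -> finite_energy (fun k => c * a k).
Proof.
move=> [A HA]; exists (cmod c ^+ 2 * A) => N.
apply: (le_trans _ (ler_wpM2l (sqr_ge0 (cmod c)) (HA N))).
rewrite mulr_sumr; apply: ler_sum => k _.
by rewrite dgeoZ cmodM exprMn [leRHS]mulrA.
Qed.

Lemma finite_energy_bounded a (C : R) : (forall k, cmod (dgeo a k) <= C) -> finite_energy a.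
Proof.
move=> H; have C0 : 0 <= C := le_trans (cmod_ge0 _) (H 0%N).
exists (C ^+ 2 * 6) => N.
apply: (@le_trans _ _ (\sum_(k < N) C ^+ 2 * cw k)).
  apply: ler_sum => k _; by rewrite ler_wpM2r ?cw_ge0 // lerXn2r ?nnegrE ?cmod_ge0.
by rewrite -mulr_sumr; apply: ler_wpM2l; [exact: sqr_ge0|exact: sum_cw_le].
Qed.

(** A single term of the energy gives |G_k|^2 <= B (k+1) (k+4) / 9, so G grows at most linearly;
    [B + 1] replaces a square root of B. *)
Lemma finite_energy_term a : finite_energy a -> exists2 B : R, 0 <= B &
  forall k, cmod (dgeo a k) <= (B + 1) * k.+1%:R.
Proof.
move=> [B HB]; exists B; first by apply: le_trans (HB 0%N); rewrite big_ord0.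
move=> k; have B0 : 0 <= B by apply: le_trans (HB 0%N); rewrite big_ord0.
have t : cmod (dgeo a k) ^+ 2 * cw k <= B.
  apply: le_trans (HB k.+1); rewrite big_ord_recr /= lerDr.
  by apply: sumr_ge0 => i _; exact: energy_term_ge0.
have x0 : 0 < k.+1%:R :> R by [].
have x1 : 1 <= k.+1%:R :> R by rewrite ler1n.
have e4 : k.+4%:R = k.+1%:R + 3 :> R by rewrite -natrD addn3.
move: t; rewrite /cw e4 mulrA ler_pdivrMr; last by rewrite mulr_gt0 // addr_gt0.
move: (k.+1%:R) x0 x1 => x x0 x1 t.
rewrite -(@ler_pXn2r _ 2) ?nnegrE ?cmod_ge0 ?mulr_ge0 ?addr_ge0 // ?(ltW x0) //.
rewrite exprMn; have Bx : 0 <= B * x ^+ 2 by rewrite mulr_ge0 ?sqr_ge0.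
have : B * (x * (x + 3)) <= B * (4 * x ^+ 2).
  by apply: ler_wpM2l => //; rewrite expr2; nra.
have x20 : 0 <= x ^+ 2 := sqr_ge0 x.
have : 0 <= (B ^+ 2) * x ^+ 2 by rewrite mulr_ge0 ?sqr_ge0.
by rewrite (_ : (B + 1) ^+ 2 * x ^+ 2 = B ^+ 2 * x ^+ 2 + 2 * (B * x ^+ 2) + x ^+ 2); [lra|ring].
Qed.

(* Summation by parts: [geo3 q a (m+1) - dgeo a m / (m+1)] is a bounded sequence
   whose increments are of size [cw m * dgeo a m]. *)
Lemma geo3_coef_bounded a : finite_energy a -> exists B : R, forall m, cmod (geo3 q a m) <= B.
Proof.
move=> ea; have [B B0 HB] := finite_energy_term ea; case: ea => [E HE].
pose U m := geo3 q a m.+1 - dgeo a m / m.+1%:R.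
have UE m : U (m + 3)%N = q * (U m + (((cw m / 3)%:C)%C * dgeo a m)).
  rewrite /U -addSn geo3_rec /dgeo geo3_rec /dcoef -addSn.
  have -> : (m.+1 + 3)%:R = m.+1%:R + 3%:R :> R[i] by rewrite natrD.
  have -> : ((cw m / 3)%:C)%C = 3%:R / (m.+1%:R * (m.+1%:R + 3%:R)) :> R[i].
    have -> : cw m / 3 = 3 / (m.+1%:R * (m.+1%:R + 3)) :> R.
      have e4 : m.+4%:R = m.+1%:R + 3 :> R by rewrite -natrD addn3.
      have x0 : 0 < m.+1%:R :> R by [].
      rewrite /cw e4; move: (m.+1%:R) x0 => x x0; field.
      by rewrite !gt_eqF //; lra.
    have -> : 3 / (m.+1%:R * (m.+1%:R + 3)) = 3%:R / (m.+1 * (m.+1 + 3))%:R :> R by rewrite natrM natrD.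
    by rewrite rmorphM fmorphV !rmorph_nat natrM natrD.
  have n1 : m.+1%:R != 0 :> R[i] by rewrite pnatr_eq0.
  have n4 : m.+1%:R + 3%:R != 0 :> R[i] by rewrite -natrD pnatr_eq0.
  move: (geo3 q (fun k => k.+1%:R * a k.+1) m) (geo3 q a m.+1) (a (m.+1 + 3)%N) => u v w.
  move: (m.+1%:R) n1 n4 => x n1 n4.
  by field; rewrite n1 n4.
(* [T] is bounded and dominates the accumulated increments, because cw |G| / 3 <= cw (1 + |G|^2). *)
pose T n := \sum_(k < n) (cw k + cmod (dgeo a k) ^+ 2 * cw k).
have Tmono n k : (n <= k)%N -> T n <= T k.
  move=> /subnKC <-; rewrite /T big_split_ord /= lerDl.
  by apply: sumr_ge0 => i _; rewrite addr_ge0 ?energy_term_ge0 ?cw_ge0.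
have TB n : T n <= 6 + E by rewrite /T big_split; apply: lerD; [exact: sum_cw_le|exact: HE].
pose U0 := cmod (U 0%N) + cmod (U 1%N) + cmod (U 2%N).
have UB n : cmod (U n) <= U0 + T n.
  elim/ltn_ind: n => n IH; have T0 : 0 <= T n by apply: le_trans (Tmono 0%N n isT); rewrite /T big_ord0.
  have [n3|n3] := ltnP n 3.
    have := cmod_ge0 (U 0%N); have := cmod_ge0 (U 1%N); have := cmod_ge0 (U 2%N).
    by case: n n3 T0 {IH} => [|[|[|]]] // _ T0; rewrite /U0; lra.
  have ne : n = ((n - 3) + 3)%N by rewrite subnK.
  rewrite {1}ne UE cmodM q1 mul1r (le_trans (cmodD _ _)) //.
  have mn : (n - 3 < n)%N by lia.
  have := IH _ mn; have : T (n - 3).+1 <= T n by apply: Tmono; lia.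
  rewrite /T big_ord_recr /= -/(T _) cmodM cmod_real ger0_norm ?divr_ge0 ?cw_ge0 //.
  have := cw_ge0 (n - 3); have := cmod_ge0 (dgeo a (n - 3)).
  move: (cw _) (cmod (dgeo _ _)) => c d c0 d0.
  have : 0 <= c * (d - 1) ^+ 2 by rewrite mulr_ge0 ?sqr_ge0.
  by rewrite expr2; nra.
exists (Num.max (cmod (a 0%N)) (U0 + (6 + E) + (B + 1))) => -[|m].
  by rewrite geo3_small // le_max lexx.
rewrite le_max; apply/orP; right.
have -> : geo3 q a m.+1 = U m + dgeo a m / m.+1%:R by rewrite /U subrK.
rewrite (le_trans (cmodD _ _)) // lerD //; first by apply: (le_trans (UB m)); rewrite lerD2l.
by rewrite cmodM cmodV cmod_nat ler_pdivrMr.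
Qed.

(** The two sides differ by the boundary term q^i c_0 when m + 1 = 3 i, and agree otherwise. *)
Lemma geo3_shift (c : nat -> R[i]) m :
  exists2 u, cmod u <= cmod (c 0%N) & geo3 q c m.+1 = geo3 q (fun k => c k.+1) m + u.
Proof.
elim/ltn_ind: m => m IH; have [m3|m3] := ltnP m 3.
  case: m m3 {IH} => [|[|[|]]] // _.
  - by exists 0; rewrite ?cmod0 ?cmod_ge0 // !geo3_small // addr0.
  - by exists 0; rewrite ?cmod0 ?cmod_ge0 // !geo3_small // addr0.
  - exists (q * c 0%N); first by rewrite cmodM q1 mul1r.
    by rewrite -[3%N]/(0 + 3)%N geo3_rec !geo3_small.
have mn : (m - 3 < m)%N by lia.
have me : m = ((m - 3) + 3)%N by rewrite subnK.
have [u u0 ue] := IH _ mn; exists (q * u); first by rewrite cmodM q1 mul1r.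
by rewrite {1 2}me -addSn !geo3_rec ue addSn; ring.
Qed.

Lemma cw_leS k : cw k <= 3 * cw k.+1 :> R.
Proof.
rewrite /cw mulrA.
have e4 : k.+4%:R = k.+1%:R + 3 :> R by rewrite -natrD addn3.
have e2 : k.+2%:R = k.+1%:R + 1 :> R by rewrite natr1.
have e5 : k.+1.+4%:R = k.+1%:R + 4 :> R by rewrite -natrD addn4.
have x0 : 1 <= k.+1%:R :> R by rewrite ler1n.
rewrite e4 e2 e5; move: (k.+1%:R) x0 => x x0.
rewrite ler_pdivrMr ?mulr_gt0 //; try lra.
rewrite mulrAC ler_pdivlMr ?mulr_gt0 //; try lra.
nra.
Qed.

Lemma cwS_le k : cw k.+1 <= cw k :> R.
Proof.
rewrite /cw ler_wpM2l // lef_pV2 ?posrE ?mulr_gt0 // ler_pM // ler_nat; lia.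
Qed.

(** This makes (f - f(0)) / z an element of D(mu). Its derivative has coefficients [dcoef a k.+1] -
    [a k.+2]; the second part is bounded after [geo3] by [geo3_coef_bounded], hence harmless against
    summable weights. *)
Lemma finite_energy_shift a : finite_energy a -> finite_energy (fun k => a k.+1).
Proof.
move=> ea; have [S HS] := geo3_coef_bounded ea.
pose E := cmod (dcoef a 0%N) + (S + cmod (a 0%N) + cmod (a 1%N)).
have H m : cmod (dgeo (fun k => a k.+1) m) <= cmod (dgeo a m.+1) + E.
  have [u u0 ue] := geo3_shift (dcoef a) m.
  have [v v0 ve] := geo3_shift a m.+1; have [w w0 we] := geo3_shift (fun k => a k.+1) m.
  have -> : dgeo (fun k => a k.+1) m = dgeo a m.+1 - u - (geo3 q a m.+2 - v - w).
    rewrite /dgeo ue ve we.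
    rewrite (@eq_geo3 _ _ _ (fun k => dcoef a k.+1 + (-1) * a k.+2)); last first.
      by move=> k; rewrite /dcoef -[k.+2%:R]natr1; ring.
    by rewrite geo3D geo3Z; ring.
  have := HS m.+2; rewrite /E.
  have := cmodB (dgeo a m.+1 - u) (geo3 q a m.+2 - v - w).
  have := cmodB (dgeo a m.+1) u; have := cmodB (geo3 q a m.+2 - v) w.
  have := cmodB (geo3 q a m.+2) v; lra.
case: ea => B HB; exists (6 * B + 2 * E ^+ 2 * 6) => N.
apply: (@le_trans _ _ (\sum_(k < N) (6 * (cmod (dgeo a k.+1) ^+ 2 * cw k.+1) + 2 * E ^+ 2 * cw k))).
  apply: ler_sum => k _.
  apply: (@le_trans _ _ ((2 * cmod (dgeo a k.+1) ^+ 2 + 2 * E ^+ 2) * cw k)).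
    rewrite ler_wpM2r ?cw_ge0 //.
    exact: sqr_le2 (cmod_ge0 _) (H k).
  rewrite mulrDl lerD2r.
  have -> : 6 * (cmod (dgeo a k.+1) ^+ 2 * cw k.+1) = (2 * cmod (dgeo a k.+1) ^+ 2) * (3 * cw k.+1) by ring.
  by rewrite ler_wpM2l ?cw_leS // mulr_ge0 // sqr_ge0.
rewrite big_split /=; apply: lerD; last first.
  rewrite -mulr_sumr; apply: ler_wpM2l; last exact: sum_cw_le.
  by rewrite mulr_ge0 ?sqr_ge0.
rewrite -mulr_sumr ler_pM2l //; apply: le_trans (HB N.+1); rewrite big_ord_recl /= lerDr.
by exact: energy_term_ge0.
Qed.

Definition unshift (a : nat -> R[i]) k := if k is j.+1 then a j else 0.

(** This makes D(mu) stable under [Mz]. In (z f)' = z f' + f the first term shifts G, and the second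
    becomes the bounded sequence [geo3 q a]. *)
Lemma finite_energy_unshift a : finite_energy a -> finite_energy (unshift a).
Proof.
move=> ea; have [S HS] := geo3_coef_bounded ea.
have H m : cmod (dgeo (unshift a) m.+1) <= cmod (dgeo a m) + S.
  have -> : dgeo (unshift a) m.+1 = dgeo a m + geo3 q a m.+1.
    rewrite /dgeo (@eq_geo3 _ _ _ (fun k => k%:R * a k + a k)); last first.
      by move=> k; rewrite /dcoef -[k.+1%:R]natr1 /=; ring.
    rewrite geo3D; congr (_ + _).
    have [u] := geo3_shift (fun k => k%:R * a k) m; rewrite mul0r cmod0 => u0 ->.
    have -> : u = 0 by apply/eqP; rewrite -cmod_eq0 eq_le u0 cmod_ge0.
    by rewrite addr0.
  by rewrite (le_trans (cmodD _ _)) // lerD2l.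
have S0 : 0 <= S := le_trans (cmod_ge0 _) (HS 0%N).
case: ea => B HB; exists (cmod (dgeo (unshift a) 0%N) ^+ 2 * cw 0 + (2 * B + 2 * S ^+ 2 * 6)) => -[|N].
  rewrite big_ord0 addr_ge0 ?energy_term_ge0 // addr_ge0 //; last by rewrite !mulr_ge0 ?sqr_ge0.
  rewrite mulr_ge0 //; by apply: le_trans (HB 0%N); rewrite big_ord0.
rewrite big_ord_recl lerD2l.
apply: (@le_trans _ _ (\sum_(k < N) (2 * (cmod (dgeo a k) ^+ 2 * cw k) + 2 * S ^+ 2 * cw k))).
  apply: ler_sum => k _; rewrite lift0.
  apply: (@le_trans _ _ (cmod (dgeo (unshift a) k.+1) ^+ 2 * cw k)).
    by rewrite ler_wpM2l ?sqr_ge0 // cwS_le.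
  rewrite [2 * (_ * _)]mulrA -mulrDl ler_wpM2r ?cw_ge0 //.
  exact: sqr_le2 (cmod_ge0 _) (H k).
rewrite big_split /=; apply: lerD; first by rewrite -mulr_sumr ler_pM2l // HB.
rewrite -mulr_sumr; apply: ler_wpM2l; last exact: sum_cw_le.
by rewrite mulr_ge0 ?sqr_ge0.
Qed.

Lemma dgeo_rec a j : dgeo a (j + 3) = (j + 3).+1%:R * a (j + 3).+1 + q * dgeo a j.
Proof. by rewrite /dgeo geo3_rec. Qed.

(** Inverts the recurrence: (j+4) a_(j+4) = G_(j+3) - q G_j, and 1 / (j+4)^2 is dominated by both
    weights. *)
Lemma coef_energy_le a j : cmod (a (j + 3).+1) ^+ 2 <=
  2 * (cmod (dgeo a (j + 3)) ^+ 2 * cw (j + 3)) + 2 * (cmod (dgeo a j) ^+ 2 * cw j).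
Proof.
have x0 : 0 < j.+1%:R :> R by [].
have e4 : (j + 3).+1%:R = j.+1%:R + 3 :> R by rewrite -natrD addSn.
have e7 : (j + 3).+4%:R = j.+1%:R + 6 :> R by rewrite -natrD; congr (_%:R); lia.
have e4' : j.+4%:R = j.+1%:R + 3 :> R by rewrite -natrD; congr (_%:R); lia.
have H : (j + 3).+1%:R * cmod (a (j + 3).+1) <= cmod (dgeo a (j + 3)) + cmod (dgeo a j).
  rewrite -(@cmod_nat R) -cmodM -[cmod (dgeo a j)]mul1r -q1 -cmodM.
  by rewrite (_ : _ * a _ = dgeo a (j + 3) - q * dgeo a j) ?cmodB // dgeo_rec addrK.
have n0 : 0 <= (j + 3).+1%:R * cmod (a (j + 3).+1) by rewrite mulr_ge0 ?cmod_ge0.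
have := sqr_le2 n0 H; rewrite exprMn e4 /cw e4 e7 e4'.
have := sqr_ge0 (cmod (dgeo a (j + 3))); have := sqr_ge0 (cmod (dgeo a j)).
move: (cmod (a _) ^+ 2) (cmod _ ^+ 2) (cmod _ ^+ 2) => u v w; move: (j.+1%:R) x0 => x x0 v0 w0 h.
have y0 : 0 < (x + 3) ^+ 2 by rewrite exprn_gt0 //; lra.
apply: (@le_trans _ _ ((2 * w + 2 * v) / (x + 3) ^+ 2)).
  by rewrite ler_pdivlMr // mulrC.
have i1 : ((x + 3) ^+ 2)^-1 <= 9 / ((x + 3) * (x + 6)).
  rewrite ler_pdivlMr ?mulr_gt0 //; try lra.
  by rewrite mulrC ler_pdivrMr // expr2; nra.
have i2 : ((x + 3) ^+ 2)^-1 <= 9 / (x * (x + 3)).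
  rewrite ler_pdivlMr ?mulr_gt0 //; try lra.
  by rewrite mulrC ler_pdivrMr // expr2; nra.
rewrite mulrDl -!mulrA; apply: lerD; rewrite ler_pM2l // ler_wpM2l //.
Qed.

(** The inclusion of D(mu) in the Hardy space. [coef_energy_le] starts at index 4, so the first four
    coefficients are counted apart. *)
Lemma finite_energy_l2 a : finite_energy a ->
  exists B : R, forall N, \sum_(k < N) cmod (a k) ^+ 2 <= B.
Proof.
move=> [B HB]; exists (\sum_(k < 4) cmod (a k) ^+ 2 + (2 * B + 2 * B)) => N.
apply: (@le_trans _ _ (\sum_(k < 4 + N) cmod (a k) ^+ 2)).
  rewrite addnC big_split_ord /= lerDl; apply: sumr_ge0 => i _; exact: sqr_ge0.
rewrite big_split_ord /= lerD2l.
apply: (@le_trans _ _ (\sum_(j < N) (2 * (cmod (dgeo a (j + 3)) ^+ 2 * cw (j + 3)) +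
    2 * (cmod (dgeo a j) ^+ 2 * cw j)))).
  apply: ler_sum => j _; rewrite (_ : (4 + j)%N = (j + 3).+1) ?coef_energy_le //; lia.
rewrite big_split /= -2!mulr_sumr; apply: lerD; rewrite ler_pM2l //; last exact: HB.
apply: le_trans (HB (3 + N)%N); rewrite big_split_ord /=.
rewrite (eq_bigr (fun j : 'I_N => cmod (dgeo a (3 + j)) ^+ 2 * cw (3 + j))); last by move=> j _; rewrite addnC.
rewrite lerDr; apply: sumr_ge0 => i _; exact: energy_term_ge0.
Qed.

End CoefficientSpace.

(** The primed letters stand for conjugates, which makes polarization a polynomial identity modulo
    I^2 = -1. *)
Lemma polarization4 (R : realType) (I u v u' v' : R[i]) : I ^+ 2 = -1 ->
  (u + v) * (u' + v') + I * ((u + I * v) * (u' - I * v')) -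
  (u - v) * (u' - v') - I * ((u - I * v) * (u' + I * v')) = 4%:R * (u * v').
Proof. by move=> HI; ring: HI. Qed.

Section EnergyPairing.
Context {R : realType}.
Variable q : R[i].

Definition ipn (a b : nat -> R[i]) N : R[i] :=
  \sum_(k < N) (a k * ((b k)^*)%C + ((cw k)%:C)%C * (dgeo q a k * ((dgeo q b k)^*)%C)).

Lemma dgeo_axpy a b c k : dgeo q (fun k => a k + c * b k) k = dgeo q a k + c * dgeo q b k.
Proof. by rewrite dgeoD dgeoZ. Qed.

(** [Dmu_inner] is defined by polarization; proving the same identity for truncated sums reduces its
    coefficient formula to that of the norm. *)
Lemma ipn_polarization a b N :
  (4%:R)^-1 * \sum_(j < 4) (Complex 0 1) ^+ j *
    ipn (fun k => a k + (Complex 0 1) ^+ j * b k) (fun k => a k + (Complex 0 1) ^+ j * b k) N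
  = ipn a b N.
Proof.
have n4 : 4%:R != 0 :> R[i] by rewrite pnatr_eq0.
apply: (mulfI n4); rewrite mulrA divff // mul1r /ipn mulr_sumr.
rewrite (eq_bigr (fun j : 'I_4 => \sum_(k < N) (Complex 0 1) ^+ j * (
   (a k + Complex 0 1 ^+ j * b k) * ((a k + Complex 0 1 ^+ j * b k)^*)%C +
   ((cw k)%:C)%C * ((dgeo q a k + Complex 0 1 ^+ j * dgeo q b k) *
      ((dgeo q a k + Complex 0 1 ^+ j * dgeo q b k)^*)%C)))); last first.
  by move=> j _; rewrite mulr_sumr; apply: eq_bigr => k _; rewrite dgeo_axpy.
rewrite exchange_big; apply: eq_bigr => k _ /=.
rewrite !big_ord_recr big_ord0 /= add0r.
set I := Complex 0 1 : R[i].
have I2 : I ^+ 2 = -1 by apply: complex_ext => /=; ring.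
have cI : (I^*)%C = - I by apply: complex_ext => /=; ring.
have I3 : I ^+ 3 = - I by rewrite exprS I2 mulrN1.
rewrite I2 I3 expr0 expr1 !mul1r.
have cNI : ((- I)^*)%C = I by apply: complex_ext => /=; ring.
have cN1 : ((- 1 : R[i])^*)%C = - 1 by apply: complex_ext => /=; ring.
have cD (x y : R[i]) : ((x + y)^*)%C = (x^*)%C + (y^*)%C := rmorphD (@conjc R) x y.
have cM (x y : R[i]) : ((x * y)^*)%C = (x^*)%C * (y^*)%C := rmorphM (@conjc R) x y.
rewrite !cD !cM cNI cN1 cI.
have := @polarization4 R I (a k) (b k) ((a k)^*)%C ((b k)^*)%C I2.
have := @polarization4 R I (dgeo q a k) (dgeo q b k) ((dgeo q a k)^*)%C ((dgeo q b k)^*)%C I2.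
move: ((cw k)%:C)%C (a k) (b k) (dgeo q a k) (dgeo q b k) => w u v s t.
move: (u^*)%C (v^*)%C (s^*)%C (t^*)%C => u' v' s' t' H1 H2.
rewrite [RHS]mulrDr -H2 [4%:R * (w * _)]mulrCA -H1; ring.
Qed.

Lemma ipnD a a' b N : ipn (fun k => a k + a' k) b N = ipn a b N + ipn a' b N.
Proof. by rewrite -big_split; apply: eq_bigr => k _; rewrite /= dgeoD; ring. Qed.

Lemma ipnZ c a b N : ipn (fun k => c * a k) b N = c * ipn a b N.
Proof. by rewrite mulr_sumr; apply: eq_bigr => k _; rewrite /= dgeoZ; ring. Qed.

Lemma ipn_self a N : ipn a a N =
  ((\sum_(k < N) cmod (a k) ^+ 2 + \sum_(k < N) cmod (dgeo q a k) ^+ 2 * cw k)%:C)%C.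
Proof.
rewrite -big_split rmorph_sum; apply: eq_bigr => k _.
by rewrite !cmod_mulJ /= rmorphD [cmod (dgeo q a k) ^+ 2 * _]mulrC (rmorphM _ (cw k)).
Qed.

End EnergyPairing.

Lemma ereal_sup_partial (R : realType) (u : nat -> R) (B : R) :
  {homo u : n m / (n <= m)%N >-> n <= m} -> (forall n, u n <= B) ->
  exists2 l : R, ereal_sup (range (fun N => (u N)%:E)) = l%:E &
    ccvg (fun n => ((u n)%:C)%C) (l%:C)%C.
Proof.
move=> um uB.
have ub : has_ubound (range u) by exists B => _ [n _ <-].
exists (sup (range u)).
  by rewrite -ereal_sup_EFin //; [rewrite image_comp|exists (u 0%N); exists 0%N].
have hs : has_sup (range u) by split=> //; exists (u 0%N); exists 0%N.
move=> e e0; have [_ [N _ <-] HN] := sup_adherent e0 hs.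
exists N => n Nn.
have h1 : u N <= u n := um _ _ Nn.
have h2 : u n <= sup (range u) by apply: ub_le_sup => //; exists n.
by rewrite -rmorphB cmod_real ler_norml; move: HN h1 h2; lra.
Qed.

Section DirichletSpace.
Context {R : realType}.
Variable zeta : R[i].
Hypothesis zeta1 : cmod zeta = 1.
Let pts := [:: zeta; zeta * omega3; zeta * omega3 ^+ 2].
Let q : R[i] := (((zeta ^+ 3)^*)%C).
Let q1 : cmod q = 1 := cmod_q zeta1.

Definition taylor_coefs (f : R[i] -> R[i]) (a : nat -> R[i]) :=
  [/\ subexp a, forall z, in_disc z -> f z = psum a z & finite_energy q a].

Lemma holomorphic_psum (f : R[i] -> R[i]) a : subexp a -> (forall z, in_disc z -> f z = psum a z) ->
  holomorphic_on_disc f.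
Proof.
move=> ga fa z z1; exists (psum (dcoef a) z).
apply: (@eq_has_cderiv _ (psum a)) => //; last exact: has_cderiv_psum.
by move=> w w1; rewrite fa.
Qed.

Lemma in_Dmu_taylor f : in_Dmu pts f <-> exists a, taylor_coefs f a.
Proof.
split=> [[hf df]|[a [ga fa [B HB]]]].
  have [a ga fa] := taylor_expansion hf; exists a; split=> //.
  move: df; rewrite (dirichlet_intE zeta1 ga fa) => df.
  set s := ereal_sup _ in df; exists (fine s) => N.
  have sN : ((\sum_(k < N) cmod (dgeo q a k) ^+ 2 * cw k)%:E <= s)%E.
    by apply: ereal_sup_ubound; exists N.
  rewrite -lee_fin fineK // ge0_fin_numE //.
  by apply: ereal_sup_ubound; exists 0%N => //; rewrite big_ord0.
split; first exact: holomorphic_psum fa.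
rewrite (dirichlet_intE zeta1 ga fa); apply: (@le_lt_trans _ _ B%:E); last exact: ltry.
by apply: ub_ereal_sup => _ [N _ <-]; rewrite lee_fin; exact: HB.
Qed.

Lemma Dmu_norm2_cvg f a : taylor_coefs f a ->
  ccvg (ipn q a a) ((Dmu_norm2 pts f)%:C)%C.
Proof.
move=> [ga fa ea]; rewrite /Dmu_norm2 (dirichlet_intE zeta1 ga fa) (H2_norm2E ga fa).
(* Both suprema are finite, so [fine] returns their true sum. *)
have [B1 HB1] := finite_energy_l2 q1 ea; case: (ea) => B2 HB2.
have [||l1 -> c1] := @ereal_sup_partial R (fun N => \sum_(k < N) cmod (a k) ^+ 2) B1 _ _.
- by move=> n m /subnKC <-; rewrite big_split_ord /= lerDl; apply: sumr_ge0 => i _; exact: sqr_ge0.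
- exact: HB1.
have [||l2 -> c2] := @ereal_sup_partial R (fun N => \sum_(k < N) cmod (dgeo q a k) ^+ 2 * cw k) B2 _ _.
- by move=> n m /subnKC <-; rewrite big_split_ord /= lerDl; apply: sumr_ge0 => i _; exact: energy_term_ge0.
- exact: HB2.
rewrite -EFinD /= rmorphD; have := ccvgD c1 c2; congr ccvg.
by apply/funext => N; rewrite ipn_self rmorphD.
Qed.

Lemma taylor_axpy f g a b c : taylor_coefs f a -> taylor_coefs g b ->
  taylor_coefs (fadd f (fscale c g)) (fun k => a k + c * b k).
Proof.
move=> [ga fa ea] [gb fb eb]; have gcb : subexp (fun k => c * b k) by exact: subexpZ.
split; first exact: subexpD.
- by move=> z z1; rewrite /fadd /fscale fa // fb // psumD // psumZ.
- by apply: finite_energyD => //; exact: finite_energyZ.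
Qed.

Lemma ccvg_sum n (u : 'I_n -> nat -> R[i]) (l : 'I_n -> R[i]) :
  (forall i, ccvg (u i) (l i)) -> ccvg (fun N => \sum_(i < n) u i N) (\sum_(i < n) l i).
Proof.
move=> H; elim: n u l H => [|n IH] u l H.
  by under eq_fun do rewrite big_ord0; rewrite big_ord0; exact: ccvg_cst.
under eq_fun do rewrite big_ord_recr; rewrite big_ord_recr /=.
by apply: ccvgD; [apply: IH => i; exact: H|exact: H].
Qed.

Lemma Dmu_inner_cvg f g a b : taylor_coefs f a -> taylor_coefs g b ->
  ccvg (ipn q a b) (Dmu_inner pts f g).
Proof.
move=> fa gb; rewrite (_ : ipn q a b = fun N => (4%:R)^-1 * \sum_(j < 4) (Complex 0 1) ^+ j *
    ipn q (fun k => a k + (Complex 0 1) ^+ j * b k) (fun k => a k + (Complex 0 1) ^+ j * b k) N);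
  last by apply/funext => N; rewrite ipn_polarization.
apply: ccvgZ; apply: (@ccvg_sum 4) => j; apply: ccvgZ.
exact/Dmu_norm2_cvg/taylor_axpy.
Qed.

Lemma taylor_Mz f a : taylor_coefs f a -> taylor_coefs (Mz f) (unshift a).
Proof.
move=> [ga fa ea]; have gu : subexp (unshift a) by exact: subexp_unshift.
split.
- exact: gu.
- by move=> z z1; rewrite /Mz psumS // fa //= add0r.
- exact: finite_energy_unshift.
Qed.

Lemma taylor_eq f g a : eq_on_disc f g -> taylor_coefs f a -> taylor_coefs g a.
Proof. by move=> fg [ga fa ea]; split=> // z z1; rewrite -fg // fa. Qed.

End DirichletSpace.

Lemma ccvg_eventually (R : realType) (u : nat -> R[i]) l N0 :
  (forall n, (N0 <= n)%N -> u n = l) -> ccvg u l.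
Proof. by move=> H e e0; exists N0 => n Nn; rewrite H // subrr cmod0 ltW. Qed.

Lemma subexp_bounded (R : realType) (a : nat -> R[i]) (C : R) :
  (forall k, cmod (a k) <= C) -> subexp a.
Proof.
move=> H r r0 r1; exists C => n; rewrite -[leRHS]mulr1.
by apply: ler_pM; rewrite ?cmod_ge0 ?exprn_ge0 ?exprn_ile1 // ltW.
Qed.

(** * The orbit of 1 under the Cauchy dual *)

Section CauchyDualOrbit.
Context {R : realType}.
Variable zeta : R[i].
Hypothesis zeta1 : cmod zeta = 1.
Let pts := [:: zeta; zeta * omega3; zeta * omega3 ^+ 2].
Let q : R[i] := (((zeta ^+ 3)^*)%C).
Let q1 : cmod q = 1 := cmod_q zeta1.
Local Notation taylor := (taylor_coefs zeta).

(** Elements are represented by functions on all of [R[i]]; this frees the inner product from their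
    values off the disc. *)
Lemma Dmu_inner_coefs f f' g g' a b : taylor f a -> taylor f' a -> taylor g b -> taylor g' b ->
  Dmu_inner pts f g = Dmu_inner pts f' g'.
Proof.
move=> fa fa' gb gb'.
exact: ccvg_uniq (Dmu_inner_cvg zeta1 fa gb) (Dmu_inner_cvg zeta1 fa' gb').
Qed.

Definition unit_coefs (k : nat) : R[i] := (k == 0%N)%:R.

Lemma dgeo_unit k : dgeo q unit_coefs k = 0.
Proof. by rewrite /dgeo /geo3 big1 // => i _; rewrite /dcoef mulr0 mulr0. Qed.

Lemma taylor_unit : taylor (fun=> 1) unit_coefs.
Proof.
have s : subexp unit_coefs.
  apply: (@subexp_bounded _ _ 1) => k; rewrite /unit_coefs.
  by case: eqP; rewrite ?cmod1 ?cmod0.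
split=> //; last by apply: (@finite_energy_bounded _ _ _ 0) => k; rewrite dgeo_unit cmod0.
move=> z z1; apply/esym/psumE => //; apply: (@ccvg_eventually _ _ _ 1) => -[//|n] _.
rewrite /psn big_ord_recl big1 ?addr0; first by rewrite /unit_coefs mul1r.
by move=> i _; rewrite /unit_coefs mul0r.
Qed.

Lemma ipn_unitr b N : ipn q b unit_coefs N.+1 = b 0%N.
Proof.
rewrite /ipn (eq_bigr (fun k : 'I_N.+1 => b k * unit_coefs k)); last first.
  by move=> k _; rewrite dgeo_unit rmorph0 !mulr0 addr0 /unit_coefs rmorph_nat.
rewrite big_ord_recl big1 ?addr0; first by rewrite /unit_coefs mulr1.
by move=> i _; rewrite /unit_coefs mulr0.
Qed.

Lemma ipn_unitl b N : b 0%N = 0 -> ipn q unit_coefs b N = 0.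
Proof.
move=> b0; rewrite /ipn big1 // => k _; rewrite dgeo_unit mul0r mulr0 addr0 /unit_coefs.
by case: eqP => [->|_]; rewrite ?mul0r // b0 rmorph0 mulr0.
Qed.

Lemma coefs_split (b : nat -> R[i]) :
  b = fun k => b 0%N * unit_coefs k + unshift (fun j => b j.+1) k.
Proof. by apply/funext => -[|k]; rewrite /unit_coefs /= ?mulr1 ?addr0 // mulr0 add0r. Qed.

Definition coef_functional (n : nat) (f : R[i] -> R[i]) :=
  (exists a, taylor f a) /\ forall g b, taylor g b -> Dmu_inner pts g f = b n.

Lemma coef_functional_unit : coef_functional 0 (fun=> 1).
Proof.
split; first by exists unit_coefs; exact: taylor_unit.
move=> g b gb; apply: ccvg_uniq (Dmu_inner_cvg zeta1 gb taylor_unit) _.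
by apply: (@ccvg_eventually _ _ _ 1) => -[//|N] _; rewrite ipn_unitr.
Qed.

Lemma coef_functional_cauchy_dual (Tp : (R[i] -> R[i]) -> (R[i] -> R[i])) n f :
  is_cauchy_dual_Dmu pts Mz Tp -> coef_functional n f -> coef_functional n.+1 (Tp f).
Proof.
move=> [A [[_ HA] HTp]] [[a fa] Hf].
have [y [yD Ay Ty]] := HTp f ((in_Dmu_taylor zeta1 f).2 (ex_intro _ a fa)).
have [c yc] := (in_Dmu_taylor zeta1 y).1 yD.
have zc := taylor_Mz zeta1 yc.
have Tc : taylor (Tp f) (unshift c) by apply: taylor_eq zc => z z1; rewrite Ty.
split; first by exists (unshift c).
move=> g b gb; set g0 := psum (fun k => b k.+1).
have gb0 : taylor g0 (fun k => b k.+1).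
  case: gb => sb _ eb; split=> //; first exact: subexp_shift.
  exact: finite_energy_shift.
have zg := taylor_Mz zeta1 gb0.
(* The defining property of the Cauchy dual: <z g0, z y> equals <g0, A (z y)> = <g0, f>, and the
   n-th coefficient of g0 is b_(n+1). *)
have e0 : Dmu_inner pts (Mz g0) (Mz y) = b n.+1.
  rewrite HA; last 2 first.
  - by apply/(in_Dmu_taylor zeta1); exists (fun k => b k.+1).
  - by apply/(in_Dmu_taylor zeta1); exists (unshift c).
  have Aa : taylor (A (Mz y)) a by apply: taylor_eq fa => z z1; rewrite Ay.
  by rewrite (Dmu_inner_coefs gb0 gb0 Aa fa) (Hf _ _ gb0).
(* g and z g0 differ by the constant b_0, which is orthogonal to z y: a constant has zero
   derivative, and z y has zero constant term. *)
have E : ipn q (unshift (fun k => b k.+1)) (unshift c) = ipn q b (unshift c).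
  apply/funext => N; rewrite [in RHS](coefs_split b) ipnD ipnZ.
  by rewrite ipn_unitl // mulr0 add0r.
have := Dmu_inner_cvg zeta1 zg zc; rewrite -/q E e0 => H.
exact: ccvg_uniq (Dmu_inner_cvg zeta1 gb Tc) H.
Qed.

(** The representing function is tested against itself. *)
Lemma coef_functional_norm n f a : taylor f a -> coef_functional n f ->
  a n = ((Dmu_norm2 pts f)%:C)%C.
Proof.
move=> fa [_ Hf]; rewrite -(Hf _ _ fa).
exact: ccvg_uniq (Dmu_inner_cvg zeta1 fa fa) (Dmu_norm2_cvg zeta1 fa).
Qed.

(* The coefficients whose weighted derivative [dgeo] is the [l]-th unit sequence. *)
Definition test_coefs (l k : nat) : R[i] :=
  (k == l.+1)%:R / l.+1%:R - q * ((k == l.+4)%:R / l.+4%:R).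

Lemma dcoef_test l k : dcoef (test_coefs l) k = (k == l)%:R - q * (k == (l + 3)%N)%:R.
Proof.
rewrite addn3 /dcoef /test_coefs !eqSS mulrBr (mulrCA _ q).
have H m : k.+1%:R * ((k == m)%:R / m.+1%:R) = (k == m)%:R :> R[i].
  by case: eqP => [->|_]; rewrite ?mul0r ?mulr0 // mul1r divff // pnatr_eq0.
by rewrite !H.
Qed.

Lemma dgeo_test l k : dgeo q (test_coefs l) k = (k == l)%:R.
Proof.
elim/ltn_ind: k => k IH; rewrite /dgeo; have [k3|k3] := ltnP k 3.
  rewrite geo3_small // dcoef_test (_ : (k == l + 3)%N = false) ?mulr0 ?subr0 //.
  by apply/negbTE; lia.
have -> : k = ((k - 3) + 3)%N by rewrite subnK.
rewrite geo3_rec -/(dgeo q _ _) IH; last by lia.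
by rewrite dcoef_test eqn_add2r subrK.
Qed.

Lemma taylor_test l : taylor (psum (test_coefs l)) (test_coefs l).
Proof.
split=> //; last first.
  apply: (@finite_energy_bounded _ _ _ 1) => k; rewrite dgeo_test.
  by case: eqP; rewrite ?cmod1 ?cmod0.
have i1 n : cmod (n.+1%:R^-1 : R[i]) <= 1.
  by rewrite cmodV cmod_nat invf_le1 // ler1n.
apply: (@subexp_bounded _ _ 2) => k; rewrite (le_trans (cmodB _ _)) //.
have -> : 2 = 1 + 1 :> R by [].
apply: lerD; rewrite ?(cmodM q) ?q1 ?mul1r; case: eqP => _; rewrite ?mul1r ?mul0r ?cmod0 //.
Qed.

Lemma ipn_test l a N : (l + 5 <= N)%N -> ipn q (test_coefs l) a N =
  ((a l.+1)^*)%C / l.+1%:R - q * (((a l.+4)^*)%C / l.+4%:R) + ((cw l)%:C)%C * ((dgeo q a l)^*)%C.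
Proof.
move=> lN; have pick (j : nat) (u : nat -> R[i]) : (j < N)%N -> \sum_(k < N) (k == j :> nat)%:R * u k = u j.
  move=> jN; rewrite (bigD1 (Ordinal jN)) //= eqxx mul1r big1 ?addr0 // => k kj.
  by rewrite (_ : (k == j :> nat) = false) ?mul0r //; apply/negbTE.
rewrite /ipn.
rewrite (eq_bigr (fun k : 'I_N => (k == l.+1 :> nat)%:R * (((a k)^*)%C / l.+1%:R)
   - q * ((k == l.+4 :> nat)%:R * (((a k)^*)%C / l.+4%:R))
   + (k == l :> nat)%:R * (((cw k)%:C)%C * ((dgeo q a k)^*)%C))); last first.
  by move=> k _; rewrite dgeo_test /test_coefs; ring.
rewrite !big_split /= sumrN -mulr_sumr.
rewrite (pick l.+1 (fun k => ((a k)^*)%C / l.+1%:R)); last by lia.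
rewrite (pick l.+4 (fun k => ((a k)^*)%C / l.+4%:R)); last by lia.
by rewrite (pick l (fun k => ((cw k)%:C)%C * ((dgeo q a k)^*)%C)) //; lia.
Qed.

(** The test function [test_coefs l] is paired with f: the result is its n-th coefficient, and the
    equation is multiplied by (l+1) (l+4). Conjugates occur because f stands in the second slot. *)
Lemma coef_functional_eq n f a l : taylor f a -> coef_functional n f ->
  l.+4%:R * (((a l.+1)^*)%C - (n == l.+1)%:R) - l.+1%:R * (q * (((a l.+4)^*)%C - (n == l.+4)%:R))
  + 9%:R * ((dgeo q a l)^*)%C = 0.
Proof.
move=> fa [_ Hf].
have := ccvg_uniq (Dmu_inner_cvg zeta1 (taylor_test l) fa) (ccvg_eventually (@ipn_test l a)).
rewrite (Hf _ _ (taylor_test l)) /test_coefs.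
have -> : ((cw l)%:C)%C = 9%:R / (l.+1%:R * l.+4%:R) :> R[i].
  have -> : cw l = 9%:R / (l.+1 * l.+4)%:R :> R by rewrite natrM.
  by rewrite rmorphM fmorphV !rmorph_nat natrM.
have n1 : l.+1%:R != 0 :> R[i] by rewrite pnatr_eq0.
have n4 : l.+4%:R != 0 :> R[i] by rewrite pnatr_eq0.
move: ((n == l.+1)%:R) ((n == l.+4)%:R) ((a l.+1)^*)%C ((a l.+4)^*)%C ((dgeo q a l)^*)%C.
move: (l.+1%:R) (l.+4%:R) n1 n4 => x y n1 n4 s t u v w H.
have -> : y * (u - s) - x * (q * (v - t)) + 9%:R * w =
  x * y * ((u / x - q * (v / y) + 9%:R / (x * y) * w) - (s / x - q * (t / y))).
  by field; rewrite n1 n4.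
by rewrite -H subrr mulr0.
Qed.

End CauchyDualOrbit.

(** * Norms along the orbit *)

Section Recurrence.
Context {R : realType}.

Definition lam : R := (11 - 3 * Num.sqrt 13) / 2.

Lemma sqrt13 : Num.sqrt 13 ^+ 2 = 13 :> R.
Proof. by rewrite sqr_sqrtr. Qed.

Lemma lam_bounds : 9 / 100 < lam /\ lam < 95 / 1000.
Proof.
have s0 : 0 <= Num.sqrt 13 :> R := sqrtr_ge0 13.
have := sqrt13; rewrite /lam expr2; move: (Num.sqrt 13) s0 => s s0 s2.
by split; nra.
Qed.

Lemma lam_root : (11 - lam) * lam = 1.
Proof.
have := sqrt13; rewrite /lam; move: (Num.sqrt 13) => s s2.
have -> : (11 - (11 - 3 * s) / 2) * ((11 - 3 * s) / 2) = (121 - 9 * s ^+ 2) / 4 by field.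
by rewrite s2; field.
Qed.

Lemma expr_unbounded (t C : R) : 1 < t -> (forall n, t ^+ n <= C) -> False.
Proof.
move=> t1 H.
have B n : 1 + n%:R * (t - 1) <= t ^+ n.
  elim: n => [|n IH]; first by rewrite mul0r addr0 expr0.
  rewrite exprS -natr1; have n0 : 0 <= n%:R :> R by [].
  move: (t ^+ n) (n%:R) n0 IH => u m m0 IH.
  apply: (@le_trans _ _ (t * (1 + m * (t - 1)))); last by rewrite ler_pM2l //; lra.
  have : 0 <= m * (t - 1) ^+ 2 by rewrite mulr_ge0 ?sqr_ge0.
  by rewrite expr2; nra.
have t0 : 0 < t - 1 by rewrite subr_gt0.
have [C0 C1] : 0 <= C /\ 0 <= C / (t - 1).
  have C0 : 0 <= C by apply: le_trans (H 0%N); rewrite expr0.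
  by split=> //; rewrite divr_ge0 // ltW.
have [m] : exists m : nat, C / (t - 1) < m%:R.
  by exists (Num.bound (C / (t - 1))); apply: archi_boundP.
rewrite ltr_pdivrMr // => Hm; have := le_trans (B m) (H m); lra.
Qed.

(* [lam] and [11 - lam] are the roots of [t^2 - 11 t + 1], and [8 < 11 - lam]. *)
Lemma bounded_recurrence (u : nat -> R) (C : R) : (forall i, u i.+2 = 11 * u i.+1 - u i) ->
  (forall i, `|u i| <= C * 8 ^+ i) -> u 1%N = lam * u 0%N.
Proof.
move=> rec H; apply/eqP; rewrite -subr_eq0; set v := u 1%N - _.
(* Removing the mode of ratio [lam] leaves a geometric sequence of ratio 11 - [lam], which outgrows
   8^i unless v = 0. *)
have V i : u i.+1 - lam * u i = (11 - lam) ^+ i * v.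
  elim: i => [|i IH]; first by rewrite expr0 mul1r.
  rewrite exprS -mulrA -IH rec; have := lam_root.
  move: (u i.+1) (u i) lam => x y l h; rewrite mulrBr mulrA h; ring.
have [l1 l2] := lam_bounds.
have C0 : 0 <= C by have := H 0%N; rewrite expr0 mulr1; apply: le_trans.
apply/negPn/negP => v0.
have nv : 0 < `|v| by rewrite normr_gt0.
(* The constant 9 C is 8 C + C, from the bounds on u_(n+1) and u_n relative to 8^n. *)
apply: (@expr_unbounded ((11 - lam) / 8) (9 * C / `|v|)) => [|n].
  by rewrite ltr_pdivlMr //; lra.
rewrite ler_pdivlMr // expr_div_n mulrAC ler_pdivrMr ?exprn_gt0 //.
have p0 : 0 <= 11 - lam by lra.
rewrite -[(11 - lam) ^+ n]ger0_norm ?exprn_ge0 // -normrM -V.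
apply: (le_trans (ler_normB _ _)); rewrite normrM (ger0_norm (_ : 0 <= lam)); last by lra.
have := H n.+1; have := H n; rewrite exprS; move: (8 ^+ n) => e h1 h2.
have : lam * `|u n| <= 1 * `|u n| by rewrite ler_wpM2r //; lra.
by lra.
Qed.

(** The system along one residue class: up to unimodular factors, conjugation and real parts, [X i]
    is the coefficient of index r + 3 i, [Y i] is G at index r + 3 i - 1, and [D i] marks the index
    n of the functional. *)
Variables (r : nat) (X Y D : nat -> R) (M : R).
Hypothesis Y0 : Y 0%N = r%:R * X 0%N.
Hypothesis YS : forall i, Y i.+1 = (r%:R + 3 * i%:R + 3) * X i.+1 + Y i.
Hypothesis E : forall i, (r%:R + 3 * i%:R + 3) * (X i - D i)
  - (r%:R + 3 * i%:R) * (X i.+1 - D i.+1) + 9 * Y i = 0.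
Hypothesis XM : forall i, `|X i| <= M * 8 ^+ i.

Lemma recurrence0 : r%:R * (X 1%N - D 1%N) = (r%:R + 3) * (X 0%N - D 0%N) + 9 * r%:R * X 0%N.
Proof. by have := E 0; rewrite Y0 mulr0; lra. Qed.

(** Subtract consecutive equations [E]. After [YS] every term is a multiple of r + 3 i + 3, and
    dividing by it leaves constant coefficients. *)
Lemma recurrenceS i : X i.+2 - D i.+2 = 2 * (X i.+1 - D i.+1) - (X i - D i) + 9 * X i.+1.
Proof.
have k0 : 0 < r%:R + 3 * i%:R + 3 :> R.
  by rewrite -addrA ltr_wpDl // -[3 in X in _ < X]/(3%:R) -natrM -natrD ltr0n addn_gt0 orbT.
apply: (mulfI (lt0r_neq0 k0)); have := E i.+1; have := E i; rewrite YS -!natr1.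
move: (X i.+2) (X i.+1) (X i) (D i.+2) (D i.+1) (D i) (Y i) (r%:R) (i%:R) => *; lra.
Qed.

Lemma shifted_bound k i : `|X (i + k)%N| <= M * 8 ^+ k * 8 ^+ i.
Proof. by rewrite -mulrA -exprD addnC. Qed.

(** The case where n is the first index of its class. The recurrence is homogeneous from [X 1] on,
    so X_2 = lam X_1; the equations at the start then form a linear system for X_0 and X_1, solved
    with (11 - lam) lam = 1. *)
Lemma decaying_solution0 : D 0%N = 1 -> (forall i, D i.+1 = 0) ->
  X 0%N * (10 * r%:R + 3 - r%:R * lam) = r%:R + 3 - r%:R * lam.
Proof.
move=> D0 DS; have B := @bounded_recurrence (fun i => X (i + 1)%N) _ _ (shifted_bound 1).
have h : X 2%N = lam * X 1%N.
  by apply: B => i; have := recurrenceS i.+1; rewrite !addn1 !DS; lra.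
have h0 := recurrence0; have h1 := recurrenceS 0; rewrite !DS D0 !subr0 in h0 h1.
have hl := lam_root; rewrite h in h1.
have x0 : X 0%N = 1 + (11 - lam) * X 1%N by lra.
have e : (11 - lam) * (r%:R * X 1%N) = r%:R * (X 0%N - 1) by rewrite x0; ring.
rewrite h0 in e; move: (X 0%N) (r%:R) lam hl e => x s l hl e.
have : l * ((11 - l) * ((s + 3) * (x - 1) + 9 * s * x)) = l * (s * (x - 1)) by rewrite e.
have -> : l * ((11 - l) * ((s + 3) * (x - 1) + 9 * s * x)) =
  ((11 - l) * l) * ((s + 3) * (x - 1) + 9 * s * x) by ring.
rewrite hl; lra.
Qed.

(** The case where n is the second index of its class. Decay now starts at [X 2], and three
    equations determine X_0, X_1 and X_2. *)
Lemma decaying_solution1 : D 0%N = 0 -> D 1%N = 1 -> (forall i, D i.+2 = 0) ->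
  X 1%N * ((11 - lam) * (10 * r%:R + 3) - r%:R) = (2 - lam) * (10 * r%:R + 3) - r%:R.
Proof.
move=> D0 D1 DS; have B := @bounded_recurrence (fun i => X (i + 2)%N) _ _ (shifted_bound 2).
have h : X 3%N = lam * X 2%N.
  by apply: B => i; have := recurrenceS i.+2; rewrite !addn2 !DS; lra.
have h0 := recurrence0; have h1 := recurrenceS 0; have h2 := recurrenceS 1.
rewrite !DS ?D1 D0 !subr0 in h0 h1; rewrite !DS D1 !subr0 h in h2.
have e2 : (11 - lam) * X 2%N = X 1%N - 1 by lra.
have x2 : X 2%N = lam * (X 1%N - 1) by rewrite -e2 mulrA [lam * _]mulrC lam_root mul1r.
rewrite x2 in h1.
have x0 : X 0%N = 11 * X 1%N - 2 - lam * (X 1%N - 1) by lra.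
have e : (10 * r%:R + 3) * X 0%N = r%:R * (X 1%N - 1) by lra.
by rewrite x0 in e; move: (X 1%N) (r%:R) lam e => x s l e; lra.
Qed.

End Recurrence.

Section OrbitNorms.
Context {R : realType}.
Variable zeta : R[i].
Hypothesis zeta1 : cmod zeta = 1.
Let pts := [:: zeta; zeta * omega3; zeta * omega3 ^+ 2].
Let q : R[i] := (((zeta ^+ 3)^*)%C).
Let q1 : cmod q = 1 := cmod_q zeta1.
Local Notation taylor := (taylor_coefs zeta).

Lemma re_natM n (z : R[i]) : re (n%:R * z) = n%:R * re z.
Proof.
elim: n => [|n IH]; first by rewrite !mul0r.
by rewrite -!natr1 !mulrDl !mul1r reD IH.
Qed.

Lemma mul_conj_unit : q * (q^*)%C = 1.
Proof. by rewrite cmod_mulJ q1 expr1n. Qed.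

Variables (n r' : nat) (f : R[i] -> R[i]) (a : nat -> R[i]) (s : R[i]).
Hypothesis r3 : (r' < 3)%N.
Hypothesis s1 : cmod s = 1.
Hypothesis fa : taylor f a.
Hypothesis nf : coef_functional zeta n f.

(* The factor [q ^+ i] makes the recurrence real; [s] normalizes the term of index [n]. *)
Let X i := re (s * (q ^+ i * ((a (r'.+1 + 3 * i)%N)^*)%C)).
Let Y i := re (s * (q ^+ i * ((dgeo q a (r' + 3 * i)%N)^*)%C)).
Let D i := re (s * (q ^+ i * (n == (r'.+1 + 3 * i)%N)%:R)).

Lemma orbit_Y0 : Y 0%N = r'.+1%:R * X 0%N.
Proof.
rewrite /X /Y muln0 !addn0 expr0 !mul1r -re_natM /dgeo geo3_small // /dcoef.
by rewrite rmorphM rmorph_nat mulrCA.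
Qed.

Lemma orbit_YS i : Y i.+1 = (r'.+1%:R + 3 * i%:R + 3) * X i.+1 + Y i.
Proof.
have -> : r'.+1%:R + 3 * i%:R + 3 = (r'.+1 + 3 * i + 3)%N%:R :> R by rewrite -natrM -!natrD.
rewrite /X /Y -re_natM -reD (_ : (r' + 3 * i.+1)%N = ((r' + 3 * i) + 3)%N); last by lia.
rewrite dgeo_rec (_ : (r'.+1 + 3 * i.+1)%N = (r' + 3 * i + 3).+1); last by lia.
rewrite (_ : (r'.+1 + 3 * i + 3)%N = (r' + 3 * i + 3).+1); last by lia.
rewrite rmorphD !rmorphM rmorph_nat exprSr; congr re.
rewrite (_ : s * (q ^+ i * ((dgeo q a (r' + 3 * i)%N)^*)%C) =
  s * (q ^+ i * (q * (q^*)%C) * ((dgeo q a (r' + 3 * i)%N)^*)%C)); last by rewrite mul_conj_unit mulr1.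
by ring.
Qed.

Lemma orbit_E i : (r'.+1%:R + 3 * i%:R + 3) * (X i - D i)
  - (r'.+1%:R + 3 * i%:R) * (X i.+1 - D i.+1) + 9 * Y i = 0.
Proof.
have -> : r'.+1%:R + 3 * i%:R + 3 = (r' + 3 * i).+4%N%:R :> R.
  by rewrite -natrM -!natrD; congr (_%:R); lia.
have -> : r'.+1%:R + 3 * i%:R = (r' + 3 * i).+1%N%:R :> R.
  by rewrite -natrM -natrD.
rewrite /X /Y /D (_ : (r'.+1 + 3 * i.+1)%N = (r' + 3 * i).+4); last by lia.
rewrite !addSn; have := coef_functional_eq zeta1 (r' + 3 * i) fa nf; rewrite -/q => H.
transitivity (re (s * (q ^+ i * 0))); last by rewrite !mulr0.
rewrite -H exprSr.
set u := ((a _)^*)%C; set v := ((a _)^*)%C; set w := ((dgeo _ _ _)^*)%C.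
have re_subM m (x y : R[i]) : m%:R * (re x - re y) = re (m%:R * (x - y)) by rewrite re_natM reD reN.
rewrite !re_subM -re_natM -reN -!reD; congr re; ring.
Qed.

(** Subexponential growth is used at radius 1/2; steps of length 3 turn this into the ratio 2^3 = 8,
    which is below 11 - [lam]. *)
Lemma orbit_bound : exists M : R, forall i, `|X i| <= M * 8 ^+ i.
Proof.
have h2 : 0 < (2^-1 : R) by rewrite invr_gt0.
have h1 : 2^-1 < 1 :> R by lra.
case: fa => sa _ _; have [M HM] := sa _ h2 h1.
exists (M * 2 ^+ r'.+1) => i; apply: (le_trans (norm_re_le _)).
rewrite !cmodM s1 cmodX q1 expr1n !mul1r cmod_conj.
have := HM (r'.+1 + 3 * i)%N; rewrite exprVn ler_pdivrMr ?exprn_gt0 //.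
rewrite exprD exprM mulrA (_ : 2 ^+ 3 = 8) //; by ring.
Qed.

Lemma orbit_norm_first : n = r'.+1 -> s = 1 ->
  Dmu_norm2 pts f * (10 * r'.+1%:R + 3 - r'.+1%:R * lam) = r'.+1%:R + 3 - r'.+1%:R * lam.
Proof.
move=> nr se; have [M HM] := orbit_bound.
have X0 : X 0%N = Dmu_norm2 pts f.
  by rewrite /X se muln0 addn0 expr0 !mul1r reJ -nr (coef_functional_norm zeta1 fa nf).
rewrite -X0; apply: (decaying_solution0 orbit_Y0 orbit_YS orbit_E HM) => //.
  by rewrite /D muln0 addn0 nr eqxx se expr0 !mul1r.
move=> i; rewrite /D (_ : (n == _) = false) ?mulr0 //; apply/negbTE; rewrite nr; lia.
Qed.

Lemma orbit_norm_second : n = r'.+4 -> s = (q^*)%C ->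
  Dmu_norm2 pts f * ((11 - lam) * (10 * r'.+1%:R + 3) - r'.+1%:R) =
  (2 - lam) * (10 * r'.+1%:R + 3) - r'.+1%:R.
Proof.
move=> nr se; have [M HM] := orbit_bound.
have n1 : n = (r'.+1 + 3 * 1)%N by rewrite nr; lia.
have X1 : X 1%N = Dmu_norm2 pts f.
  rewrite /X -n1 se expr1 mulrA [_ * q]mulrC mul_conj_unit mul1r reJ.
  by rewrite (coef_functional_norm zeta1 fa nf).
rewrite -X1; apply: (decaying_solution1 orbit_Y0 orbit_YS orbit_E HM) => //.
- by rewrite /D (_ : (n == _) = false) ?mulr0 //; apply/negbTE; rewrite nr; lia.
- by rewrite /D -n1 eqxx mulr1 expr1 se mulrC mul_conj_unit.
- move=> i; rewrite /D (_ : (n == _) = false) ?mulr0 //; apply/negbTE; rewrite nr; lia.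
Qed.

End OrbitNorms.

(** * Moments of normal operators *)

Section NormalMoments.
Context {R : realType}.
Variables (K : hilbert R) (S Sadj : K -> K).
Hypothesis Slin : forall (a : R[i]) (x y : K), S (a *: x + y) = a *: S x + S y.
Hypothesis SP : forall x y : K, hinner (S x) y = hinner x (Sadj y).
Hypothesis SN : forall x : K, S (Sadj x) = Sadj (S x).

Lemma hinnerDl (x y z : K) : hinner (x + y) z = hinner x z + hinner y z.
Proof. by rewrite -[x]scale1r hinner_linl mul1r scale1r. Qed.

Lemma hinner0l (z : K) : hinner 0 z = 0.
Proof. by apply: (addrI (hinner 0 z)); rewrite -hinnerDl !addr0. Qed.

Lemma hinnerZl a (x z : K) : hinner (a *: x) z = a * hinner x z.
Proof. by rewrite -[a *: x]addr0 hinner_linl hinner0l addr0. Qed.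

Lemma hinnerDr (x y z : K) : hinner z (x + y) = hinner z x + hinner z y.
Proof. by rewrite hinner_conj hinnerDl (rmorphD (@conjc R)) [hinner z x]hinner_conj [hinner z y]hinner_conj. Qed.

Lemma hinnerZr a (x z : K) : hinner z (a *: x) = (a^*)%C * hinner z x.
Proof. by rewrite hinner_conj hinnerZl (rmorphM (@conjc R)) [hinner z x]hinner_conj. Qed.

Lemma hinner_ge0 (x : K) : 0 <= re (hinner x x).
Proof.
have [->|x0] := eqVneq x 0; first by rewrite hinner0l.
by have := hinner_pos x0; rewrite ltcE /= => /andP[_ /ltW].
Qed.

Let A (x : K) : K := Sadj (S x).

(** Normality moves [Sadj] past the powers of S, so one S on each side is traded for a single [A] in
    one slot. *)
Lemma moment_adj k (x y : K) : hinner (iter k.+1 S x) (iter k.+1 S y) = hinner (iter k S x) (iter k S (A y)).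
Proof.
rewrite [iter k.+1 S x]iterS [iter k.+1 S y]iterS SP; congr hinner.
by rewrite /A; elim: k => //= k <-; rewrite SN.
Qed.

Lemma moment_adjl k (x y : K) : hinner (iter k.+1 S x) (iter k.+1 S y) = hinner (iter k S (A x)) (iter k S y).
Proof. by rewrite hinner_conj moment_adj [RHS]hinner_conj. Qed.

Definition moment (v : K) k := re (hinner (iter k S v) (iter k S v)).

(** Each [A], in whichever slot it stands, is traded back for one more S on both sides; the outer S
    accounts for the extra 1. *)
Lemma moment_shift v i j : re (hinner (S (iter i A v)) (S (iter j A v))) = moment v (i + j).+1.
Proof.
suff H k x y : hinner (iter k S (iter i A x)) (iter k S (iter j A y)) =
    hinner (iter (k + i + j) S x) (iter (k + i + j) S y).
  by rewrite (H 1%N) add1n addSn.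
elim: i k x => [|i IH] k x.
  elim: j k y => [|j IHj] k y; first by rewrite !addn0.
  by rewrite iterSr IHj !addn0 addnS moment_adj.
by rewrite [iter i.+1 A x]iterSr IH addnS addSn moment_adjl.
Qed.

(* Positivity of [|S (I - A) (2 A - I) v|^2], where [A = S^* S]. *)
Lemma normal_moment_ineq v :
  0 <= moment v 1 - 6 * moment v 2 + 13 * moment v 3 - 12 * moment v 4 + 4 * moment v 5.
Proof.
have M := moment_shift v.
(* This is (I - A) (2 A - I) v expanded. The final 0 gives every summand the shape [a *: x + y] on
   which [Slin] rewrites. *)
have H := hinner_ge0 (S ((- 2%:R) *: A (A v) + (3%:R *: A v + ((-1) *: v + 0)))).
move: H; rewrite !Slin (_ : S 0 = 0); last first.
  by have := Slin (-1) 0 0; rewrite scaler0 addr0 scaleN1r addNr.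
rewrite addr0 !(hinnerDl, hinnerDr, hinnerZl, hinnerZr).
have cN k : ((- k%:R : R[i])^*)%C = - k%:R by rewrite rmorphN rmorph_nat.
rewrite rmorph_nat cN (cN 1%N).
have := M 0%N 0%N; have := M 0%N 1%N; have := M 1%N 0%N; have := M 1%N 1%N.
have := M 0%N 2%N; have := M 2%N 0%N; have := M 2%N 1%N; have := M 1%N 2%N; have := M 2%N 2%N.
rewrite -[(2 + 2).+1]/5%N -[(1 + 2).+1]/4%N -[(2 + 1).+1]/4%N -[(2 + 0).+1]/3%N -[(0 + 2).+1]/3%N.
rewrite -[(1 + 1).+1]/3%N -[(1 + 0).+1]/2%N -[(0 + 1).+1]/2%N -[(0 + 0).+1]/1%N.
rewrite /= -/(A v) -/(A (A v)) => m22 m12 m21 m20 m02 m11 m10 m01 m00.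
have re_oppM k (z : R[i]) : re (- k%:R * z) = - (k%:R * re z) by rewrite mulNr reN re_natM.
rewrite !reD !(re_oppM, re_natM, re_oppM 1%N) m22 m12 m21 m20 m02 m11 m10 m01 m00.
lra.
Qed.

End NormalMoments.

(** Moments with positive weight are bounded above and those with negative weight below; these
    decimal bounds already give at most -0.0165, so the crude interval for l suffices. *)
Lemma moments_contradiction (R : realType) (l m1 m2 m3 m4 m5 : R) :
  9 / 100 < l -> l < 95 / 1000 ->
  m1 * (10 * 1%:R + 3 - 1%:R * l) = 1%:R + 3 - 1%:R * l ->
  m2 * (10 * 2%:R + 3 - 2%:R * l) = 2%:R + 3 - 2%:R * l ->
  m3 * (10 * 3%:R + 3 - 3%:R * l) = 3%:R + 3 - 3%:R * l ->
  m4 * ((11 - l) * (10 * 1%:R + 3) - 1%:R) = (2 - l) * (10 * 1%:R + 3) - 1%:R ->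
  m5 * ((11 - l) * (10 * 2%:R + 3) - 2%:R) = (2 - l) * (10 * 2%:R + 3) - 2%:R ->
  m1 - 6 * m2 + 13 * m3 - 12 * m4 + 4 * m5 < 0.
Proof.
move=> l1 l2 h1 h2 h3 h4 h5.
have H (m d n c : R) : 0 < d -> m * d = n -> n < c * d -> m < c.
  by move=> d0 e h; rewrite -(ltr_pM2r d0) e.
have H' (m d n c : R) : 0 < d -> m * d = n -> c * d < n -> c < m.
  by move=> d0 e h; rewrite -(ltr_pM2r d0) e.
have b1 : m1 < 304 / 1000 by apply: H h1 _; clear -l1 l2; lra.
have b2 : 210 / 1000 < m2 by apply: H' h2 _; clear -l1 l2; lra.
have b3 : m3 < 1755 / 10000 by apply: H h3 _; clear -l1 l2; lra.
have b4 : 1685 / 10000 < m4 by apply: H' h4 _; clear -l1 l2; lra.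
have b5 : m5 < 170 / 1000 by apply: H h5 _; clear -l1 l2; lra.
by clear -b1 b2 b3 b4 b5; lra.
Qed.

Theorem theorem1p1 (R : realType) (zeta1 : R[i]) (Hz1 : cmod zeta1 = 1)
  (Tp : (R[i] -> R[i]) -> (R[i] -> R[i]))
  (HTp : is_cauchy_dual_Dmu [:: zeta1; zeta1 * omega3; zeta1 * omega3 ^+ 2] Mz Tp) :
  ~ subnormal_Dmu [:: zeta1; zeta1 * omega3; zeta1 * omega3 ^+ 2] Tp.
Proof.
move=> [K [J [S [_ Jn [[Slin _] [Sadj [SP SN]]] SJ]]]].
set pts := [:: _; _; _] in HTp Jn SJ.
pose f k := iter k Tp (fun=> 1).
have ff k : coef_functional zeta1 k (f k).
  elim: k => [|k IH]; first exact: coef_functional_unit.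
  exact: coef_functional_cauchy_dual IH.
have fD k : in_Dmu pts (f k) by apply/in_Dmu_taylor => //; case: (ff k).
have Jf k : iter k S (J (f 0%N)) = J (f k) by elim: k => //= k ->; rewrite SJ.
have m k : moment S (J (f 0%N)) k = Dmu_norm2 pts (f k) by rewrite /moment Jf Jn.
have := normal_moment_ineq Slin SP SN (J (f 0%N)); rewrite !m leNgt => /negP; apply.
have [l1 l2] := @lam_bounds R.
(* The indices 1, 2, 3 come first among the positive ones in their classes mod 3; 4 and 5 come
   second. *)
have first r' : (r' < 3)%N -> Dmu_norm2 pts (f r'.+1) * (10 * r'.+1%:R + 3 - r'.+1%:R * lam) =
    r'.+1%:R + 3 - r'.+1%:R * lam.
  move=> r3; have [[a fa] _] := ff r'.+1.
  exact: (orbit_norm_first Hz1 r3 (cmod1 R) fa (ff _)).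
have second r' : (r' < 3)%N -> Dmu_norm2 pts (f r'.+4) * ((11 - lam) * (10 * r'.+1%:R + 3) - r'.+1%:R) =
    (2 - lam) * (10 * r'.+1%:R + 3) - r'.+1%:R.
  move=> r3; have [[a fa] _] := ff r'.+4.
  have s1 : cmod (((((zeta1 ^+ 3)^*)%C)^*)%C) = 1 by rewrite !cmod_conj cmodX Hz1 expr1n.
  exact: (orbit_norm_second Hz1 r3 s1 fa (ff _) erefl erefl).
exact: moments_contradiction l1 l2 (first 0%N isT) (first 1%N isT) (first 2%N isT)
  (second 0%N isT) (second 1%N isT).
Qed.
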